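(* Let $t \geq 1$ and $h \geq 4t(2t+1)$ be integers with $(t+1) \mid h$. Let $c_0 = \lfloor (\lfloor h/t \rfloor + 1)/3 \rfloor$, $\ell_0 = \lceil h/(2t+1) \rceil$, and $p_0 = t/(c_0 \ell_0 - c_0 - \ell_0 + t + 1)$. Then for all $p \in [p_0, 1/\lceil h/(2t+1) \rceil]$, \[ \mathrm{ed}_{\mathrm{Forb}(C_h^t)}(p) = \frac{p(1-p)}{t + \left( \lceil \frac{h}{2t+1} \rceil - t - 1 \right) p}. \]
   Context: $C_h$ is the cycle on $h$ vertices, and $C_h^t$ (the $t$-th power of $C_h$) is the graph on the vertex set of $C_h$ in which two vertices are adjacent if and only if their distance in $C_h$ is at most $t$. $\mathrm{Forb}(H)$ denotes the class of all graphs that do not contain $H$ as an induced subgraph. For graphs $G, G'$ on the same $n$-vertex set, $\mathrm{dist}(G,G') = |E(G) \triangle E(G')| / \binom{n}{2}$; for a class $\mathcal{H}$ of graphs, $\mathrm{dist}(G,\mathcal{H}) = \min\{\mathrm{dist}(G,G') : G' \in \mathcal{H}, V(G') = V(G)\}$. The edit distance function is \[ \mathrm{ed}_{\mathcal{H}}(p) = \lim_{n\to\infty} \max\{\mathrm{dist}(G,\mathcal{H}) : |V(G)| = n, |E(G)| = \lfloor p\binom{n}{2} \rfloor\}, \] which exists for every non-trivial hereditary property $\mathcal{H}$ (a class closed under isomorphism and induced subgraphs containing graphs of arbitrarily large order). *)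

(* Defs.v *)
From HB Require Import structures.
From mathcomp Require Import all_boot all_order all_algebra.
From mathcomp Require Import all_classical all_reals all_analysis.

Set Implicit Arguments.
Unset Strict Implicit.
Unset Printing Implicit Defensive.

Import Order.TTheory GRing.Theory Num.Theory.
Import numFieldNormedType.Exports.

Local Open Scope ring_scope.

Record graph (V : finType) := Graph {
  edges : {set {set V}};
  edgesP : [forall e in edges, #|e| == 2] }.

HB.instance Definition _ (V : finType) := [isSub for @edges V].
HB.instance Definition _ (V : finType) := [Countable of graph V by <:].
HB.instance Definition _ (V : finType) := [Finite of graph V by <:].

(* For x = y the set [set x; y] is a singleton, hence not an edge. *)
Definition adj (V : finType) (G : graph V) : rel V :=
  fun x y => [set x; y] \in edges G.

Definition rel_edges (V : finType) (r : rel V) : {set {set V}} :=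
  [set e | [exists x, exists y, [&& x != y, r x y & e == [set x; y]]]].

Lemma rel_edgesP (V : finType) (r : rel V) :
  [forall e in rel_edges r, #|e| == 2].
Proof.
apply/forall_inP => e; rewrite inE => /existsP[x /existsP[y]].
by case/and3P => xy _ /eqP ->; rewrite cards2 xy.
Qed.

(* Loops of r are dropped and r is symmetrized, see adj_graph_of_rel. *)
Definition graph_of_rel (V : finType) (r : rel V) : graph V :=
  Graph (rel_edgesP r).

Lemma adj_graph_of_rel (V : finType) (r : rel V) (x y : V) :
  adj (graph_of_rel r) x y = (x != y) && (r x y || r y x).
Proof.
rewrite /adj inE; apply/existsP/andP => [[a /existsP[b]]|[xy]].
  case/and3P => ab rab /eqP E.
  have xy : x != y.
    by move: (congr1 (fun A : {set V} => #|A|) E); rewrite !cards2 ab; case: eqP.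
  split=> //.
  have : x \in [set a; b] by rewrite -E set21.
  have : y \in [set a; b] by rewrite -E set22.
  move: xy; rewrite !inE => xy /orP[] /eqP ya /orP[] /eqP xa; subst x y;
    by rewrite ?rab ?orbT //; rewrite eqxx in xy.
case/orP => rxy; [exists x; apply/existsP; exists y|exists y; apply/existsP; exists x].
  by rewrite xy rxy eqxx.
by rewrite eq_sym xy rxy finset.setUC eqxx.
Qed.

Definition cycle_graph (h : nat) : graph 'I_h :=
  graph_of_rel (fun i j : 'I_h => j == ordS i).

(* The distance from x to y in G is at most t: some walk of length k <= t
   leads from x to y. *)
Definition dist_le (V : finType) (G : graph V) (t : nat) : rel V :=
  fun x y => [exists k : 'I_t.+1, exists s : k.-tuple V,
                path (adj G) x s && (last x s == y)].

Definition graph_power (V : finType) (G : graph V) (t : nat) : graph V :=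
  graph_of_rel (dist_le G t).

Definition induced_subgraph (W V : finType) (H : graph W) (G : graph V) : bool :=
  [exists f : {ffun W -> V}, injectiveb f &&
    [forall x, forall y, adj G (f x) (f y) == adj H x y]].

Definition graph_class := forall V : finType, pred (graph V).

Definition Forb (W : finType) (H : graph W) : graph_class :=
  fun V G => ~~ induced_subgraph H G.

Section EditDistance.
Variable R : realType.

Definition graph_dist (V : finType) (G G' : graph V) : R :=
  #|(edges G :\: edges G') :|: (edges G' :\: edges G)|%:R / 'C(#|V|, 2)%:R.

(* As graph_dist is at most 1, the initial value 1 does not affect the minimum
   whenever P contains a graph on V. *)
Definition class_dist (P : graph_class) (V : finType) (G : graph V) : R :=
  \big[Num.min/1]_(G' : graph V | P V G') graph_dist G G'.

(* As class_dist is nonnegative, the initial value 0 does not affect the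
   maximum whenever some graph has the prescribed number of edges, that is,
   whenever 0 <= p <= 1. *)
Definition max_class_dist (P : graph_class) (p : R) (n : nat) : R :=
  \big[Num.max/0]_(G : graph 'I_n |
      #|edges G|%:Z == Num.floor (p * 'C(n, 2)%:R)) class_dist P G.

Definition edit_distance (P : graph_class) (p : R) : R :=
  limn (max_class_dist P p).

End EditDistance.

(* Main.v *)
(* Write l = ceil(h / (2t+1)) and g = p(1-p) / (t(1-p) + (l-1)p).

   Upper bound: colour the vertices at random with t "independent" colours of
   weight (1-p)/D and l-1 "clique" colours of weight p/D, D = t(1-p) + (l-1)p, and
   make each colour class independent or complete.  About g C(n,2) pairs change on
   average, and C_h^t has no partition into t independent sets and l-1 cliques.

   Lower bound: let G be a quasirandom graph of density p; explicitly, join (a,b)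
   to (c,d) in F_q x F_q when ac + b + d lies in a set of about pq elements.  If
   G' has no induced C_h^t, a regular partition of G', the box lemma and Ramsey's
   theorem give a coloured reduced graph K into which C_h^t does not embed and
   whose cost is at most the distance from G to G'.  So it suffices that every
   such weighted K costs at least g.

   In a cheapest counterexample all weights are positive, white vertices are
   joined to everything by gray edges, and pairs of black vertices are gray or
   white.  Let w be the number of white vertices.  C_h^t embeds if w > t (colour
   modulo t+1), if w = t and there are l black vertices, and if w < t and the gray
   graph on the black vertices has a cycle of length in [h/(t+w+1), h/t].  The
   optimality conditions bound the gray weighted degrees from below.  A longest
   path with heaviest possible end then yields a cycle of length at least
   h/(t+w+1).  A shortest such cycle, if longer than h/t, has few chords: for
   w = t-1 every vertex has at most 3 neighbours on it, which contradicts the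
   degrees because its length is at least 3 c0; for w < t-1 two of its vertices
   have too many common neighbours, all of them on the cycle. *)

Require Import Defs.
From mathcomp Require Import all_boot all_order all_algebra.
From mathcomp Require Import all_classical all_reals all_analysis.
From mathcomp Require Import finfield.
From mathcomp Require Import zify ring lra.

Set Implicit Arguments.
Unset Strict Implicit.
Unset Printing Implicit Defensive.

Import Order.TTheory GRing.Theory Num.Theory.
Import numFieldNormedType.Exports.

Local Open Scope ring_scope.

(** * Powers of cycles *)

(** The upper bound is the cost of the reduced graph with [t] white and [l - 1] black vertices and
    only gray pairs; the difficulty is that no other reduced graph may beat it. Optimality turns
    this into extremal graph theory: at an interior minimizer all rows of the cost matrix have the
    same weighted sum, so the gray degree of a black vertex is a function of its weight, which is at
    most [ga * p / (1 - p)], where [ga], the value divided by [p], is the weight of a white vertex.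
    A set of large weight thus has many vertices. Both ends of the range of [p] enter this
    bookkeeping: [l * p <= 1] gives [core_slack], which serves every number of white vertices, and
    [p0 <= p] is what the double count over an induced cycle requires. There [h %/ t + 1] is the
    least length of a cycle too long for the embedding, and [c0] is a third of it because a vertex
    sees at most three of its vertices. The bound on [h] is matched to
    [(W + 1) * (2 * t + 1 - W) >= 4 * t] for [W = t - w]. In the dense part a random sample of
    boundedly many vertices, with a penalty on bad pairs, replaces the cleaning of a reduced
    graph. *)

Lemma modn_eq_cases (h u v : nat) : (0 < h)%N -> u = v %[mod h] ->
  (u < v + 2 * h)%N -> (v < u + h)%N -> u = v \/ u = (v + h)%N.
Proof.
move=> h0 uv lt1 lt2; have [q1 eu] : exists q, u = (q * h + u %% h)%N.
  by exists (u %/ h)%N; apply: divn_eq.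
have [q2 ev] : exists q, v = (q * h + u %% h)%N.
  by exists (v %/ h)%N; rewrite uv; apply: divn_eq.
move: eu ev; set r := (u %% h)%N => eu ev.
have [q12|] := leqP q1 q2; last first.
  move=> q21; have [?|?] := leqP (q2 + 2) q1.
    have : ((q2 + 2) * h <= q1 * h)%N by rewrite leq_mul2r; lia.
    by lia.
  have e : q1 = q2.+1 by lia.
  by right; rewrite eu ev e mulSn; lia.
have [?|?] := leqP (q1 + 1) q2; last by left; rewrite eu ev; congr (_ * _ + _)%N; lia.
have : ((q1 + 1) * h <= q2 * h)%N by rewrite leq_mul2r; lia.
by lia.
Qed.

(** [a] counts the forward steps and [b] the backward ones; keeping both avoids subtraction modulo
    [h]. *)
Lemma cycle_walk_mod (h : nat) (x : 'I_h) (s : seq 'I_h) :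
  path (adj (cycle_graph h)) x s ->
  exists a b, (a + b = size s)%N /\ (last x s + b = x + a %[mod h])%N.
Proof.
elim: s x => [|y s IHs] x /=; first by exists 0, 0.
case/andP; rewrite adj_graph_of_rel => /andP[_ xy] /IHs[a [b [eab e]]].
case/orP: xy => /eqP xy.
  exists a.+1, b; split; first by lia.
  by rewrite e xy /= modnDml addSnnS.
exists a, b.+1; split; first by lia.
by rewrite xy /= modnDml addnS -addn1 -modnDml e modnDml; congr (_ %% _)%N; lia.
Qed.

Lemma cycle_walk_traject (h k : nat) (x : 'I_h) : (1 < h)%N ->
  path (adj (cycle_graph h)) x (traject (@ordS h) (ordS x) k) /\
  nat_of_ord (last x (traject (@ordS h) (ordS x) k)) = ((x + k) %% h)%N.
Proof.
move=> h1; elim: k x => [|k IHk] x /=; first by rewrite addn0 modn_small.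
have [p e] := IHk (ordS x); split; last first.
  by rewrite e /= modnDml addSnnS.
rewrite p andbT adj_graph_of_rel eqxx /= andbT.
apply/eqP => /(congr1 val) /= E; have xh := ltn_ord x.
have [|sx] := ltnP x.+1 h; first by move=> ?; rewrite modn_small in E; lia.
have sxh : x.+1 = h by lia.
by rewrite sxh modnn in E; lia.
Qed.

Lemma adj_cycle_power (h t : nat) (i j : 'I_h) : (t < h)%N -> (i < j)%N ->
  adj (graph_power (cycle_graph h) t) i j = (j - i <= t)%N || (h + i - j <= t)%N.
Proof.
move=> th ij; have jh := ltn_ord j.
have h1 : (1 < h)%N by lia.
rewrite adj_graph_of_rel.
have -> : i != j by apply/eqP => E; rewrite E ltnn in ij.
rewrite /=; apply/orP/orP.
  have key (x y : 'I_h) : dist_le (cycle_graph h) t x y ->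
      exists a b, (a + b <= t)%N /\ (y + b = x + a %[mod h])%N.
    case/existsP=> k /existsP[s /andP[/cycle_walk_mod[a [b [e m]]] /eqP <-]].
    exists a, b; split=> //; rewrite e size_tuple.
    by have := ltn_ord k; lia.
  case=> /key[a [b [ab m]]].
    by case: (modn_eq_cases _ m); lia.
  by move/esym: m => m; case: (modn_eq_cases _ m); lia.
have key (x : 'I_h) k : (k <= t)%N -> forall y : 'I_h, ((x + k) %% h = y)%N ->
    dist_le (cycle_graph h) t x y.
  move=> kt y e; have [p l] := cycle_walk_traject k x h1.
  apply/existsP; exists (Ordinal (kt : k < t.+1)%N).
  apply/existsP; exists (Tuple (introT eqP (size_traject (@ordS h) (ordS x) k))).
  by rewrite /= p /=; apply/eqP/val_inj; rewrite /= l.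
case=> le.
  by left; apply: (key i (j - i)%N) => //; rewrite subnKC ?modn_small // ltnW.
right; apply: (key j (h + i - j)%N) => //.
by rewrite subnKC ?modnDl ?modn_small //; lia.
Qed.

Lemma adjC (V : finType) (G : graph V) (x y : V) : adj G x y = adj G y x.
Proof. by rewrite /adj finset.setUC. Qed.

Lemma adjxx (V : finType) (G : graph V) (x : V) : adj G x x = false.
Proof.
rewrite /adj; apply/negP => xE; have /forall_inP/(_ _ xE) := edgesP G.
by rewrite finset.setUid cards1.
Qed.

(* A coloured reduced graph is encoded by al : bool -> rel T: al true u v (resp.
   al false u v) says that vertices placed at u and v may be adjacent (resp.
   nonadjacent).  Gray pairs allow both, white ones only false, black ones only
   true; the colour of a vertex u is given by al be u u. *)
Definition embeds (h : nat) (H : graph 'I_h) (T : Type) (al : bool -> rel T) :=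
  exists f : 'I_h -> T, forall i j, i != j -> al (adj H i j) (f i) (f j).

(** * Cutting the cycle into blocks *)

Section Blocks.
Variables (h l lo hi : nat).
Hypotheses (l0 : (0 < l)%N) (hlo : (lo * l <= h)%N) (hhi : (h <= hi * l)%N).

(** This is [b * h / l] rounded up. Consecutive values differ by the floor or the ceiling of
    [h / l], whence [lo] and [hi] bound the block sizes. *)
Definition block_start (b : nat) := ((b * h + l.-1) %/ l)%N.

Lemma block_startS b :
  (block_start b + lo <= block_start b.+1 <= block_start b + hi)%N.
Proof.
rewrite /block_start mulSn.
rewrite [X in (X <= _ <= _)%N]addnC [X in (_ <= _ <= X)%N]addnC.
rewrite -(divnMDl lo _ l0) -(divnMDl hi _ l0).
by rewrite !leq_div2r //; lia.
Qed.

Lemma block_start0 : block_start 0 = 0%N.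
Proof. by rewrite /block_start divn_small; lia. Qed.

Lemma block_startl : block_start l = h.
Proof. by rewrite /block_start mulnC divnMDl // divn_small; lia. Qed.

Lemma block_start_lt b b' : (b < b')%N -> (block_start b + lo <= block_start b')%N.
Proof.
elim: b' => // b' IH; rewrite ltnS leq_eqVlt => /orP[/eqP->|/IH].
  by have /andP[] := block_startS b'.
by have /andP[] := block_startS b'; lia.
Qed.

Lemma block_start_le b b' : (b <= b')%N -> (block_start b <= block_start b')%N.
Proof.
by rewrite leq_eqVlt => /orP[/eqP->//|/block_start_lt]; lia.
Qed.

Lemma block_of i : (i < h)%N ->
  exists b, [/\ (b < l)%N, (block_start b <= i)%N & (i < block_start b.+1)%N].
Proof.
move=> ih; have ex : exists b, (i < block_start b.+1)%N.
  by exists l.-1; rewrite prednK // block_startl.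
case: (ex_minnP ex) => b ib bmin; exists b; split => //.
  have : (b <= l.-1)%N by apply: bmin; rewrite prednK // block_startl.
  by lia.
case: b ib bmin => [|b] _ bmin; first by rewrite block_start0.
by rewrite leqNgt; apply/negP => /bmin; rewrite ltnn.
Qed.
End Blocks.

(* The vertices of the cycle are cut into l consecutive blocks of nearly equal
   size; the first w vertices of each block go to w white vertices and the rest
   of the b-th block goes to the black vertex bl b. *)
Lemma embeds_blocks (h t w l lo hi : nat) (T : Type) (al : bool -> rel T)
    (wh bl : nat -> T) :
  (t < h)%N -> (2 < l)%N -> (lo * l <= h)%N -> (h <= hi * l)%N ->
  (t <= lo)%N -> ((0 < w)%N -> (t < lo)%N) -> (hi <= t.+1 + w)%N ->
  (forall be x y, al be x y = al be y x) ->
  (forall be a a', (a < w)%N -> (a' < w)%N -> a != a' -> al be (wh a) (wh a')) ->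
  (forall be a b, (a < w)%N -> (b < l)%N -> al be (wh a) (bl b)) ->
  (forall a, (a < w)%N -> al false (wh a) (wh a)) ->
  (forall b, (b < l)%N -> al true (bl b) (bl b)) ->
  (forall b b', (b < l)%N -> (b' < l)%N -> b != b' -> al false (bl b) (bl b')) ->
  ((w < t)%N -> forall b, (b < l)%N -> al true (bl b) (bl (b.+1 %% l)%N)) ->
  embeds (graph_power (cycle_graph h) t) al.
Proof.
move=> th l2 hlo hhi tlo wlo hiw alC ww wb w_ b_ bb bS.
have l0 : (0 < l)%N by lia.
pose B (i : 'I_h) := block_of l0 hlo hhi (ltn_ord i).
have [blk blkP] := choice B.
pose o (i : 'I_h) := (i - block_start h l (blk i))%N.
exists (fun i => if (o i < w)%N then wh (o i) else bl (blk i)).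
suff key (i j : 'I_h) : (i < j)%N ->
    al (adj (graph_power (cycle_graph h) t) i j)
      (if (o i < w)%N then wh (o i) else bl (blk i))
      (if (o j < w)%N then wh (o j) else bl (blk j)).
  move=> i j; rewrite neq_ltn => /orP[/key //|/key].
  by rewrite adjC alC.
move=> ij; rewrite adj_cycle_power //.
have [bi si ei] := blkP i; have [bj sj ej] := blkP j.
have sS := block_startS l0 hlo hhi; have slt := block_start_lt l0 hlo hhi.
have sle := block_start_le l0 hlo hhi.
have s0 := block_start0 l0 hlo hhi; have sl := block_startl l0 hlo hhi.
have jh := ltn_ord j.
have bij : (blk i <= blk j)%N.
  rewrite leqNgt; apply/negP => ji.
  by have := sle _ _ ji; lia.
case: ifP => oi; case: ifP => oj.
(* Equal offsets in different blocks: both arcs between [i] and [j] have length at least [lo], and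
   [lo > t]. *)
- have [oij|] := eqVneq (o i) (o j); last exact: ww.
  have bne : (blk i < blk j)%N.
    rewrite ltn_neqAle bij andbT; apply/eqP => E.
    by move: oij si; rewrite /o E; lia.
  have := slt _ _ bne; have := slt _ _ bj; rewrite sl => d1 d2.
  have w0 : (0 < w)%N by lia.
  have := wlo w0 => tl.
  have -> : (j - i <= t)%N || (h + i - j <= t)%N = false.
    apply/negbTE; rewrite negb_or -!ltnNge.
    by move: oij; rewrite /o => oij; apply/andP; split; lia.
  by rewrite oij w_.
- exact: wb.
- by rewrite alC wb.
(* A block has at most [hi - w <= t.+1] black positions, so these are pairwise adjacent. *)
have [E|bne] := eqVneq (blk i) (blk j).
  have /andP[_ d] := sS (blk j).
  have -> : (j - i <= t)%N || (h + i - j <= t)%N = true.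
    by apply/orP; left; move: oi oj d si; rewrite /o E; lia.
  by rewrite E b_.
have bl_ij : (blk i < blk j)%N by rewrite ltn_neqAle bne.
case: orP => [adj_ij|_]; last exact: bb.
have oi' : (block_start h l (blk i) + w <= i)%N by move: oi; rewrite /o; lia.
have oj' : (block_start h l (blk j) + w <= j)%N by move: oj; rewrite /o; lia.
(* A full block between two black positions would separate them by more than [lo >= t], so the
   blocks are consecutive, possibly across the end of the cycle. The [w] white positions skipped in
   the later block then force [w < t], and [bS] applies. *)
case: adj_ij => [d|d].
  have E : blk j = (blk i).+1.
    apply/eqP; rewrite eqn_leq bl_ij andbT leqNgt; apply/negP => /slt.
    by lia.
  have wt : (w < t)%N by move: oj'; rewrite E; lia.
  have := bS wt _ bi; rewrite -E modn_small //.
have Ej : blk j = l.-1.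
  apply/eqP; rewrite eqn_leq; apply/andP; split; first by lia.
  rewrite leqNgt; apply/negP => lt.
  have : ((blk j).+1 < l)%N by lia.
  by move/slt; rewrite sl; lia.
have Ei : blk i = 0%N.
  apply/eqP; rewrite -leqn0 leqNgt; apply/negP => /slt; rewrite s0.
  have : (block_start h l (blk j).+1 <= h)%N by rewrite -[X in (_ <= X)%N]sl; apply: sle.
  by lia.
have wt : (w < t)%N.
  by move: ej; rewrite Ej prednK // sl; move: oi'; rewrite Ei s0; lia.
have := bS wt _ bj; rewrite Ej prednK // modnn Ei alC; exact.
Qed.

(** Positions are coloured by their residue modulo [t.+1]. As [t.+1] divides [h], both arcs between
    two positions of one colour are multiples of [t.+1], hence longer than [t]. *)
Lemma embeds_color (h t : nat) (T : Type) (al : bool -> rel T) (wh : nat -> T) :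
  (t < h)%N -> (t.+1 %| h)%N ->
  (forall be a a', (a < t.+1)%N -> (a' < t.+1)%N -> a != a' -> al be (wh a) (wh a')) ->
  (forall a, (a < t.+1)%N -> al false (wh a) (wh a)) ->
  embeds (graph_power (cycle_graph h) t) al.
Proof.
move=> th /dvdnP[k hk] ww w_.
exists (fun i : 'I_h => wh (i %% t.+1)%N) => i j ij.
have mt n : (n %% t.+1 < t.+1)%N by rewrite ltn_pmod.
have [E|] := eqVneq (i %% t.+1)%N (j %% t.+1)%N; last by apply: ww.
suff -> : adj (graph_power (cycle_graph h) t) i j = false by rewrite E w_.
have key (x y : 'I_h) : (x < y)%N -> x = y %[mod t.+1] ->
    adj (graph_power (cycle_graph h) t) x y = false.
  move=> xy; rewrite adj_cycle_power // => /esym/eqP.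
  rewrite eqn_mod_dvd ?(ltnW xy) // => dv; have yh := ltn_ord y.
  apply/negP => /orP[]; apply/negP; rewrite -ltnNge.
    by apply: dvdn_leq => //; lia.
  apply: dvdn_leq; first by lia.
  have -> : (h + x - y = h - (y - x))%N by lia.
  by apply: dvdn_sub => //; rewrite hk dvdn_mull.
by move: ij; rewrite neq_ltn => /orP[/key|/key]; [exact|rewrite adjC; apply].
Qed.

(** * Cliques in powers of cycles *)

Section Windows.
Variables (h t : nat).
Hypothesis (h3t : (3 * t < h)%N).

Let h0 : (0 < h)%N. Proof. exact: leq_ltn_trans h3t. Qed.

Definition shift (i : 'I_h) (a : nat) : 'I_h := Ordinal (ltn_pmod (i + a) h0).

Lemma adj_shift (i : 'I_h) (a : nat) : (0 < a)%N -> (a <= t)%N ->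
  adj (graph_power (cycle_graph h) t) i (shift i a).
Proof.
move=> a0 lat; have ih := ltn_ord i; have th : (t < h)%N by lia.
have [iah|hia] := ltnP (i + a) h.
  have e : shift i a = (i + a)%N :> nat by rewrite /= modn_small.
  by rewrite adj_cycle_power ?e ?addKn ?lat //; lia.
have e : shift i a = (i + a - h)%N :> nat.
  by rewrite /= -[in LHS](subnK hia) modnDr modn_small //; lia.
rewrite adjC adj_cycle_power ?e //; last by lia.
by apply/orP; right; lia.
Qed.

Lemma shift_adj (i : 'I_h) (a : nat) : (t < a)%N -> (a < h - t)%N ->
  adj (graph_power (cycle_graph h) t) i (shift i a) = false.
Proof.
move=> ta aht; have ih := ltn_ord i; have th : (t < h)%N by lia.
have [iah|hia] := ltnP (i + a) h.
  have e : shift i a = (i + a)%N :> nat by rewrite /= modn_small.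
  by rewrite adj_cycle_power ?e //; lia.
have e : shift i a = (i + a - h)%N :> nat.
  by rewrite /= -[in LHS](subnK hia) modnDr modn_small //; lia.
by rewrite adjC adj_cycle_power ?e //; lia.
Qed.

Lemma shift_shift (i : 'I_h) (a b : nat) : shift (shift i a) b = shift i (a + b).
Proof. by apply/val_inj; rewrite /= modnDml addnA. Qed.

Lemma shift_neq (i : 'I_h) (a : nat) : (0 < a)%N -> (a < h)%N -> shift i a != i.
Proof.
move=> a0 ah; apply/eqP => /(congr1 val) /= E; have ih := ltn_ord i.
have [iah|hia] := ltnP (i + a) h; first by rewrite modn_small in E; lia.
by move: E; rewrite -[in LHS](subnK hia) modnDr modn_small; lia.
Qed.

Lemma shift_surj (i j : 'I_h) : exists2 a, (a < h)%N & j = shift i a.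
Proof.
exists ((j + (h - i)) %% h)%N; first by rewrite ltn_pmod.
apply/val_inj; rewrite /= modnDmr addnC -addnA subnK ?(ltnW (ltn_ord i)) //.
by rewrite modnDr modn_small.
Qed.

(** [3 * t < h] keeps a clique from closing up around the cycle. Counted from the position [t]
    before [v], the clique has offsets at most [2 * t]; counted from its first element, an offset
    beyond [t] is still below [h - t], hence a nonedge. *)
Lemma clique_window (K : {set 'I_h}) (v : 'I_h) : v \in K ->
  {in K &, forall x y, x != y -> adj (graph_power (cycle_graph h) t) x y} ->
  exists s, forall x, x \in K -> exists2 a, (a <= t)%N & x = shift s a.
Proof.
move=> vK clK; pose u := shift v (h - t).
have ut : shift u t = v.
  rewrite shift_shift subnK; last by lia.
  by apply/val_inj; rewrite /= modnDr modn_small.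
have near x : x \in K -> exists a, (a <= 2 * t)%N && (x == shift u a).
  move=> xK; have [->|] := eqVneq x v.
    by exists t; rewrite ut eqxx andbT; lia.
  have [a ah e] := shift_surj u x => ne; rewrite e.
  exists a; rewrite eqxx andbT leqNgt; apply/negP => ta.
  have xE : shift u a = shift v (a - t) by rewrite -ut shift_shift subnKC //; lia.
  have F : adj (graph_power (cycle_graph h) t) v (shift v (a - t)) = false.
    by apply: shift_adj; lia.
  have := clK v x vK xK; rewrite eq_sym => /(_ ne).
  by rewrite e xE F.
have [s0 /andP[s0t /eqP s0E]] := near v vK.
have ex : exists a, (a <= 2 * t)%N && (shift u a \in K).
  by exists s0; rewrite s0t -s0E.
case: (ex_minnP ex) => s /andP[st sK] smin.
exists (shift u s) => x xK; have [a /andP[lat /eqP xE]] := near x xK.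
have sa : (s <= a)%N by apply: smin; rewrite lat -xE.
exists (a - s)%N; last by rewrite shift_shift subnKC.
rewrite leqNgt; apply/negP => ta.
have xE2 : x = shift (shift u s) (a - s)%N by rewrite shift_shift subnKC.
have F : adj (graph_power (cycle_graph h) t) (shift u s) x = false.
  by rewrite xE2; apply: shift_adj; lia.
have := clK _ _ sK xK; rewrite F => /contraFF/(_ erefl)/eqP E.
by move: (shift_neq (shift u s) (a := a - s)); rewrite -xE2 -E eqxx; lia.
Qed.
End Windows.

(* The vertices x such that one of x, ..., x + t lies in a given clique form an
   interval of length at most 2 t + 1, so l.-1 cliques leave some t + 1
   consecutive vertices uncovered; these need t + 1 colors. *)
Lemma cycle_power_unsplittable (h t l : nat) : (3 * t < h)%N ->
  (l.-1 * (2 * t + 1) < h)%N ->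
  forall f : 'I_h -> 'I_t + 'I_l.-1,
  exists x y, [/\ x != y, f x = f y &
    adj (graph_power (cycle_graph h) t) x y = is_inl (f x)].
Proof.
move=> h3t lh f; set A := adj _.
have h0 : (0 < h)%N by lia.
apply: contrapT => nf.
have white x y c : x != y -> f x = inl c -> f y = inl c -> A x y = false.
  move=> xy fx fy; apply/negP => Axy; apply: nf; exists x, y.
  by rewrite fx fy; split => //; rewrite -/A Axy.
have black x y c : x != y -> f x = inr c -> f y = inr c -> A x y.
  move=> xy fx fy; apply/negPn/negP => Axy; apply: nf; exists x, y.
  by rewrite fx fy; split => //; rewrite -/A (negbTE Axy).
pose sh := shift h3t.
pose hit c := [set x : 'I_h | [exists a : 'I_t.+1, f (sh x a) == inr c]].
have hit_le c : (#|hit c| <= 2 * t + 1)%N.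
  have [v /eqP vc|no] := pickP [pred v | f v == inr c]; last first.
    rewrite (_ : hit c = finset.set0) ?cards0 //; apply/finset.setP => x.
    by rewrite !inE; apply/existsP => -[a E]; have := no (sh x a); rewrite /= E.
  pose K := [set v | f v == inr c].
  have [||s sP] := @clique_window h t h3t K v.
  - by rewrite inE vc.
  - by move=> x y; rewrite !inE => /eqP xc /eqP yc xy; apply: (black _ _ c).
  (* [g] runs from [s - t] to [s + t]; adding [h - t] stands for subtracting [t]. *)
  pose g (b : 'I_(2 * t + 1)) := sh s (b + (h - t))%N.
  rewrite -[X in (_ <= X)%N](card_ord (2 * t + 1)) -cardsT.
  apply: leq_trans (leq_imset_card g _); apply: subset_leq_card.
  apply/fintype.subsetP => x; rewrite inE => /existsP[a xa].
  have [|b bt xb] := sP (sh x a); first by rewrite inE.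
  have bat : (b + t - a < 2 * t + 1)%N by lia.
  apply/imsetP; exists (Ordinal bat) => //; rewrite /g /=.
  have at' := ltn_ord a.
  have -> : x = sh (sh x a) (h - a)%N.
    rewrite /sh shift_shift subnKC; last by lia.
    by apply/val_inj; rewrite /= modnDr modn_small.
  by rewrite xb /sh shift_shift; congr (shift _ _ _); lia.
have [x xno] : exists x, x \notin \bigcup_(c : 'I_l.-1) hit c.
  apply: contrapT => /forallNP all; have : (h <= l.-1 * (2 * t + 1))%N.
    rewrite -[X in (X <= _)%N](card_ord h) -cardsT.
    have -> : [set: 'I_h] = \bigcup_(c : 'I_l.-1) hit c.
      by apply/finset.setP => x; rewrite inE; have /negP/negPn -> := all x.
    have -> : (l.-1 * (2 * t + 1) = \sum_(c : 'I_l.-1) (2 * t + 1))%N.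
      by rewrite sum_nat_const card_ord.
    elim/big_ind2: _ => [|B m B' m' Bm Bm'|c _]; [by rewrite cards0| |exact: hit_le].
    by apply: leq_trans (leq_card_setU _ _) (leq_add Bm Bm').
  by lia.
have col (a : 'I_t.+1) : exists c, f (sh x a) = inl c.
  case E : (f (sh x a)) => [c|c]; first by exists c.
  case/negP: xno; apply/bigcupP; exists c => //.
  by rewrite inE; apply/existsP; exists a; rewrite E.
have [c cP] := choice col.
have /injectivePn[a [b ab cab]] : ~~ injectiveb c.
  apply/negP => /injectiveP/leq_card; rewrite !card_ord; lia.
wlog lt_ab : a b ab cab / (a < b)%N.
  move=> wl; have [ab'|ba|E] := ltngtP a b; first exact: (wl a b).
    by apply: (wl b a) => //; rewrite eq_sym.
  by rewrite (val_inj E) eqxx in ab.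
have bt := ltn_ord b.
have e : sh (sh x a) (b - a)%N = sh x b by rewrite /sh shift_shift subnKC // ltnW.
have ne : sh x a != sh x b.
  by rewrite eq_sym -e; apply: shift_neq; lia.
have := white _ _ _ ne (cP a); rewrite cab => /(_ (cP b)).
rewrite -e [A _ _]adj_shift //; lia.
Qed.

(** * Long cycles in weighted graphs *)

(** For [long_cycle]: [a i] says that the [i]-th vertex of a path is adjacent to its first vertex,
    whose weight is [X]. With [K] marked positions, [S] of them followed by a marked one, the sum is
    at most [S * X + (K - S) * M]. This is affine in [X], so it is enough to look at [X = 0] and
    [X = M], where [2 * K - S <= m] (marked positions and their predecessors lie below [m]) and
    [K + 1 <= m] (position 0 is unmarked) settle the matter. *)
Lemma initial_segment_sum (R : realFieldType) (a : nat -> bool) (m : nat)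
    (F : nat -> R) (A k X M : R) :
  (0 < m)%N -> a 0 = false -> (forall i, a i -> i < m)%N -> 0 <= X <= M ->
  (forall i, a i -> F i <= M) -> (forall i, a i -> a i.+1 -> F i <= X) ->
  m%:R * M < 2 * A -> m%:R * M < A + (k + 1) * M ->
  \sum_(0 <= i < m | a i) F i < A + k * X.
Proof.
move=> m0 a0 am /andP[X0 XM] FM FX mA mk.
pose K : R := \sum_(0 <= i < m) (a i)%:R.
pose S : R := \sum_(0 <= i < m) (a i && a i.+1)%:R.
have am' : a m = false by apply/negP => /am; rewrite ltnn.
have shiftK : \sum_(0 <= i < m) (a i.+1)%:R = K.
  apply/eqP; rewrite -subr_eq0 -sumrB (telescope_sumr (fun i => (a i)%:R)) //.
  by rewrite a0 am' subrr.
have le1 : \sum_(0 <= i < m) F i *+ a i <= S * X + (K - S) * M.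
  rewrite -sumrB !mulr_suml -big_split /=; apply: ler_sum => i _.
  case ai : (a i); rewrite ?mulr0n ?mulr1n /=; last first.
    by rewrite subrr !mul0r addr0.
  case ai' : (a i.+1); rewrite /= ?subr0 ?subrr ?mul0r ?mul1r ?addr0 ?add0r.
    exact: FX.
  exact: FM.
have le2 : 2 * K - S <= m%:R.
  have -> : 2 * K - S = \sum_(0 <= i < m) ((a i)%:R + (a i.+1)%:R - (a i && a i.+1)%:R).
    by rewrite sumrB big_split /= shiftK -/K -/S; ring.
  apply: (@le_trans _ _ (\sum_(0 <= i < m) 1)); last by rewrite sumr_const_nat subn0.
  by apply: ler_sum => i _; case: (a i); case: (a i.+1); rewrite /=; lra.
have le3 : K + 1 <= m%:R.
  rewrite /K -(prednK m0) big_nat_recl // a0 add0r -natr1 lerD2r.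
  apply: (@le_trans _ _ (\sum_(0 <= i < m.-1) 1)); last by rewrite sumr_const_nat subn0.
  by apply: ler_sum => i _; case: (a i.+1); rewrite ?ler01.
have S0 : 0 <= S by apply: sumr_ge0 => i _; apply: ler0n.
have SK : S <= K.
  by apply: ler_sum => i _; case: (a i); case: (a i.+1); rewrite /= ?ler01.
rewrite big_mkcond /=.
apply: (@le_lt_trans _ _ (S * X + (K - S) * M)).
  apply: le_trans le1; apply: ler_sum => i _.
  by case: (a i); rewrite ?mulr0n ?mulr1n.
have M0 : 0 <= M by apply: le_trans XM.
have f0 : 0 < A - (K - S) * M.
  have : (2 * K - S) * M <= m%:R * M by apply: ler_wpM2r.
  have : 0 <= S * M by apply: mulr_ge0.
  by lra.
have [M00|Mn0] := eqVneq M 0.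
  have -> : X = 0 by apply/eqP; rewrite eq_le X0 -M00 XM.
  by move: f0; rewrite M00; lra.
have Mp : 0 < M by rewrite lt_neqAle eq_sym Mn0.
have fM : 0 < A + k * M - K * M.
  have : (K + 1) * M <= m%:R * M by apply: ler_wpM2r.
  by lra.
suff : 0 < M * (A + k * X - (S * X + (K - S) * M)).
  by rewrite pmulr_rgt0 // subr_gt0.
have -> : M * (A + k * X - (S * X + (K - S) * M)) =
   (M - X) * (A - (K - S) * M) + X * (A + k * M - K * M) by ring.
have [XM'|XM'] := eqVneq X M.
  by rewrite XM' subrr mul0r add0r mulr_gt0.
apply: ltr_wpDr; first by rewrite mulr_ge0 // ltW.
by rewrite mulr_gt0 // subr_gt0 lt_neqAle XM'.
Qed.

Section LongCycle.
Variables (R : realFieldType) (T : finType) (r : rel T) (D : pred T) (y : T -> R).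
Variables (A k M : R) (m : nat).
Hypotheses (symr : symmetric r) (irrr : irreflexive r).
Hypothesis domr : forall u v, r u v -> D v.
Hypothesis yM : forall v, D v -> 0 <= y v <= M.
Hypothesis dy : forall v, D v -> A + k * y v <= \sum_(z | r v z) y z.
Hypotheses (m1 : (1 < m)%N).
Hypotheses (mA : m%:R * M < 2 * A) (mk : m%:R * M < A + (k + 1) * M).

(* Take a longest path whose first vertex v is as heavy as possible.  If z is
   adjacent to v, then reversing the part of the path before z shows that the
   predecessor of z starts a longest path, so it is at most as heavy as v. *)
Lemma long_cycle (v0 : T) : D v0 -> exists c, [/\ cycle r c, uniq c & (m < size c)%N].
Proof.
move=> Dv0.
pose P n := [exists v, D v && [exists p : n.-tuple T, path r v p && uniq (v :: p)]].
have exP : exists n, P n.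
  by exists 0%N; apply/existsP; exists v0; rewrite Dv0; apply/existsP; exists [tuple].
have ubP n : P n -> (n <= #|T|)%N.
  case/existsP=> v /andP[_ /existsP[p /andP[_ /=/andP[_ /card_uniqP]]]].
  by rewrite size_tuple => <-; apply: max_card.
case: (ex_maxnP exP ubP) => n Pn nmax.
pose Q v := D v && [exists p : n.-tuple T, path r v p && uniq (v :: p)].
have [v1 Qv1] : exists v, Q v by apply/existsP.
case: (arg_maxP y Qv1) => v /andP[Dv /existsP[p /andP[pp up]]] vmax.
have szp : size p = n by rewrite size_tuple.
have inP z : r v z -> z \in val p.
  move=> vz; have [|zn] := boolP (z \in v :: p).
    by rewrite inE => /orP[/eqP zv|//]; rewrite zv irrr in vz.
  have : (n.+1 <= n)%N; last by rewrite ltnn.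
  apply: nmax; apply/existsP; exists z; rewrite (domr vz).
  apply/existsP; exists [tuple of v :: p].
  by rewrite -[uniq (z :: _)]/((z \notin v :: p) && uniq (v :: p)) zn up /= symr vz pp.
apply: contrapT => noc.
pose s := v :: p.
pose a i := (i < size s)%N && r v (nth v s i).
have a0 : a 0 = false by rewrite /a /= irrr.
(* A neighbour of [v] at index [m] or later would close an initial segment to a cycle with more than
   [m] vertices. *)
have am i : a i -> (i < m)%N.
  move=> /andP[isz ri]; rewrite ltnNge; apply/negP => mi; apply: noc.
  case: i isz ri mi => [|i] isz ri mi; first by have := leq_trans m1 mi.
  exists (take i.+2 s); rewrite take_uniq // size_takel; last exact: isz.
  split => //; rewrite [take _ _]/= /= rcons_path.
  have iszp : (i < size p)%N by [].
  have /= := take_path i.+1 pp; rewrite (take_nth v iszp) => ->.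
  by rewrite last_rcons symr.
have pred_le i : a i -> a i.+1 -> y (nth v s i) <= y v.
  move=> /andP[isz _] /andP[isz' ri']; apply: vmax.
  have sE : s = take i.+1 s ++ drop i.+1 s by rewrite cat_take_drop.
  have iszp : (i <= size p)%N by [].
  have tE : take i.+1 s = v :: take i p by [].
  have last_t : last v (take i p) = nth v s i.
    by case: (i) iszp => [|j] jp; rewrite ?take0 // (take_nth v jp) last_rcons.
  have dE : drop i.+1 s = nth v s i.+1 :: drop i.+2 s by rewrite -drop_nth.
  (* Reverse the segment up to index [i] and go on from index [i.+1], whose vertex is joined to [v]:
     a path on the same vertices with a new first vertex. *)
  pose p' := rev (belast v (take i p)) ++ drop i.+1 s.
  have p'E : nth v s i :: p' = rev (take i.+1 s) ++ drop i.+1 s.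
    by rewrite tE [v :: take i p]lastI rev_rcons last_t.
  have szp' : size p' == n.
    rewrite -eqSS -[(size p').+1]/(size (nth v s i :: p')) p'E size_cat size_rev.
    by rewrite -size_cat -sE /= szp.
  have Dnth : D (nth v s i).
    case: (i) isz => [//|j] jsz.
    have jp : (j < size p)%N by [].
    have := take_path j.+1 pp; rewrite (take_nth v jp) rcons_path => /andP[_].
    exact: domr.
  apply/andP; split => //; apply/existsP; exists (Tuple szp').
  rewrite /= -[_ && uniq p']/(uniq (nth v s i :: p')) p'E.
  rewrite (perm_uniq (_ : perm_eq _ s)) ?up; last first.
    by rewrite [X in perm_eq _ X]sE perm_cat2r perm_rev.
  rewrite andbT /p' cat_path.
  have pr : path r (nth v s i) (rev (belast v (take i p))).
    rewrite -last_t rev_path.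
    by rewrite -(eq_path (e := r)) ?take_path // => x z; apply: symr.
  rewrite pr dE /=.
  have {}ri' : r v (nth v p i) := ri'.
  have -> : last (nth v s i) (rev (belast v (take i p))) = v.
    by rewrite -last_t; case: (take i p) => [|x q] //=; rewrite rev_cons last_rcons.
  rewrite ri' /=.
  have ip : (i < size p)%N by [].
  by move: pp; rewrite -{1}[val p](cat_take_drop i.+1) cat_path (take_nth v ip) last_rcons => /andP[].
have yn i : a i -> y (nth v s i) <= M.
  by case/andP=> _ /domr/yM/andP[].
have := initial_segment_sum (ltnW m1) a0 am (yM Dv) yn pred_le mA mk.
apply/negP; rewrite -leNgt; apply: le_trans (dy Dv) _.
have -> : \sum_(z | r v z) y z = \sum_(z <- s | r v z) y z.
  rewrite [RHS]big_mkcond big_uniq //= -big_mkcondr; apply: eq_bigl => z.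
  by case rz : (r v z); rewrite ?andbT ?andbF // inE (inP z rz) orbT.
rewrite (big_nth v).
rewrite le_eqVlt; apply/orP; left; apply/eqP.
pose N := maxn m (size s).
rewrite (big_nat_widen 0 (size s) N) ?leq_maxr // (big_nat_widen 0 m N) ?leq_maxl //.
apply: eq_bigl => i; rewrite /a; case rs : (r v _); rewrite ?andbF //= andbT.
case isz : (i < size s)%N => //=; apply/esym/am.
by rewrite /a isz.
Qed.
End LongCycle.

(** * Shortest long cycles *)

Section ShortestLongCycle.
Variables (T : finType) (r : rel T) (c : seq T) (m : nat).
Hypothesis symr : symmetric r.
Hypotheses (cyc : cycle r c) (unc : uniq c).
Hypothesis minc : forall c', cycle r c' -> uniq c' -> (m <= size c')%N ->
  (size c <= size c')%N.

Let L := size c.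

(** A chord closes each of the two arcs to a cycle shorter than [c], which by minimality has fewer
    than [m] vertices. *)
Lemma chord_head (x : T) (p : seq T) (a : nat) : c = x :: p ->
  (1 < a)%N -> (a + 1 < L)%N -> r x (nth x c a) ->
  (a + 1 < m)%N /\ (L - a + 1 < m)%N.
Proof.
move=> cE a1 aL xa.
have szp : L = (size p).+1 by rewrite /L cE.
have pp : path r x (rcons p x) by move: cyc; rewrite cE.
case: a a1 aL xa => [//|a] a1 aL xa.
have ap : (a < size p)%N by lia.
have xa' : r x (nth x p a) by move: xa; rewrite cE.
split; rewrite ltnNge; apply/negP => ma.
  have : (L <= size (take a.+2 c))%N.
    apply: minc; last by rewrite size_takel -/L; lia.
      rewrite cE /= rcons_path (take_nth x ap) last_rcons symr xa' andbT.
      rewrite -(take_nth x ap).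
      have -> : take a.+1 p = take a.+1 (rcons p x) by rewrite -cats1 takel_cat.
      exact: take_path.
    exact: take_uniq.
  by rewrite size_takel -/L; lia.
have : (L <= size (x :: drop a.+1 c))%N.
  apply: minc; last by rewrite /= size_drop -/L; lia.
    rewrite cE /= (drop_nth x ap) /= xa' /=.
    have : path r x (rcons p x) by [].
    rewrite -{1}(cat_take_drop a.+1 p) (take_nth x ap) rcons_cat cat_path last_rcons.
    by case/andP.
  rewrite /= drop_uniq // andbT cE /=; move: unc; rewrite cE /= => /andP[xp _].
  by apply: contra xp; apply: mem_drop.
by rewrite /= size_drop -/L; lia.
Qed.

(** The detour through [z] plays the role of a chord; [2 < a] and [a + 2 < L] are what makes both
    new cycles shorter than [c]. *)
Lemma apex_head (x z : T) (p : seq T) (a : nat) : c = x :: p ->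
  (2 < a)%N -> (a + 2 < L)%N -> z \notin c -> r z x -> r z (nth x c a) ->
  (a + 2 < m)%N /\ (L - a + 2 < m)%N.
Proof.
move=> cE a1 aL zc zx za.
have szp : L = (size p).+1 by rewrite /L cE.
have pp : path r x (rcons p x) by move: cyc; rewrite cE.
case: a a1 aL za => [//|a] a1 aL za.
have ap : (a < size p)%N by lia.
have za' : r z (nth x p a) by move: za; rewrite cE.
split; rewrite ltnNge; apply/negP => ma.
  have : (L <= size (z :: take a.+2 c))%N.
    apply: minc; last by rewrite /= size_takel -/L; lia.
      rewrite cE /= zx /= rcons_path (take_nth x ap) last_rcons symr za' andbT.
      rewrite -(take_nth x ap).
      have -> : take a.+1 p = take a.+1 (rcons p x) by rewrite -cats1 takel_cat.
      exact: take_path.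
    rewrite /= take_uniq // andbT; apply: contra zc; exact: mem_take.
  by rewrite /= size_takel -/L; lia.
have : (L <= size (z :: rcons (drop a.+1 c) x))%N.
  apply: minc; last by rewrite /= size_rcons size_drop -/L; lia.
    rewrite cE /= (drop_nth x ap) /= za' /= rcons_path last_rcons symr zx andbT.
    rewrite -{1}[p](cat_take_drop a.+1 p) (take_nth x ap) in pp.
    by move: pp; rewrite rcons_cat cat_path last_rcons => /andP[].
  rewrite /= rcons_uniq drop_uniq // andbT mem_rcons inE negb_or.
  rewrite cE /= in zc *; move: zc; rewrite inE negb_or => /andP[-> zp] /=.
  move: unc; rewrite cE /= => /andP[xp _].
  by rewrite (contra (@mem_drop a _ p z)) // (contra (@mem_drop a _ p x)).
by rewrite /= size_rcons size_drop -/L; lia.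
Qed.
End ShortestLongCycle.

Section ShortestLongCycleRot.
Variables (T : finType) (r : rel T) (c : seq T) (m : nat) (x0 : T).
Hypotheses (symr : symmetric r) (irrr : irreflexive r).
Hypotheses (cyc : cycle r c) (unc : uniq c).
Hypothesis minc : forall c', cycle r c' -> uniq c' -> (m <= size c')%N ->
  (size c <= size c')%N.

Let L := size c.

Lemma rot_nth (i j : nat) : (i <= j)%N -> (j < size c)%N ->
  exists p, rot i c = nth x0 c i :: p /\ nth (nth x0 c i) (rot i c) (j - i)%N = nth x0 c j.
Proof.
move=> ij jL; have iL : (i < size c)%N := leq_ltn_trans ij jL.
rewrite /rot (drop_nth x0 iL) /=; exists (drop i.+1 c ++ take i c); split=> //.
rewrite -[_ :: _ ++ _]/((_ :: _) ++ _) -(drop_nth x0 iL) nth_cat size_drop.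
have -> : (j - i < size c - i)%N by lia.
by rewrite nth_drop subnKC //; apply: set_nth_default.
Qed.

(** Rotation brings position [i] to the head; the first two outcomes are the edges of the cycle
    itself. *)
Lemma chord_length (i j : nat) : (i < j)%N -> (j < L)%N ->
  r (nth x0 c i) (nth x0 c j) ->
  [\/ j = i + 1, j = i + L.-1 |
      (j - i + 1 < m /\ L - (j - i) + 1 < m)]%N.
Proof.
move=> ij jL rij; have [p [rE nE]] := rot_nth (ltnW ij) jL.
have [ji|ji] := leqP (j - i) 1; first by constructor 1; lia.
have [Lji|Lji] := leqP L (j - i + 1); first by constructor 2; lia.
constructor 3; move: (Lji); rewrite /L -(size_rot i) => Lji'.
apply: (chord_head symr _ _ _ rE); rewrite ?rot_cycle ?rot_uniq ?nE //.
by move=> c' ? ? ?; rewrite size_rot; apply: minc.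
Qed.

Lemma apex_length (z : T) (i j : nat) : (i < j)%N -> (j < L)%N -> z \notin c ->
  r z (nth x0 c i) -> r z (nth x0 c j) ->
  [\/ j <= i + 2, i + L <= j + 2 |
      (j - i + 2 < m /\ L - (j - i) + 2 < m)]%N.
Proof.
move=> ij jL zc ri rj; have [p [rE nE]] := rot_nth (ltnW ij) jL.
have [ji|ji] := leqP (j - i) 2; first by constructor 1; lia.
have [Lji|Lji] := leqP L (j - i + 2); first by constructor 2; lia.
constructor 3; move: (Lji); rewrite /L -(size_rot i) => Lji'.
apply: (apex_head (z := z) symr _ _ _ rE); rewrite ?rot_cycle ?rot_uniq ?mem_rot ?nE //.
by move=> c' ? ? ?; rewrite size_rot; apply: minc.
Qed.

(** [2 * m < L + 4] contradicts the third outcome of [chord_length] and of [apex_length]. So a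
    vertex of the cycle has only its two cycle neighbours there, and the neighbours of an outside
    vertex are pairwise at cyclic distance at most 2, hence at most three in number as [7 < L]. *)
Lemma few_neighbors (z : T) : (2 * m < L + 4)%N -> (7 < L)%N ->
  (count (r z) c <= 3)%N.
Proof.
move=> mL L7; pose N := [seq i <- iota 0 L | r z (nth x0 c i)].
have -> : count (r z) c = size N.
  by rewrite /N size_filter -{1}[c](mkseq_nth x0) /mkseq count_map.
have inN i : i \in N = (i < L)%N && r z (nth x0 c i).
  by rewrite mem_filter mem_iota add0n andbC.
have uN : uniq N by rewrite filter_uniq // iota_uniq.
have sub3 l : size l = 3%N -> {subset N <= l} -> (size N <= 3)%N.
  by move=> <-; apply: uniq_leq_size.
have [zc|zc] := boolP (z \in c).
  have iL : (index z c < L)%N by rewrite index_mem.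
  set i := index z c in iL.
  have zE : z = nth x0 c i by rewrite nth_index.
  (* The third entry is the neighbour across the end of the list, which [i.-1] and [i.+1] miss when
     [i] is [0] or [L.-1]. *)
  apply: (@sub3 [:: i.-1; i.+1; if i == 0 then L.-1 else 0]%N) => // j.
  rewrite inN => /andP[jL rj]; rewrite !inE.
  case: (ltngtP i j) => ij.
  - case: (@chord_length i j) => //; rewrite -?zE //; first by move=> ->; rewrite addn1 eqxx orbT.
      move=> jE; have i0 : i = 0%N by lia.
      by rewrite i0 jE i0 add0n !eqxx !orbT.
    by lia.
  - case: (@chord_length j i) => //; rewrite -?zE ?[r _ z]symr //; first by move=> ->; rewrite addn1 eqxx.
      by move=> iE; have -> : i == 0%N = false by [lia]; lia.
    by lia.
  - by rewrite -ij -zE irrr in rj.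
have ap i j : (i < j)%N -> i \in N -> j \in N -> (j <= i + 2)%N || (i + L <= j + 2)%N.
  move=> ij; rewrite !inN => /andP[iL ri] /andP[jL rj].
  by case: (apex_length ij jL zc ri rj) => [->//|->|]; rewrite ?orbT //; lia.
case NE : N => [//|i0 N']; rewrite -NE.
have i0N : i0 \in N by rewrite NE mem_head.
have sN : sorted ltn N by apply: sorted_filter; [exact: ltn_trans|exact: iota_ltn_sorted].
have lei j : j \in N -> (i0 <= j)%N.
  rewrite NE inE => /orP[/eqP->//|jN]; move: sN; rewrite NE /= (path_sortedE ltn_trans).
  by case/andP=> /allP/(_ _ jN)/ltnW.
have ltL j : j \in N -> (j < L)%N by rewrite inN => /andP[].
(* With [i0] the least index, all indices lie in a cyclic window of three positions; it starts at
   [i0], one before or two before, according to whether [i0 + 2] or [i0 + 1] occurs. *)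
have [i2|i2] := boolP (i0 + 2 \in N)%N.
  apply: (@sub3 [:: i0; i0 + 1; i0 + 2]%N) => // j jN; rewrite !inE.
  have := lei _ jN; have := ltL _ jN; have := ltL _ i2.
  have := @ap i0 j; have := @ap (i0 + 2)%N j; rewrite i0N jN i2.
  move=> h1 h2; have [ij2|ij2] := ltnP (i0 + 2)%N j; last by lia.
  have := h1 ij2 isT isT; have : (i0 < j)%N by [lia]; move=> /h2/(_ isT isT).
  by lia.
have [i1|i1] := boolP (i0 + 1 \in N)%N.
  apply: (@sub3 [:: i0; i0 + 1; i0 + L.-1]%N) => // j jN; rewrite !inE.
  have := lei _ jN; have := ltL _ jN; have := ltL _ i1.
  have := @ap i0 j; have := @ap (i0 + 1)%N j; rewrite i0N jN i1.
  have j2 : j != (i0 + 2)%N by apply: contra i2 => /eqP<-.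
  move=> h1 h2; have [ij2|ij2] := ltnP (i0 + 1)%N j; last by lia.
  have := h1 ij2 isT isT; have : (i0 < j)%N by [lia]; move=> /h2/(_ isT isT).
  by lia.
apply: (@sub3 [:: i0; i0 + (L - 2); i0 + L.-1]%N) => // j jN; rewrite !inE.
have := lei _ jN; have := ltL _ jN; have := @ap i0 j; rewrite i0N jN.
have j2 : j != (i0 + 2)%N by apply: contra i2 => /eqP<-.
have j1 : j != (i0 + 1)%N by apply: contra i1 => /eqP<-.
move=> h2; have [ij2|ij2] := ltnP i0 j; last by lia.
by have := h2 ij2 isT isT; lia.
Qed.

(** Two vertices three apart on the cycle have no common neighbour outside: the detour through it
    would replace three edges by two and leave [L - 1 >= m] vertices. On the cycle, [chord_length]
    puts the neighbours of the first vertex next to it or into an interval of [2 * m - L - 3]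
    positions. *)
Lemma few_common_neighbors : (m < L)%N -> (5 < L)%N ->
  exists u v, [/\ u \in c, v \in c &
    (#|[set z | r u z && r v z]| <= 2 + (2 * m - L - 3))%N].
Proof.
move=> mL L5; exists (nth x0 c 0), (nth x0 c 3); split; try by apply: mem_nth; rewrite -/L; lia.
pose s := [seq nth x0 c a | a <- [:: 1, L.-1 & iota (L + 2 - m) (2 * m - L - 3)]%N].
have szs : size s = (2 + (2 * m - L - 3))%N by rewrite size_map /= size_iota.
rewrite -szs; apply: leq_trans (card_size s); apply: subset_leq_card.
apply/fintype.subsetP => z; rewrite inE => /andP[uz vz].
have zc : z \in c.
  apply/negPn/negP => zc.
  case: (@apex_length z 0 3) => //; rewrite ?[r z _]symr //; lia.
have zL : (index z c < L)%N by rewrite index_mem.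
apply/mapP; exists (index z c); last by rewrite nth_index.
set a := index z c in zL *.
have zE : z = nth x0 c a by rewrite nth_index.
have a0 : (0 < a)%N.
  by rewrite lt0n; apply/eqP => a0; move: uz; rewrite zE a0 irrr.
rewrite !inE mem_iota.
case: (@chord_length 0 a) => //; rewrite -?zE //; lia.
Qed.
End ShortestLongCycleRot.

(** * Minimizing a quadratic form on the simplex *)

Section QuadraticForm.
Variables (R : realType) (T : finType) (M : T -> T -> R).

Definition mulv (x : T -> R) (u : T) : R := \sum_v M u v * x v.
Definition quad_form (x : T -> R) : R := \sum_u x u * mulv x u.

Hypothesis symM : forall u v, M u v = M v u.

Lemma mulvD (x d : T -> R) u : mulv (fun a => x a + d a) u = mulv x u + mulv d u.
Proof. by rewrite /mulv -big_split; apply: eq_bigr => v _; rewrite mulrDr. Qed.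

Lemma mulv_sym (x d : T -> R) : \sum_u x u * mulv d u = \sum_u d u * mulv x u.
Proof.
rewrite /mulv (eq_bigr (fun u => \sum_v x u * M u v * d v)); last first.
  by move=> u _; rewrite mulr_sumr; apply: eq_bigr => v _; rewrite mulrA.
rewrite exchange_big /=; apply: eq_bigr => v _; rewrite mulr_sumr.
by apply: eq_bigr => u _; rewrite symM; ring.
Qed.

Lemma quad_formD (x d : T -> R) :
  quad_form (fun a => x a + d a) = quad_form x + 2 * (\sum_u d u * mulv x u) + quad_form d.
Proof.
rewrite /quad_form (eq_bigr (fun u => (x u * mulv x u + x u * mulv d u) +
   (d u * mulv x u + d u * mulv d u))); last first.
  by move=> u _; rewrite mulvD; ring.
by rewrite !big_split /= (mulv_sym x d); ring.
Qed.

Lemma mulv_delta (s : R) u v : mulv (fun a => s * (a == u)%:R) v = s * M v u.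
Proof.
rewrite /mulv (bigD1 u) //= eqxx big1 ?addr0 ?mulr1 1?mulrC // => w /negbTE->.
by rewrite mulr0 mulr0.
Qed.

Lemma sum_delta (f : T -> R) (s : R) u : \sum_v s * (v == u)%:R * f v = s * f u.
Proof.
rewrite (bigD1 u) //= eqxx big1 ?addr0 ?mulr1 // => w /negbTE->.
by rewrite mulr0 mul0r.
Qed.

Lemma quad_form_delta (s : R) u (w : T -> R) :
  quad_form (fun a => s * (a == u)%:R + w a) =
  s ^+ 2 * M u u + 2 * (s * mulv w u) + quad_form w.
Proof.
rewrite quad_formD; congr (_ + 2 * _ + _).
  by rewrite /quad_form sum_delta mulv_delta mulrA expr2.
by rewrite -mulv_sym sum_delta.
Qed.

Variable y : T -> R.
Hypotheses (y_gt0 : forall u, 0 < y u) (y_sum : \sum_u y u = 1).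
Hypothesis y_min :
  forall z, (forall u, 0 <= z u) -> \sum_u z u = 1 -> quad_form y <= quad_form z.

(** First-order condition at an interior minimizer: moving weight [s] from [v] to [u] changes the
    form by [2 * s * D + s ^+ 2 * c], which is negative for a small [s] of sign opposite to [D]. *)
Lemma mulv_const u v : mulv y u = mulv y v.
Proof.
apply/eqP; rewrite -subr_eq0; apply/negPn/negP; set D := _ - _ => D0.
pose e s a : R := s * (a == u)%:R + (- s) * (a == v)%:R.
pose c := quad_form (e 1).
have eE s a : e s a = s * e 1 a by rewrite /e; ring.
have qe s : quad_form (e s) = s ^+ 2 * c.
  rewrite /c /quad_form mulr_sumr; apply: eq_bigr => a _.
  rewrite eE (_ : mulv (e s) a = s * mulv (e 1) a); first by ring.
  by rewrite /mulv mulr_sumr; apply: eq_bigr => b _; rewrite eE; ring.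
have key s : `|s| <= y u -> `|s| <= y v -> 0 <= 2 * s * D + s ^+ 2 * c.
  move=> su sv; have := y_min (z := fun a => y a + e s a).
  rewrite quad_formD qe (_ : \sum_a e s a * mulv y a = s * D); last first.
    under eq_bigr => a _ do rewrite /e mulrDl.
    by rewrite big_split /= !sum_delta /D; ring.
  move=> h; suff : quad_form y <= quad_form y + 2 * (s * D) + s ^+ 2 * c by lra.
  apply: h.
    move=> a; rewrite /e; have := y_gt0 a.
    move: su sv; rewrite !ler_norml => /andP[s1 s2] /andP[s3 s4].
    case: (eqVneq a u) => [->|_]; first by have := y_gt0 u; case: eqP => _ /=; lra.
    by case: (eqVneq a v) => [->|_] /=; lra.
  rewrite big_split /= y_sum /e big_split /= (eq_bigr (fun a => s * (a == u)%:R * 1)).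
    rewrite (sum_delta (fun=> 1)) (eq_bigr (fun a => - s * (a == v)%:R * 1)).
      by rewrite (sum_delta (fun=> 1)); ring.
    by move=> a _; rewrite mulr1.
  by move=> a _; rewrite mulr1.
pose m := Num.min (y u) (y v).
have m0 : 0 < m by rewrite lt_min !y_gt0.
(* The shift will be [s = - (k * D)]. The first bound keeps the weights nonnegative, the second
   keeps the quadratic term below the linear one. *)
pose k := Num.min (m / (`|D| + 1)) ((`|c| + 1)^-1).
have k0 : 0 < k.
  by rewrite lt_min divr_gt0 ?invr_gt0 // ltr_wpDl // normr_ge0.
have kD : `|- (k * D)| <= m.
  rewrite normrN normrM (gtr0_norm k0).
  have : k <= m / (`|D| + 1) by rewrite ge_min lexx.
  rewrite ler_pdivlMr; last by rewrite ltr_wpDl // normr_ge0.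
  by rewrite mulrDr mulr1; lra.
have kc : k * `|c| < 1.
  have : k <= (`|c| + 1)^-1 by rewrite ge_min lexx orbT.
  rewrite -[X in _ <= X]div1r ler_pdivlMr; last by rewrite ltr_wpDl // normr_ge0.
  by rewrite mulrDr mulr1; lra.
have mu : m <= y u by rewrite ge_min lexx.
have mv : m <= y v by rewrite ge_min lexx orbT.
have := key _ (le_trans kD mu) (le_trans kD mv).
have -> : 2 * - (k * D) * D + (- (k * D)) ^+ 2 * c = (k * D ^+ 2) * (k * c - 2) by ring.
have D2 : 0 < k * D ^+ 2 by rewrite mulr_gt0 // lt_neqAle sqr_ge0 eq_sym sqrf_eq0 D0.
rewrite pmulr_rge0 // => h.
have := ler_norm c; have : k * c <= k * `|c| by rewrite ler_pM2l // ler_norm.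
by lra.
Qed.

Lemma mulv_quad_form u : mulv y u = quad_form y.
Proof.
rewrite /quad_form (eq_bigr (fun v => y v * mulv y u)); last first.
  by move=> v _; rewrite (mulv_const v u).
by rewrite -mulr_suml y_sum mul1r.
Qed.

Hypothesis y_core : forall z, (forall u, 0 <= z u) -> \sum_u z u = 1 ->
  (exists u, z u = 0) -> quad_form y < quad_form z.

(** As [mulv M y] is constant and [d] sums to 0, the linear term vanishes and the form grows by
    exactly [quad_form d]. Used to refute: a shift that empties a vertex and has [quad_form d <= 0]
    cannot exist at the minimizer. *)
Lemma no_flat_direction (d : T -> R) : \sum_u d u = 0 ->
  (forall u, 0 <= y u + d u) -> (exists u, y u + d u = 0) -> 0 < quad_form d.
Proof.
move=> d0 yd ex.
have := y_core yd _ ex; rewrite big_split /= y_sum d0 addr0 => /(_ erefl).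
rewrite quad_formD (eq_bigr (fun u => d u * quad_form y)); last by move=> u _; rewrite mulv_quad_form.
by rewrite -mulr_suml d0 mul0r mulr0 addr0 ltrDl.
Qed.
End QuadraticForm.

Lemma continuous_bigsum (R : realType) (U : topologicalType) (I : Type) (s : seq I)
    (F : I -> U -> R) : (forall i, continuous (F i)) ->
  continuous (fun x => \sum_(i <- s) F i x).
Proof.
move=> cF; elim: s => [|i s IHs].
  by rewrite (_ : (fun _ => _) = cst 0);
    [exact: cst_continuous | apply/funext => x; rewrite big_nil].
rewrite (_ : (fun _ => _) = F i + (fun x => \sum_(j <- s) F j x)).
  by move=> x; apply: continuousD; [exact: cF | exact: IHs].
by apply/funext => x; rewrite big_cons.
Qed.

(** Extreme value theorem on the simplex, transported to row vectors, where the box with sides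
    [[0, 1]] is compact. *)
Lemma quad_form_minimizer (R : realType) (T : finType) (M : T -> T -> R) (t0 : T) :
  exists y, [/\ forall u, 0 <= y u, \sum_u y u = 1 &
    forall z, (forall u, 0 <= z u) -> \sum_u z u = 1 -> quad_form M y <= quad_form M z].
Proof.
pose n := #|T|.
pose toT (v : 'rV[R]_n) (u : T) : R := v ord0 (enum_rank u).
pose A : set 'rV[R]_n := ([set v : 'rV[R]_n | forall i, `[0, 1]%classic (v ord0 i)] `&`
   (fun v => \sum_u toT v u) @^-1` [set x | x = 1])%classic.
have ctoT u : continuous (toT^~ u) by exact: coord_continuous.
have cA : compact A.
  apply: compact_closedI.
    have := @rV_compact R n (fun=> `[0, 1]%classic); apply.
    by move=> _; apply: segment_compact.
  apply: preimage_closed; last exact: closed_eq.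
  by move=> x _; apply: continuous_bigsum.
pose f v := quad_form M (toT v).
have cf : continuous f.
  apply: continuous_bigsum => u x; apply: continuousM; first exact: ctoT.
  apply: continuous_bigsum => v {}x; apply: continuousM; last exact: ctoT.
  exact: cst_continuous.
have ofT (z : T -> R) : (forall u, 0 <= z u) -> \sum_u z u = 1 ->
    exists2 v, A v & toT v = z.
  move=> z0 z1; have zE : toT (\row_i z (enum_val i)) = z.
    by apply/funext => u; rewrite /toT mxE enum_rankK.
  exists (\row_i z (enum_val i)); last exact: zE.
  split => /=; last by rewrite zE.
  move=> i; rewrite mxE /= in_itv /= z0 /= -z1 (bigD1 (enum_val i)) //= lerDl.
  exact: sumr_ge0.
have [|v vA vmin] := compact_EVT_min _ cA (continuous_subspaceT (A := A) cf).
  have [||v Av _] := ofT (fun u => (u == t0)%:R); last by exists v.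
    by move=> u; apply: ler0n.
  by rewrite (bigD1 t0) //= eqxx big1 ?addr0 // => u /negbTE->.
rewrite inE in vA; case: vA => v01 vsum.
exists (toT v); split=> //.
  by move=> u; have := v01 (enum_rank u); rewrite /= in_itv /= => /andP[].
move=> z z0 z1; have [w Aw <-] := ofT z z0 z1.
by apply: vmin; rewrite inE.
Qed.

(** * Numerical estimates *)

(** [W] stands for [t - w], the left side for the cycle length to be exceeded, the right side for
    what [core_slack] at [x = w] supplies. The reason is [h <= 4 * t * (l - 1)] together with
    [4 * t <= (W + 1) * (2 * t + 1 - W)], an equality at [W = 1]. *)
Lemma long_path_arith (t h l W : nat) : (0 < W)%N -> (W <= t)%N ->
  (4 * t * (2 * t + 1) <= h)%N -> (h <= l * (2 * t + 1))%N ->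
  ((h - 1) %/ (2 * t + 1 - W) <= (W + 1) * (l - 1))%N.
Proof.
move=> W0 Wt hh hl.
have l4 : (h <= 4 * t * (l - 1))%N.
  have : (h * (2 * t + 1) <= 4 * t * (l - 1) * (2 * t + 1))%N.
    have e : (4 * t * (l - 1) * (2 * t + 1) = 4 * t * (l * (2 * t + 1)) - 4 * t * (2 * t + 1))%N.
      by rewrite mulnBr muln1 mulnBl mulnA.
    rewrite e; have := leq_mul (leqnn (4 * t)) hl.
    have : ((2 * t + 2) * h <= 4 * t * h)%N by rewrite leq_mul2r; apply/orP; right; lia.
    lia.
  by rewrite leq_pmul2r //; lia.
have W4 : (4 * t <= (W + 1) * (2 * t + 1 - W))%N.
  have [V WE] : exists V, W = V.+1 by exists W.-1; rewrite prednK.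
  have [x tE] : exists x, t = (V + 1 + x)%N by exists (t - W)%N; lia.
  have -> : (2 * t + 1 - W = V + 2 + 2 * x)%N by lia.
  have -> : ((W + 1) * (V + 2 + 2 * x) = 4 * t + (V * V + 2 * x * V))%N.
    by rewrite WE tE; ring.
  exact: leq_addr.
have s0 : (0 < 2 * t + 1 - W)%N by lia.
apply: (@leq_trans (((W + 1) * (l - 1) * (2 * t + 1 - W)) %/ (2 * t + 1 - W))%N).
  apply: leq_div2r; have := leq_mul W4 (leqnn (l - 1)); lia.
by rewrite mulnK.
Qed.

(** Again [W = t - w]: the left side is the count of [few_common_neighbors] with [m.+1] for [m], the
    right side what [core_slack] at [x = w + 2] supplies. *)
Lemma common_arith (t h l L W : nat) : (1 < W)%N -> (W <= t)%N ->
  (4 * t * (2 * t + 1) <= h)%N -> (h <= l * (2 * t + 1))%N -> (h < t * L)%N ->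
  (2 + (2 * ((h - 1) %/ (2 * t + 1 - W)).+1 - L - 3) <= (W - 1) * (l - 1))%N.
Proof.
move=> W1 Wt hh hl hL.
set s := (2 * t + 1 - W)%N; set k := ((h - 1) %/ s)%N.
have st : (t + 1 <= s)%N by rewrite /s; lia.
have ks : (k * s <= h - 1)%N by apply: leq_trunc_div.
have t2 : (2 <= t)%N by lia.
have l4 : (4 * t <= l)%N.
  by rewrite -(leq_pmul2r (m := 2 * t + 1)) ?addn1 //; lia.
have [k3|k3] := leqP (2 * k.+1) (L + 3).
  have -> : (2 * k.+1 - L - 3 = 0)%N by lia.
  by rewrite addn0; have : (1 * 2 <= (W - 1) * (l - 1))%N by apply: leq_mul; lia.
suff : (2 * k + 1 <= (W - 1) * (l - 1) + L)%N by lia.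
(* multiplying by s t, it suffices that s t (l - 2) + s + 2 t >= h *)
have key1 : (h <= (t + 1) * (t * (l - 2) + 1) + 2 * t)%N.
  suff : (h * (2 * t + 1) <= ((t + 1) * (t * (l - 2) + 1) + 2 * t) * (2 * t + 1))%N.
    by rewrite leq_pmul2r //; lia.
  have [j lE] : exists j, l = (j + 2)%N by exists (l - 2)%N; lia.
  rewrite lE addnK.
  have h1 : (h <= j * (2 * t + 1) + 2 * (2 * t + 1))%N by rewrite -mulnDl -lE.
  have h2 : (4 * t * (2 * t + 1) * (t * t - t - 1) <= h * (t * t - t - 1))%N by rewrite leq_mul2r hh orbT.
  have h3 : ((t + 1) * t * h <= (t + 1) * t * (j * (2 * t + 1) + 2 * (2 * t + 1)))%N by rewrite leq_mul2l h1 orbT.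
  have tt : (2 * t <= t * t)%N by rewrite leq_mul2r t2 orbT.
  have [u uE] : exists u, (t * t = u + t + 1)%N by exists (t * t - t - 1)%N; lia.
  have uE' : (t * t - t - 1 = u)%N by lia.
  rewrite uE' in h2.
  have h4 : (2 * t * t <= 4 * t * u + t + 1)%N.
    have : (4 * t * (t - 1) <= 4 * t * u)%N by rewrite leq_mul2l; apply/orP; right; lia.
    have -> : (2 * t * t = 2 * (t * t))%N by rewrite mulnA.
    have -> : (4 * t * (t - 1) = 4 * (t * t) - 4 * t)%N by rewrite mulnBr muln1 mulnA.
    by move: tt; clear; lia.
  have h5 : (2 * t * t * (2 * t + 1) <= (4 * t * u + t + 1) * (2 * t + 1))%N.
    by rewrite leq_mul2r h4 orbT.
  have e1 : ((t + 1) * t * h = h * (2 * t + 1) + h * u)%N.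
    by rewrite mulnDl mul1n uE; ring.
  clear - h2 h3 h5 e1; lia.
have key2 : (h <= s * (t * (l - 2) + 1) + 2 * t)%N.
  by apply: leq_trans key1 _; rewrite leq_add2r leq_mul2r st orbT.
have st0 : (0 < s * t)%N by rewrite muln_gt0; apply/andP; split; lia.
rewrite -(leq_pmul2r st0).
have e2 : (2 * t = s + (W - 1))%N by rewrite /s; lia.
have [j lE] : exists j, l = (j + 2)%N by exists (l - 2)%N; lia.
have [V WE] : exists V, W = (V + 2)%N by exists (W - 2)%N; lia.
have n1 n : (n + 2 - 1 = n + 1)%N by lia.
move: key2 e2; rewrite lE WE addnK !n1.
move=> key2 e2.
have h6 : (s * (h + 1) <= s * (t * L))%N by rewrite leq_mul2l addn1 hL orbT.
have h7 : (2 * t * (k * s) <= 2 * t * (h - 1))%N by rewrite leq_mul2l ks orbT.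
have h8 : (V * h <= V * (s * (t * j + 1) + 2 * t))%N by rewrite leq_mul2l key2 orbT.
have h0 : (0 < h)%N by apply: leq_trans hh; rewrite !muln_gt0; lia.
have h9 : (2 * t * h = s * h + (V + 1) * h)%N by rewrite -mulnDl e2.
have h10 : (2 * t * (h - 1) = 2 * t * h - 2 * t)%N by rewrite mulnBr muln1.
have h11 : (V * (s + 2 * t) <= V * (s * t))%N.
  rewrite leq_mul2l; apply/orP; have [|V0] := posnP V; first by left; apply/eqP.
  right; have : ((t + 1) * 2 <= s * (t - 1))%N by apply: leq_mul => //; lia.
  by rewrite mulnBr muln1; clear; lia.
have t20 : (2 * t <= 2 * t * h)%N by rewrite leq_pmulr.
clear - h6 h7 h8 h9 h10 h11 t20 key2; lia.
Qed.

Lemma ltn_power_length (t h : nat) : (0 < t)%N -> (4 * t * (2 * t + 1) <= h)%N -> (3 * t < h)%N.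
Proof.
move=> t0 hh; apply: leq_trans hh; apply: (@leq_trans (4 * t)); first by lia.
by rewrite leq_pmulr // addn1.
Qed.

Lemma leq_cliques (t h l : nat) : (4 * t * (2 * t + 1) <= h)%N ->
  (h <= l * (2 * t + 1))%N -> (4 * t <= l)%N.
Proof.
move=> hh hl; rewrite -(leq_pmul2r (m := 2 * t + 1)); first exact: leq_trans hl.
by rewrite addn1.
Qed.

Lemma leq_blocks (t h l : nat) : (3 <= l)%N -> (l.-1 * (2 * t + 1) < h)%N ->
  (t.+1 * l <= h)%N.
Proof.
move=> l3 lh; have [k lE] : exists k, l = k.+2 by exists (l - 2)%N; lia.
by apply: leq_trans lh; rewrite lE /=; lia.
Qed.

Lemma long_path_gt1 (t h w : nat) : (0 < t)%N -> (4 * t * (2 * t + 1) <= h)%N ->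
  (1 < (h - 1) %/ (2 * t + 1 - (t - w)))%N.
Proof.
move=> t0 hh; set s := (2 * t + 1 - (t - w))%N.
have s0 : (0 < s)%N by rewrite /s; lia.
rewrite leq_divRL //; have st : (s <= 2 * t + 1)%N by rewrite /s leq_subr.
have : (4 * 1 * (2 * t + 1) <= 4 * t * (2 * t + 1))%N by rewrite leq_mul2r leq_mul2l t0 !orbT.
by move: hh st; clear; lia.
Qed.

Lemma short_cycle_arith (t h w L : nat) : (w <= t)%N ->
  ((h - 1) %/ (2 * t + 1 - (t - w)) < L)%N -> (h <= (t.+1 + w) * L)%N.
Proof.
move=> wt; have -> : (2 * t + 1 - (t - w) = t.+1 + w)%N by lia.
by rewrite ltn_divLR // mulnC; lia.
Qed.

Lemma long_cycle_gt12 (t h L : nat) : (0 < t)%N -> (4 * t * (2 * t + 1) <= h)%N ->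
  (h < t * L)%N -> (12 < L)%N.
Proof.
move=> t0 hh hL; rewrite -(ltn_pmul2l t0); apply: leq_ltn_trans hL.
apply: leq_trans hh; rewrite [(4 * t)%N]mulnC -mulnA leq_mul2l; apply/orP; right.
by lia.
Qed.

Lemma induced_cycle_arith (t h L W : nat) : W = 1%N -> (h < t * L)%N ->
  (2 * ((h - 1) %/ (2 * t + 1 - W)).+1 < L + 4)%N.
Proof.
move=> -> hL; rewrite addnK; set k := (_ %/ _)%N.
have t0 : (0 < t)%N by case: (t) hL.
have : (k * (2 * t) <= h - 1)%N by apply: leq_trunc_div.
move=> hk; suff : (t * (2 * k) <= t * L)%N by rewrite leq_pmul2l //; lia.
by rewrite (_ : t * (2 * k) = k * (2 * t))%N; lia.
Qed.

Lemma common_cycle_arith (t h w L : nat) : (0 < t)%N -> (4 * t * (2 * t + 1) <= h)%N ->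
  (h < t * L)%N -> (((h - 1) %/ (2 * t + 1 - (t - w))).+1 < L)%N.
Proof.
move=> t0 hh hL; set k := (_ %/ _)%N.
have h1 : (4 * (2 * t + 1) < L)%N.
  by rewrite -(ltn_pmul2l t0); apply: leq_ltn_trans hL; apply: leq_trans hh; lia.
have hk : (k * (t + 1) <= h - 1)%N.
  apply: leq_trans (leq_trunc_div (h - 1) (2 * t + 1 - (t - w))).
  by rewrite leq_mul2l; apply/orP; right; lia.
rewrite ltnNge; apply/negP => Lk.
have : ((L - 1) * (t + 1) <= k * (t + 1))%N by rewrite leq_mul2r; apply/orP; right; lia.
rewrite mulnBl mulnDr muln1 mul1n; move: hk hL h1; rewrite [(L * t)%N]mulnC.
by clear; lia.
Qed.

Lemma c0_gt0 (t h c : nat) : (0 < t)%N -> (4 * t * (2 * t + 1) <= h)%N ->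
  c = ((h %/ t + 1) %/ 3)%N -> (0 < c)%N.
Proof.
move=> t0 hh ->; rewrite divn_gt0 //.
have : (12 <= h %/ t)%N; last by lia.
rewrite leq_divRL //; apply: leq_trans hh; rewrite [(4 * t)%N]mulnC -mulnA mulnC leq_mul2l.
by apply/orP; right; lia.
Qed.

(** * Optimal weighted reduced graphs *)

(** The proportion of pairs to be changed between two parts of a quasirandom graph of density [p]:
    edges go if adjacency is forbidden, nonedges if nonadjacency is. White costs [p], black [1 - p],
    gray nothing. *)
Definition edit_cost (R : realType) (T : Type) (p : R) (al : bool -> rel T) (u v : T) : R :=
  p * (~~ al true u v)%:R + (1 - p) * (~~ al false u v)%:R.

Section Structure.
Variables (R : realType) (T : finType) (p : R) (al : bool -> rel T) (y : T -> R).
Hypotheses (p0 : 0 < p) (p_half : 2 * p < 1).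
Hypothesis alC : forall be u v, al be u v = al be v u.
Hypothesis al_cover : forall u v, al true u v || al false u v.
Hypothesis al_diag : forall u, ~~ (al true u u && al false u u).
Hypotheses (y_gt0 : forall u, 0 < y u) (y_sum : \sum_u y u = 1).

Let M := edit_cost p al.
Hypothesis y_min :
  forall z, (forall u, 0 <= z u) -> \sum_u z u = 1 -> quad_form M y <= quad_form M z.
Hypothesis y_core : forall z, (forall u, 0 <= z u) -> \sum_u z u = 1 ->
  (exists u, z u = 0) -> quad_form M y < quad_form M z.

Let symM u v : M u v = M v u.
Proof. by rewrite /M /edit_cost !(alC _ u v). Qed.

Let M_ge0 u v : 0 <= M u v.
Proof.
have q0 : 0 <= 1 - p by move: p0 p_half; lra.
by apply: addr_ge0; apply: mulr_ge0; rewrite ?ler0n // ltW.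
Qed.

Let M_gray u v : al true u v -> al false u v -> M u v = 0.
Proof. by rewrite /M /edit_cost => -> ->; rewrite !mulr0 addr0. Qed.

Let M_nongray u v : ~~ (al true u v && al false u v) -> p <= M u v.
Proof.
rewrite /M /edit_cost; have := al_cover u v.
by move: p0 p_half; case: (al true u v); case: (al false u v) => //= ? ? _ _; lra.
Qed.

Let M_white u : ~~ al true u u -> M u u = p.
Proof.
have := al_cover u u; rewrite /M /edit_cost.
by case: (al true u u) => //= -> _; rewrite mulr0 addr0 mulr1.
Qed.

Let M_black u : al true u u -> M u u = 1 - p.
Proof.
have := al_diag u; rewrite /M /edit_cost => + uu; rewrite uu /= => ->.
by rewrite mulr0 add0r mulr1.
Qed.

Let My u : mulv M y u = quad_form M y.
Proof. exact: mulv_quad_form. Qed.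

(* Moving the weight of all non-gray neighbours of a white vertex u to u does
   not increase the quadratic form. *)
Lemma white_gray u z : ~~ al true u u -> z != u -> al true u z && al false u z.
Proof.
move=> wu zu; apply/negPn/negP => ngz.
pose W a := (a != u) && ~~ (al true u a && al false u a).
pose s := \sum_a (W a)%:R * y a.
pose w a := - ((W a)%:R * y a).
pose m := \sum_a M u a * ((W a)%:R * y a).
have Wy0 a : 0 <= (W a)%:R * y a by rewrite mulr_ge0 ?ler0n // ltW.
have s0 : 0 <= s by apply: sumr_ge0.
have gE : quad_form M y = p * y u + m.
  rewrite -(My u) /mulv /m (bigD1 u) //= [in RHS](bigD1 u) //= M_white //.
  rewrite {1}/W eqxx /= mul0r mulr0 add0r; congr (_ + _).
  apply: eq_bigr => a au; rewrite /W au /=.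
  case ga : (al true u a && al false u a); rewrite /= ?mul1r // mul0r mulr0.
  by case/andP: ga => ? ?; rewrite M_gray // mul0r.
have ms : p * s <= m.
  rewrite /s mulr_sumr; apply: ler_sum => a _.
  case Wa : (W a); last by rewrite mul0r !mulr0.
  by rewrite mul1r ler_wpM2r ?(ltW (y_gt0 a)) //; case/andP: Wa => _; exact: M_nongray.
have qw : quad_form M w <= quad_form M y * s - y u * m.
  have -> : quad_form M y * s - y u * m =
      \sum_a (W a)%:R * y a * (quad_form M y - M a u * y u).
    rewrite /s /m !mulr_sumr -sumrB; apply: eq_bigr => a _.
    by rewrite [M u a]symM; ring.
  rewrite /quad_form; apply: ler_sum => a _.
  rewrite -[X in _ * (X - _)](My a) [w a]/(- _) mulNr -mulrN.
  rewrite ler_wpM2l //.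
  have -> : mulv M y a - M a u * y u = \sum_(v | v != u) M a v * y v.
    by rewrite /mulv (bigD1 u) //= addrAC subrr add0r.
  have -> : - mulv M w a = \sum_(v | v != u) M a v * ((W v)%:R * y v).
    rewrite /mulv -sumrN (bigD1 u) //= {1}/w {1}/W eqxx /= mul0r oppr0 mulr0 oppr0 add0r.
    by apply: eq_bigr => v _; rewrite /w mulrN opprK.
  apply: ler_sum => v vu; rewrite ler_wpM2l //.
  by case: (W v); rewrite ?mul1r // mul0r ltW.
have := no_flat_direction symM y_gt0 y_sum y_min y_core
  (d := fun a => s * (a == u)%:R + w a).
have sw : \sum_u0 (s * (u0 == u)%:R + w u0) = 0.
  rewrite big_split /= (eq_bigr (fun v => s * (v == u)%:R * 1)); last by move=> v _; rewrite mulr1.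
  by rewrite (sum_delta (fun=> 1)) /w sumrN mulr1 subrr.
move=> /(_ sw); rewrite quad_form_delta // M_white //.
have -> : mulv M w u = - m.
  by rewrite /mulv /m -sumrN; apply: eq_bigr => a _; rewrite /w mulrN.
move=> F; have {F} : 0 < s ^+ 2 * p + 2 * (s * - m) + quad_form M w.
  apply: F => [a|].
    have [->|au] := eqVneq a u.
      by rewrite /w /W eqxx /= mul0r oppr0 addr0 mulr1 addr_ge0 // ltW.
    rewrite mulr0 add0r /w; case: (W a); rewrite ?mul1r ?subrr // mul0r subr0 ltW //.
  by exists z; rewrite /w /W zu (negbTE zu) /= ngz mul1r mulr0 add0r subrr.
(* By [gE] and [qw] the form of the shift is at most [(p * s - m) * (s + y u)], and [ms] makes this
   nonpositive. *)
have : (p * s - m) * (s + y u) <= 0.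
  by rewrite mulr_le0_ge0 //; [lra|rewrite addr_ge0 // ltW].
by move: qw; rewrite gE; nra.
Qed.

(** If the pair were black, all costs among [u] and [v] would equal [1 - p], and moving the weight
    of [v] to [u] would be a flat direction. *)
Lemma black_nonedge u v : al true u u -> al true v v -> u != v -> al false u v.
Proof.
move=> bu bv uv; apply/negPn/negP => nf.
have tuv : al true u v by have := al_cover u v; rewrite (negbTE nf) orbF.
have Muv : M u v = 1 - p by rewrite /M /edit_cost tuv nf mulr0 add0r mulr1.
pose w a : R := - y v * (a == v)%:R + 0.
have vu : (v == u) = false by rewrite eq_sym (negbTE uv).
have q0 : quad_form M (fun=> 0) = 0 by rewrite /quad_form big1 // => a _; rewrite mul0r.
have m0 b : mulv M (fun=> 0) b = 0 by rewrite /mulv big1 // => a _; rewrite mulr0.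
have := no_flat_direction symM y_gt0 y_sum y_min y_core
  (d := fun a => y v * (a == u)%:R + w a).
rewrite !quad_form_delta // q0 m0 mulvD mulv_delta m0 Muv !M_black //.
rewrite (_ : _ + _ = 0); last by ring.
rewrite ltxx => F; suff : false by []; apply: F.
- rewrite !big_split /= big1_eq (eq_bigr (fun a => y v * (a == u)%:R * 1)); last by move=> a _; rewrite mulr1.
  rewrite (sum_delta (fun=> 1)) (eq_bigr (fun a => - y v * (a == v)%:R * 1)); last by move=> a _; rewrite mulr1.
  by rewrite (sum_delta (fun=> 1)); ring.
- move=> a; rewrite /w; case: (eqVneq a v) => [->|_].
    by rewrite vu /=; lra.
  by case: eqP => _; have := y_gt0 a; have := y_gt0 v => /=; lra.
- by exists v; rewrite /w eqxx vu /=; ring.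
Qed.

(** By [black_nonedge] two distinct black vertices of a minimizer always allow a nonedge, so
    [al true u v] alone says that the pair is gray. *)
Definition gray_rel : rel T :=
  fun u v => [&& al true u u, al true v v, u != v & al true u v].

(** The weight that every white vertex turns out to have. *)
Let ga := quad_form M y / p.
Let w := #|[pred u | ~~ al true u u]|.
Let b := \sum_(u | al true u u) y u.

Let gaE : quad_form M y = ga * p.
Proof. by rewrite /ga mulfVK // gt_eqF. Qed.

Lemma white_weight u : ~~ al true u u -> y u = ga.
Proof.
move=> wu; have := My u; rewrite /mulv (bigD1 u) //= M_white // big1 => [|v vu].
  by rewrite addr0 gaE mulrC => /(mulIf (lt0r_neq0 p0)).
have /andP[t f] := white_gray wu vu.
by rewrite M_gray // mul0r.
Qed.

Lemma black_total : b = 1 - w%:R * ga.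
Proof.
have : \sum_(u | ~~ al true u u) y u = w%:R * ga.
  rewrite (eq_bigr (fun=> ga)); last by move=> u; exact: white_weight.
  by rewrite sumr_const mulr_natl.
move=> F; have E := y_sum; rewrite (bigID (fun u => al true u u)) /= in E.
by rewrite /b -F -E addrK.
Qed.

(** This is [mulv M y v = quad_form M y] spelled out: pairs with white vertices are free, non-gray
    pairs with other black vertices cost [p], and [v] itself costs [1 - p]. *)
Lemma gray_degree v : al true v v ->
  p * \sum_(z | gray_rel v z) y z = p * (b - ga) + (1 - 2 * p) * y v.
Proof.
move=> bv; have := My v; rewrite /mulv (bigD1 v) //= M_black // gaE => E.
have -> : p * \sum_(z | gray_rel v z) y z = p * (b - y v) - \sum_(i | i != v) M v i * y i.
  have -> : b - y v = \sum_(i | al true i i && (i != v)) y i.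
    by rewrite /b (bigD1 v) //= addrAC subrr add0r.
  rewrite [in LHS]big_mkcond [X in _ = p * X - _]big_mkcond.
  rewrite [X in _ = _ - X]big_mkcond /= !mulr_sumr -sumrB.
  apply: eq_bigr => z _; rewrite /gray_rel bv /= [v == z]eq_sym.
  case zv : (z != v); rewrite ?andbF ?andbT /= ?mulr0 ?subr0 //.
  case bz : (al true z z) => /=; last first.
    have := @white_gray z v; rewrite bz eq_sym zv => /(_ isT isT)/andP[t f].
    by rewrite mulr0 M_gray ?mul0r ?subr0 // alC.
  have vz : v != z by rewrite eq_sym.
  rewrite /M /edit_cost black_nonedge //=.
  by case: (al true v z) => /=; ring.
by rewrite -[X in _ - X](addKr ((1 - p) * y v)) E; ring.
Qed.

Lemma black_weight v : al true v v -> (1 - p) * y v <= ga * p.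
Proof.
move=> bv; rewrite -gaE -(My v) /mulv (bigD1 v) //= M_black // lerDl.
by apply: sumr_ge0 => z _; rewrite mulr_ge0 // ltW.
Qed.
End Structure.

(** * Embedding into a cheapest counterexample *)

Section Core.
Variables (R : realType) (T : finType) (p : R) (al : bool -> rel T) (y : T -> R).
Variables (t h l c0 : nat).
Hypotheses (t0 : (0 < t)%N) (hh : (4 * t * (2 * t + 1) <= h)%N) (th : (t.+1 %| h)%N).
Hypotheses (lh : (l.-1 * (2 * t + 1) < h)%N) (hl : (h <= l * (2 * t + 1))%N).
Hypothesis c0E : c0 = ((h %/ t + 1) %/ 3)%N.
Hypotheses (p0 : 0 < p) (lp : l%:R * p <= 1).
Hypothesis p0p : t%:R <= p * ((c0%:R - 1) * (l%:R - 1) + t%:R).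
Hypothesis alC : forall be u v, al be u v = al be v u.
Hypothesis al_cover : forall u v, al true u v || al false u v.
Hypothesis al_diag : forall u, ~~ (al true u u && al false u u).
Hypotheses (y_gt0 : forall u, 0 < y u) (y_sum : \sum_u y u = 1).
Let M := edit_cost p al.
Hypothesis y_min :
  forall z, (forall u, 0 <= z u) -> \sum_u z u = 1 -> quad_form M y <= quad_form M z.
Hypothesis y_core : forall z, (forall u, 0 <= z u) -> \sum_u z u = 1 ->
  (exists u, z u = 0) -> quad_form M y < quad_form M z.
Let ga := quad_form M y / p.
(** The value at [y] is below the claimed bound; both sides are divided by [p] and cleared of the
    denominator. *)
Hypothesis gaD : ga * (t%:R * (1 - p) + (l%:R - 1) * p) < 1 - p.

Let l4 : (4 * t <= l)%N.
Proof. exact: leq_cliques hh hl. Qed.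

Let l3 : (2 < l)%N.
Proof. by apply: leq_trans l4; apply: (@leq_trans 4) => //; apply: leq_pmulr. Qed.

Let l4R : 4 <= l%:R :> R.
Proof. by rewrite (ler_nat _ 4) (leq_trans _ l4) // leq_pmulr. Qed.

Let p4 : 4 * p <= 1.
Proof. by apply: le_trans lp; rewrite ler_pM2r. Qed.

Let p_half : 2 * p < 1. Proof. by move: p0 p4; lra. Qed.

Let tR : 1 <= t%:R :> R. Proof. by rewrite (ler_nat _ 1). Qed.

Let whites := enum [pred u | ~~ al true u u].
Let blacks := enum [pred u | al true u u].
Let w := size whites.

Let u0 : T.
Proof.
case: (pickP T) => [u _|T0]; first exact: u.
by exfalso; move: y_sum; rewrite big_pred0 // => /esym/eqP; rewrite oner_eq0.
Qed.

Let wE : w = #|[pred u | ~~ al true u u]|. Proof. by rewrite /w -cardE. Qed.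

Let ga0 : 0 < ga.
Proof.
rewrite divr_gt0 // -(mulv_quad_form _ y_gt0 y_sum y_min u0); last first.
  by move=> u v; rewrite /M /edit_cost !(alC _ u v).
have M0 a c : 0 <= M a c.
  by rewrite /M /edit_cost addr_ge0 // mulr_ge0 ?ler0n //; move: p0 p_half; lra.
rewrite /mulv (bigD1 u0) //= ltr_wpDr //.
  by apply: sumr_ge0 => v _; rewrite mulr_ge0 // ltW.
rewrite mulr_gt0 // /M /edit_cost; have := al_diag u0; have := al_cover u0 u0.
by case: (al true u0 u0); case: (al false u0 u0) => //= _ _; move: p0 p_half; lra.
Qed.

Let gat : ga * t%:R < 1.
Proof.
have h1 : 0 < 1 - p by move: p0 p_half; lra.
rewrite -(ltr_pM2r h1) mul1r; apply: le_lt_trans gaD.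
rewrite -mulrA ler_pM2l ?ga0 // lerDl mulr_ge0 //; first by move: l4R; lra.
exact: ltW.
Qed.

Let b := \sum_(u | al true u u) y u.
Let bE : b = 1 - w%:R * ga.
Proof.
by rewrite wE; apply: (black_total p0 p_half alC al_cover y_gt0 y_sum y_min y_core).
Qed.

Let wh a := nth u0 whites a.
Let whP a : (a < w)%N -> ~~ al true (wh a) (wh a).
Proof. by move=> aw; have := mem_nth u0 aw; rewrite mem_enum. Qed.

Let wh_self a : (a < w)%N -> al false (wh a) (wh a).
Proof. by move=> /whP; have := al_cover (wh a) (wh a); case: al. Qed.

Let wg u z be : ~~ al true u u -> z != u -> al be u z.
Proof.
move=> wu zu.
have /andP[] := white_gray p0 p_half alC al_cover y_gt0 y_sum y_min y_core wu zu.
by case: be.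
Qed.

Let wh_wh be a a' : (a < w)%N -> (a' < w)%N -> a != a' -> al be (wh a) (wh a').
Proof.
move=> aw aw' aa'; apply: wg (whP aw) _.
by rewrite /wh nth_uniq ?enum_uniq // eq_sym.
Qed.

Let wh_black be a v : (a < w)%N -> al true v v -> al be (wh a) v.
Proof.
move=> aw bv; apply: wg (whP aw) _; apply: contraTneq bv => ->; exact: whP.
Qed.

Let bb u v : al true u u -> al true v v -> u != v -> al false u v.
Proof. exact: (black_nonedge alC al_cover al_diag y_gt0 y_sum y_min y_core). Qed.

Let t_lt_h : (t < h)%N. Proof. by apply: leq_ltn_trans (ltn_power_length t0 hh); apply: leq_pmull. Qed.

Let embed := embeds (graph_power (cycle_graph h) t) al.

Lemma core_many_white : (t < w)%N -> embed.
Proof.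
move=> tw; apply: (embeds_color (wh := wh)) => //.
  by move=> be a a' at1 at1'; apply: wh_wh; apply: leq_trans tw.
by move=> a at1; apply: wh_self; apply: leq_trans at1 tw.
Qed.

Let y_black v : al true v v -> (1 - p) * y v <= ga * p.
Proof.
exact: (black_weight p0 p_half alC al_diag y_gt0 y_sum y_min).
Qed.

(** Fewer than [l] black vertices, each of weight at most [ga * p / (1 - p)], cannot carry the black
    weight [1 - t * ga]: that comparison is [gaD]. *)
Lemma core_t_white : w = t -> embed.
Proof.
move=> wt; have [lb|bl] := leqP l (size blacks).
  have bP c : (c < l)%N -> al true (nth u0 blacks c) (nth u0 blacks c).
    by move=> cl; have := mem_nth u0 (leq_trans cl lb); rewrite mem_enum.
  apply: (@embeds_blocks h t t l t.+1 (t.+1 + t) _ _ wh (nth u0 blacks)) => //.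
  - exact: leq_blocks l3 lh.
  - by rewrite mulnC addSn addnn -mul2n -addn1.
  - by move=> be a a' at1 at1'; apply: wh_wh; rewrite wt.
  - by move=> be a c at1 cl; apply: wh_black; rewrite ?wt ?bP.
  - by move=> a at1; apply: wh_self; rewrite wt.
  - move=> c c' cl cl' cc'; apply: bb; rewrite ?bP //.
    by rewrite nth_uniq ?enum_uniq ?(leq_trans _ lb).
  - by rewrite ltnn.
exfalso.
have h1 : 0 < 1 - p by move: p0 p_half; lra.
have : (1 - p) * b <= (l%:R - 1) * (ga * p).
  rewrite /b mulr_sumr; apply: (@le_trans _ _ (\sum_(u | al true u u) ga * p)).
    by apply: ler_sum => u bu; apply: y_black.
  rewrite sumr_const -[X in X <= _]mulr_natl.
  apply: ler_wpM2r; first by apply: mulr_ge0; apply: ltW.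
  rewrite lerBrDr natr1 ler_nat; move: bl; rewrite /blacks -cardE.
  by congr (_ <= _)%N.
rewrite bE wt; move: gaD.
rewrite mulrDr => F; have := ltW ga0; lra.
Qed.

Let h1p : 0 < 1 - p. Proof. by move: p0 p_half; lra. Qed.

(** Weight [1 - x * ga] is more than [(t - x + 1) * (l - 1)] black vertices of maximal weight
    [ga * p / (1 - p)] can carry. For [x = t] this is [gaD]; the loss for smaller [x] is
    [ga * (t - x) * (1 - l * p)], nonnegative because [p <= 1 / l]. *)
Lemma core_slack (x : R) : x <= t%:R ->
  ga * p * ((t%:R - x + 1) * (l%:R - 1)) < (1 - p) * (1 - x * ga).
Proof.
move=> xt; have e : ga * p * ((t%:R - x + 1) * (l%:R - 1)) <=
    ga * (t%:R * (1 - p) + (l%:R - 1) * p) - x * ga * (1 - p).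
  rewrite -subr_ge0.
  have -> : ga * (t%:R * (1 - p) + (l%:R - 1) * p) - x * ga * (1 - p) -
    ga * p * ((t%:R - x + 1) * (l%:R - 1)) =
    ga * (t%:R - x) * (1 - l%:R * p) by ring.
  apply: mulr_ge0; last by rewrite subr_ge0.
  by apply: mulr_ge0; [exact: ltW | rewrite subr_ge0].
apply: le_lt_trans e _; move: gaD; lra.
Qed.

Let r := gray_rel al.

Let symr : symmetric r.
Proof.
move=> u v; rewrite /r /gray_rel eq_sym alC.
by case: (al true u u); case: (al true v v).
Qed.

Let irrr : irreflexive r.
Proof. by move=> u; rewrite /r /gray_rel eqxx !andbF. Qed.

Let domr u v : r u v -> al true v v.
Proof. by case/and4P. Qed.

Let degE v : al true v v ->
  \sum_(z | r v z) y z = b - ga + (1 - 2 * p) / p * y v.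
Proof.
move=> bv; apply: (mulfI (lt0r_neq0 p0)).
rewrite (gray_degree p0 p_half alC al_cover al_diag y_gt0 y_sum y_min y_core bv).
by rewrite -/b -/M -/ga; field; rewrite lt0r_neq0.
Qed.

Let deg_gt v : al true v v -> b - ga < \sum_(z | r v z) y z.
Proof.
move=> bv; rewrite degE // ltrDl mulr_gt0 // divr_gt0 //.
by move: p_half; lra.
Qed.

Let m := ((h - 1) %/ (2 * t + 1 - (t - w)))%N.

Lemma core_long_cycle : (w < t)%N ->
  exists c, [/\ cycle r c, uniq c & (m < size c)%N].
Proof.
move=> wt; have wtR : w%:R + 1 <= t%:R :> R by rewrite natr1 ler_nat.
have b0 : 0 < b.
  rewrite bE subr_gt0 mulrC; apply: le_lt_trans gat.
  by rewrite ler_pM2l ?ga0 // ler_nat ltnW.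
have [v bv] : exists v, al true v v.
  apply/existsP; apply: contraTT b0 => /existsPn nb.
  by rewrite /b big_pred0 ?ltxx // => v; apply/negbTE.
have tw0 : (0 < t - w)%N by rewrite subn_gt0.
have mle : m%:R <= (t%:R - w%:R + 1) * (l%:R - 1) :> R.
  have := long_path_arith tw0 (leq_subr _ _) hh hl.
  rewrite -/m -(ler_nat R) natrM natrD natrB ?(ltnW wt) // natrB //.
  exact: leq_trans l3.
have gp0 : 0 < ga * p by rewrite mulr_gt0 ?ga0.
have m1 : (1 < m)%N.
  exact: long_path_gt1.
(* As [(k + 1) * M] equals [ga], the two conditions of [long_cycle] read [m * M < 2 * (b - ga)] and
   [m * M < b]; they are [core_slack] at [w + 1] and at [w]. *)
apply: (@long_cycle R T r (fun v => al true v v) y (b - ga)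
  ((1 - 2 * p) / p) (ga * p / (1 - p)) m symr irrr domr _ _ m1 _ _ v bv).
- move=> u bu; rewrite ltW //= ler_pdivlMr // mulrC; exact: y_black.
- by move=> u bu; rewrite degE.
- rewrite mulrA ltr_pdivrMr //.
  have s1 := core_slack wtR.
  apply: (@le_lt_trans _ _ (2 * (ga * p * ((t%:R - (w%:R + 1) + 1) * (l%:R - 1))))).
    rewrite [ga * p * _]mulrC [2 * _]mulrA ler_pM2r //.
    apply: le_trans mle _; rewrite [2 * _]mulrA ler_pM2r; last by move: l4R; lra.
    by lra.
  by move: s1; rewrite bE; lra.
- have -> : ((1 - 2 * p) / p + 1) * (ga * p / (1 - p)) = ga.
    by field; rewrite !lt0r_neq0.
  rewrite addrNK mulrA ltr_pdivrMr // bE.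
  have s1 : w%:R <= t%:R :> R by rewrite ler_nat ltnW.
  have := core_slack s1; rewrite [X in _ < X]mulrC; apply: le_lt_trans.
  by rewrite mulrC ler_pM2l.
Qed.

Lemma core_short_cycle (c : seq T) : (w <= t)%N -> cycle r c -> uniq c ->
  (m < size c)%N -> (size c * t <= h)%N -> embed.
Proof.
move=> wt cyc unc mc ch.
have m1 : (1 < m)%N by exact: long_path_gt1.
have L2 : (2 < size c)%N by exact: leq_ltn_trans mc.
have bc v : v \in c -> al true v v.
  by move=> vc; have /and4P[] := next_cycle cyc vc.
have bP e : (e < size c)%N -> al true (nth u0 c e) (nth u0 c e).
  by move=> ec; apply: bc; apply: mem_nth.
have gray_next e : (e < size c)%N -> al true (nth u0 c e) (nth u0 c (e.+1 %% size c)%N).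
  move=> ec; have := next_cycle cyc (mem_nth u0 ec).
  rewrite next_nth mem_nth // index_uniq // => /and4P[_ _ _].
  case: (c) ec => [|x q] //= ec; move: ec; rewrite ltnS leq_eqVlt => /orP[/eqP->|eq].
    by rewrite modnn [nth x q _]nth_default.
  by rewrite modn_small //= (set_nth_default u0).
(* A short cycle has blocks of at least [t.+1] positions, and the white vertices absorb the surplus;
   otherwise blocks of at most [t.+1] positions do without white vertices. *)
have [hL|hL] := leqP (size c * t.+1) h.
  apply: (@embeds_blocks h t w (size c) t.+1 (t.+1 + w) _ _ wh (nth u0 c)) => //.
  - by rewrite mulnC.
  - exact: short_cycle_arith.
  - by move=> be a e aw ec; apply: wh_black; rewrite ?bP.
  - by move=> e e' ec ec' ee'; apply: bb; rewrite ?bP // nth_uniq.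
apply: (@embeds_blocks h t 0 (size c) t t.+1 _ _ wh (nth u0 c)) => //.
- by rewrite mulnC.
- by rewrite mulnC ltnW.
- by rewrite addn0.
- by move=> e e' ec ec' ee'; apply: bb; rewrite ?bP // nth_uniq.
Qed.

(** Double counting: the gray degrees along [c] sum to at most [3 * b] by [few_neighbors], yet each
    exceeds [b - ga = 1 - t * ga]. From [h < t * size c] the cycle has at least
    [h %/ t + 1 >= 3 * c0] vertices, and [p0 <= p] yields [c0 * (1 - t * ga) >= 1 >= b]. *)
Lemma core_induced_cycle (c : seq T) : w.+1 = t -> cycle r c -> uniq c ->
  (forall c', cycle r c' -> uniq c' -> (m < size c')%N -> (size c <= size c')%N) ->
  (h < t * size c)%N -> False.
Proof.
move=> wt cyc unc minc hc.
have c13 : (12 < size c)%N by exact: long_cycle_gt12 hh hc.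
have mc : (2 * m.+1 < size c + 4)%N.
  by apply: induced_cycle_arith hc; rewrite // -wt subSnn.
have cnt z := few_neighbors u0 symr irrr cyc unc minc z mc (leq_trans (isT : 7 < 13)%N c13).
have bc v : v \in c -> al true v v.
  by move=> vc; have /and4P[] := next_cycle cyc vc.
have le3 : \sum_(v <- c) \sum_(z | r v z) y z <= 3 * b.
  rewrite (eq_bigr (fun v => \sum_(z | al true z z) if r v z then y z else 0)); last first.
    move=> v _; rewrite -big_mkcondr; apply: eq_bigl => z.
    by case rvz : (r v z); rewrite ?andbF // andbT; move: rvz => /and4P[_ ->].
  rewrite exchange_big /= /b mulr_sumr; apply: ler_sum => z _.
  rewrite -big_mkcond big_const_seq iter_addr_0 -[X in X <= _]mulr_natl.
  apply: ler_wpM2r; first exact: ltW.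
  rewrite (ler_nat _ _ 3) (eq_count (a2 := r z)) ?cnt // => v; exact: symr.
have lt3 : (size c)%:R * (b - ga) < \sum_(v <- c) \sum_(z | r v z) y z.
  have -> : (size c)%:R * (b - ga) = \sum_(v <- c) (b - ga).
    by rewrite big_const_seq iter_addr_0 count_predT mulr_natl.
  rewrite !big_seq; apply: ltr_sum => [|v vc]; last by apply: deg_gt; apply: bc.
  by case: (c) c13 => // x q _; rewrite /= mem_head.
have c03 : (3 * c0 <= size c)%N.
  rewrite c0E mulnC; apply: leq_trans (leq_trunc_div _ _) _.
  by rewrite addn1 ltn_divLR // mulnC.
have c01 : (1 <= c0)%N by exact: c0_gt0 c0E.
have c01R : 1 <= c0%:R :> R by rewrite (ler_nat _ 1).
have key : c0%:R * (ga * t%:R) <= c0%:R - 1.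
  rewrite -(ler_pM2r h1p).
  have e1 : 0 <= c0%:R - 1 :> R by lra.
  have e2 : (c0%:R - 1) * (ga * (t%:R * (1 - p) + (l%:R - 1) * p)) <= (c0%:R - 1) * (1 - p).
    by rewrite ler_wpM2l // ltW.
  apply: le_trans e2.
  have -> : (c0%:R - 1) * (ga * (t%:R * (1 - p) + (l%:R - 1) * p)) =
    ga * (c0%:R * t%:R * (1 - p) + (p * ((c0%:R - 1) * (l%:R - 1) + t%:R) - t%:R)) by ring.
  have -> : c0%:R * (ga * t%:R) * (1 - p) = ga * (c0%:R * t%:R * (1 - p)) by ring.
  by rewrite ler_pM2l ?ga0 // lerDl subr_ge0.
have bg : b - ga = 1 - ga * t%:R by rewrite bE -wt -natr1; ring.
have bg0 : 0 < b - ga by rewrite bg subr_gt0.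
have : 3 * c0%:R * (b - ga) <= (size c)%:R * (b - ga).
  by rewrite ler_pM2r // -natrM ler_nat.
have bE' : b = 1 - ga * t%:R + ga by rewrite -bg addrNK.
have g1 : ga * 1 <= ga * t%:R by rewrite ler_pM2l ?ga0.
by move: le3 lt3; rewrite bg bE'; lra.
Qed.

(** Inclusion-exclusion gives any two vertices of [c] a common gray neighbourhood of weight above
    [b - 2 * ga]. By [core_slack] at [w + 2] this takes more than [(t - w - 1) * (l - 1)]
    vertices. *)
Lemma core_common_neighbors (c : seq T) : (w.+1 < t)%N -> cycle r c -> uniq c ->
  (forall c', cycle r c' -> uniq c' -> (m < size c')%N -> (size c <= size c')%N) ->
  (h < t * size c)%N -> False.
Proof.
move=> wt cyc unc minc hc.
have c13 : (12 < size c)%N by exact: long_cycle_gt12 hh hc.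
have mL : (m.+1 < size c)%N by exact: common_cycle_arith hh hc.
have [u [v [uc vc few]]] :=
  few_common_neighbors u0 symr irrr cyc unc minc mL (leq_trans (isT : 5 < 13)%N c13).
have bc x : x \in c -> al true x x.
  by move=> xc; have /and4P[] := next_cycle cyc xc.
have tw1 : (1 < t - w)%N by rewrite ltn_subRL addn1.
have := leq_trans few (common_arith tw1 (leq_subr _ _) hh hl hc).
set k := #|_| => kle.
pose S := \sum_(z | r u z && r v z) y z.
have S1 : b - 2 * ga < S.
  have : \sum_(z | r u z) y z + \sum_(z | r v z) y z <= S + b.
    rewrite /S /b [X in X + _]big_mkcond [X in _ + X <= _]big_mkcond.
    rewrite [X in _ <= X + _]big_mkcond [X in _ <= _ + X]big_mkcond /= -!big_split /=.
    apply: ler_sum => z _; have yz := ltW (y_gt0 z).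
    case ruz : (r u z); case rvz : (r v z); rewrite /= ?addr0 ?add0r //.
    - by move: ruz => /and4P[_ ->].
    - by move: ruz => /and4P[_ ->].
    - by move: rvz => /and4P[_ ->].
    - by case: (al true z z).
  have := deg_gt (bc _ uc); have := deg_gt (bc _ vc); lra.
have S2 : (1 - p) * S <= k%:R * (ga * p).
  rewrite /S mulr_sumr; apply: (@le_trans _ _ (\sum_(z | r u z && r v z) ga * p)).
    by apply: ler_sum => z /andP[/domr bz _]; apply: y_black.
  rewrite sumr_const -[X in X <= _]mulr_natl ler_wpM2r //.
    by apply: mulr_ge0; apply: ltW.
  by rewrite ler_nat /k cardsE.
have wtR : w%:R + 2 <= t%:R :> R by rewrite -natrD ler_nat addn2.
have := core_slack wtR.
have kR : k%:R <= (t%:R - w%:R - 1) * (l%:R - 1) :> R.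
  move: kle; rewrite -(ler_nat R) natrM natrB ?(ltnW tw1) //.
  rewrite natrB ?natrB //; first exact: leq_trans l3.
  by apply: ltnW; apply: ltnW.
have : k%:R * (ga * p) <= (t%:R - w%:R - 1) * (l%:R - 1) * (ga * p).
  by rewrite ler_wpM2r // mulr_ge0 // ltW.
have : (1 - p) * (b - 2 * ga) < (1 - p) * S by rewrite ltr_pM2l.
by rewrite bE; lra.
Qed.

Lemma core_embeds : embed.
Proof.
have [tw|tw|wt] := ltngtP t w; first exact: core_many_white; last exact: core_t_white.
have [c1 [cyc1 unc1 mc1]] := core_long_cycle tw.
have ex : exists n, `[< exists c, [/\ cycle r c, uniq c, size c = n & (m < n)%N] >].
  by exists (size c1); apply/asboolP; exists c1.
case: (ex_minnP ex) => n /asboolP[c [cyc unc cn mn]] nmin; rewrite -cn in mn nmin.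
have [cs|cl] := leqP (size c * t) h.
  exact: core_short_cycle (ltnW tw) cyc unc mn cs.
exfalso; rewrite mulnC in cl.
have minc c' : cycle r c' -> uniq c' -> (m < size c')%N -> (size c <= size c')%N.
  by move=> cyc' unc' mc'; apply: nmin; apply/asboolP; exists c'.
move: tw; rewrite leq_eqVlt => /orP[/eqP wt|wt].
  exact: core_induced_cycle wt cyc unc minc cl.
exact: core_common_neighbors wt cyc unc minc cl.
Qed.
End Core.

(** Induction on the number of vertices: a weighting with a zero lives on a smaller reduced graph,
    where the bound holds. A minimizer below the bound is therefore interior and strictly better
    than every boundary weighting, as [core_embeds] requires. *)
Lemma crg_lower_bound (R : realType) (t h l c0 : nat) (p : R) :
  (0 < t)%N -> (4 * t * (2 * t + 1) <= h)%N -> (t.+1 %| h)%N ->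
  (l.-1 * (2 * t + 1) < h)%N -> (h <= l * (2 * t + 1))%N ->
  c0 = ((h %/ t + 1) %/ 3)%N ->
  0 < p -> l%:R * p <= 1 -> t%:R <= p * ((c0%:R - 1) * (l%:R - 1) + t%:R) ->
  forall (T : finType) (al : bool -> rel T) (x : T -> R),
  (forall be u v, al be u v = al be v u) ->
  (forall u v, al true u v || al false u v) ->
  (forall u, ~~ (al true u u && al false u u)) ->
  ~ embeds (graph_power (cycle_graph h) t) al ->
  (forall u, 0 <= x u) -> \sum_u x u = 1 ->
  p * (1 - p) / (t%:R + (l%:R - t%:R - 1) * p) <= quad_form (edit_cost p al) x.
Proof.
move=> t0 hh th lh hl c0E p0 lp p0p T.
have [n] := ubnP #|T|; elim: n T => // n IHn T Tn al x alC cover diag nemb x0 x1.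
have [u0 _] : exists u : T, True.
  case: (pickP T) => [u _|T0]; first by exists u.
  by move: x1; rewrite big_pred0 // => /esym/eqP; rewrite oner_eq0.
set val := _ / _; set M := edit_cost p al.
have [y [y0 y1 ymin]] := quad_form_minimizer M u0.
have [vy|yv] := leP val (quad_form M y); first exact: le_trans vy (ymin _ x0 x1).
have face z u : (forall v, 0 <= z v) -> \sum_v z v = 1 -> z u = 0 -> val <= quad_form M z.
  move=> z0 z1 zu; pose A := [pred v | v != u].
  have sumA (F : T -> R) : F u = 0 -> \sum_v F v = \sum_(a : {a in A}) F (\val a).
    move=> Fu; rewrite -(big_sub A F) (bigD1 u) //= Fu add0r.
    by apply: eq_bigl => v; rewrite inE.
  pose al' be (a b : {a in A}) := al be (\val a) (\val b).
  have zq : quad_form M z = quad_form (edit_cost p al') (z \o \val).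
    rewrite /quad_form sumA ?zu ?mul0r //; apply: eq_bigr => a _.
    by rewrite /mulv sumA ?zu ?mulr0.
  rewrite zq; apply: IHn => //.
  - by rewrite card_sig -ltnS; apply: leq_trans Tn; rewrite ltnS; apply: (@proper_card _ A T);
      apply/properP; split; [apply/fintype.subsetP|exists u; rewrite ?inE ?eqxx].
  - by move=> be a b; apply: alC.
  - by move=> a b; apply: cover.
  - by move=> a; apply: diag.
  - by case=> f fP; apply: nemb; exists (\val \o f) => i j ij; apply: fP.
  - by move=> a; apply: z0.
  - by rewrite -z1 [RHS]sumA.
have y_gt0 u : 0 < y u.
  rewrite lt_neqAle y0 andbT eq_sym; apply/eqP => yu.
  by have := face y u y0 y1 yu; rewrite leNgt yv.
exfalso; apply: nemb.
apply: (core_embeds (p := p) (y := y) t0 hh th lh hl c0E) => //.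
- by move=> z z0 z1 [u zu]; apply: lt_le_trans yv _; apply: face zu.
- have l4 : (4 * t <= l)%N by exact: leq_cliques hh hl.
  have l1R : 1 <= l%:R :> R.
    by rewrite (ler_nat _ 1); apply: leq_trans l4; apply: (leq_trans t0); rewrite leq_pmull.
  have tR : 1 <= t%:R :> R by rewrite (ler_nat _ 1).
  have p1 : p < 1.
    have l4R : 4 * p <= l%:R * p.
      by rewrite ler_pM2r // (ler_nat _ 4) (leq_trans _ l4) // leq_pmulr.
    lra.
  have D0 : 0 < t%:R * (1 - p) + (l%:R - 1) * p.
    by apply: ltr_pwDl; [rewrite mulr_gt0 //; lra|rewrite mulr_ge0 //; lra].
  have DE : t%:R + (l%:R - t%:R - 1) * p = t%:R * (1 - p) + (l%:R - 1) * p by ring.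
  move: yv; rewrite /val DE ltr_pdivlMr // -/M => yv.
  by rewrite mulrAC ltr_pdivrMr // [(1 - p) * p]mulrC.
Qed.

(** * Ramsey and box lemmas *)

Lemma ramsey (V : finType) (r : rel V) : symmetric r ->
  forall (n a b : nat) (A : {set V}), (a + b <= n)%N -> (2 ^ n <= #|A|)%N ->
  (exists s : seq V, [/\ size s = a, {subset s <= A}, uniq s &
      {in s &, forall x y, x != y -> r x y}]) \/
  (exists s : seq V, [/\ size s = b, {subset s <= A}, uniq s &
      {in s &, forall x y, x != y -> ~~ r x y}]).
Proof.
move=> symr; elim=> [|n IHn] a b A ab An.
  have -> : a = 0%N by lia.
  by left; exists [::].
case: a ab => [|a] ab; first by left; exists [::].
case: b ab => [|b] ab; first by right; exists [::].
have A0 : (0 < #|A|)%N by apply: leq_trans An; rewrite expn_gt0.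
have [x xA] := card_gt0P A0.
pose N := [set y in A :\ x | r x y]; pose N' := [set y in A :\ x | ~~ r x y].
have NN : (#|N| + #|N'| + 1 = #|A|)%N.
  rewrite (cardsD1 x A) xA addnC; congr (_ + _)%N.
  rewrite -cardsUI (_ : N :&: N' = finset.set0) ?cards0 ?addn0; last first.
    by apply/finset.setP => y; rewrite !inE; case: (r x y); rewrite /= ?andbF.
  by congr #|pred_of_set _|; apply/finset.setP => y; rewrite !inE; case: (r x y); rewrite /= ?andbF ?andbT ?orbF.
have sz : (2 ^ n <= #|N|)%N \/ (2 ^ n <= #|N'|)%N.
  have : (2 ^ n * 2 <= #|A|)%N by rewrite mulnC -expnS.
  rewrite -NN => ?; case: (leqP (2 ^ n) #|N|); [by left|move=> ?; right; lia].
have ext (s : seq V) (P : rel V) : symmetric P -> {subset s <= A :\ x} -> uniq s ->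
    {in s, forall y, P x y} -> {in s &, forall y z, y != z -> P y z} ->
    [/\ {subset x :: s <= A}, uniq (x :: s) & {in x :: s &, forall y z, y != z -> P y z}].
  move=> symP sA us Px Ps; split.
  - by move=> y; rewrite inE => /orP[/eqP->//|/sA]; rewrite !inE => /andP[].
  - by rewrite /= us andbT; apply/negP => /sA; rewrite !inE eqxx.
  - move=> y z; rewrite !inE => /orP[/eqP->|ys] /orP[/eqP->|zs]; rewrite ?eqxx //.
    + by move=> _; apply: Px.
    + by move=> _; rewrite symP; apply: Px.
    + exact: Ps.
have sub1 : {subset N <= A :\ x} by move=> y; rewrite inE => /andP[].
have sub2 : {subset N' <= A :\ x} by move=> y; rewrite inE => /andP[].
have sub3 : {subset A :\ x <= A} by move=> y; rewrite !inE => /andP[].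
case: sz => sz.
  have ab1 : (a + b.+1 <= n)%N by lia.
  case: (IHn _ _ N ab1 sz).
    case=> s [szs sN us Ps]; left; exists (x :: s); rewrite /= szs.
    have [] // := ext s r symr _ us _ Ps; first by move=> y /sN/sub1.
    by move=> y /sN; rewrite inE => /andP[].
  by case=> s [szs sN us Ps]; right; exists s; split=> // y /sN/sub1/sub3.
have ab2 : (a.+1 + b <= n)%N by lia.
case: (IHn _ _ N' ab2 sz).
  by case=> s [szs sN us Ps]; left; exists s; split=> // y /sN/sub2/sub3.
case=> s [szs sN us Ps]; right; exists (x :: s); rewrite /= szs.
have [] // := ext s (fun y z => ~~ r y z) _ _ us _ Ps; first by move=> y z; rewrite symr.
  by move=> y /sN/sub2.
by move=> y /sN; rewrite inE => /andP[].
Qed.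

Lemma exists_subset_card (T : finType) (A : {set T}) (k : nat) : (k <= #|A|)%N ->
  exists2 B : {set T}, B \subset A & #|B| = k.
Proof.
move=> kA; exists [set:: take k (enum A)].
  by apply/fintype.subsetP => x; rewrite inE => /mem_take; rewrite mem_enum.
by rewrite cardsE (card_uniqP _) ?take_uniq ?enum_uniq // size_takel // -cardE.
Qed.

Lemma card_tuple_cons (X : finType) (k : nat) (E : pred (seq X)) :
  #|[set t : k.+1.-tuple X | E t]| = (\sum_x #|[set t : k.-tuple X | E (x :: t)]|)%N.
Proof.
pose g (xt : X * k.-tuple X) := [tuple of xt.1 :: xt.2].
have gbij : bijective g.
  exists (fun t => (thead t, [tuple of behead t])).
    by move=> [x t] /=; congr (_, _); apply/val_inj.
  by move=> t; rewrite /g /= -tuple_eta.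
rewrite -sum1_card (reindex g) /=; last exact: onW_bij.
rewrite -(pair_big_dep xpredT (fun x (t : k.-tuple X) => g (x, t) \in [set t : k.+1.-tuple X | E t]) (fun _ _ => 1%N)) /=.
by apply: eq_bigr => x _; rewrite -sum1_card; apply: eq_bigl => t; rewrite !inE.
Qed.

(* Fix r vertices of large degree; by pigeonhole many of the shorter tuples see
   the same large subset of them. *)
Lemma box_lemma (R : realType) (k s : nat) (d : R) : 0 < d -> exists M0 : nat,
  forall (X : finType) (E : pred (seq X)), (M0 <= #|X|)%N ->
  d * #|X|%:R ^+ k <= #|[set t : k.-tuple X | E t]|%:R ->
  exists S : seq {set X}, [/\ size S = k, all (fun B : {set X} => (s <= #|B|)%N) S &
    forall t, size t = k -> all2 (fun x (B : {set X}) => x \in B) t S -> E t].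
Proof.
elim: k d => [|k IHk] d d0.
  exists 0%N => X E _; rewrite expr0 mulr1 => dE; exists [::]; split=> // -[] // _ _.
  have : (0 < #|[set t : 0.-tuple X | E t]|)%N by rewrite -(ltr_nat R) (lt_le_trans d0).
  by case/card_gt0P => t; rewrite inE (tuple0 t).
(* [r] makes the tuples that see fewer than [s] of the [r] chosen vertices account for at most half
   of the incidences; the factor [2 ^+ r] in [d'] pays for the pigeonhole over subsets. *)
pose r := (Num.truncn (4 * s%:R / d)).+1.
have r0 : 0 < r%:R :> R by rewrite ltr0n.
have rs : 4 * s%:R <= d * r%:R.
  by rewrite [d * _]mulrC -ler_pdivrMr // ltW // truncnS_gt.
pose d' := d / 4 / 2 ^+ r.
have d'0 : 0 < d' by rewrite /d' !divr_gt0 // exprn_gt0.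
have [M0 HM] := IHk d' d'0.
pose M1 := (Num.truncn (2 * r%:R / d)).+1.
exists (maxn M0 M1) => X E XM dE.
pose N : R := #|X|%:R.
have NM1 : 2 * r%:R <= d * N.
  rewrite [d * _]mulrC -ler_pdivrMr //; apply: le_trans (ltW (truncnS_gt _)) _.
  by rewrite ler_nat; apply: leq_trans XM; apply: leq_maxr.
have N0 : 0 < N.
  by have := lt_le_trans (mulr_gt0 (ltr0n R 2) r0) NM1; rewrite pmulr_rgt0.
have Nk0 : 0 < N ^+ k by rewrite exprn_gt0.
pose c x : R := #|[set t : k.-tuple X | E (x :: t)]|%:R.
have cN x : c x <= N ^+ k.
  by rewrite /c /N -natrX ler_nat -card_tuple max_card.
pose X1 := [set x | d / 2 * N ^+ k <= c x].
have X1big : r%:R <= #|X1|%:R :> R.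
  have : d * N ^+ k.+1 <= #|X1|%:R * N ^+ k + N * (d / 2 * N ^+ k).
    apply: le_trans dE _; rewrite card_tuple_cons natr_sum.
    rewrite (bigID (fun x => x \in X1)) /=; apply: lerD.
      rewrite -sum1_card natr_sum mulr_suml; apply: ler_sum => x _.
      by rewrite mul1r; apply: cN.
    have -> : N * (d / 2 * N ^+ k) = \sum_(x : X) d / 2 * N ^+ k.
      by rewrite sumr_const -[RHS]mulr_natl.
    rewrite big_mkcond; apply: ler_sum => x _; case: ifP => [|_]; first by rewrite inE -ltNge => /ltW.
    by rewrite mulr_ge0 ?divr_ge0 ?(ltW d0) ?(ltW Nk0).
  rewrite exprS => h; have {}h : N * (d / 2) * N ^+ k <= #|X1|%:R * N ^+ k by lra.
  by move: h; rewrite ler_pM2r // => h; lra.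
have [X0 X0sub X0card] : exists2 X0 : {set X}, X0 \subset X1 & #|X0| = r.
  by apply: exists_subset_card; rewrite ler_nat in X1big.
pose D (t : seq X) := [set x in X0 | E (x :: t)].
have Dr t : (#|D t| <= r)%N.
  by rewrite -X0card; apply: subset_leq_card; apply/fintype.subsetP => x; rewrite inE => /andP[].
pose good := [set t : k.-tuple X | (s <= #|D t|)%N].
have goodbig : d / 4 * N ^+ k <= #|good|%:R.
  have h1 : r%:R * (d / 2 * N ^+ k) <= \sum_(t : k.-tuple X) #|D t|%:R.
    rewrite -X0card -sum1_card natr_sum mulr_suml.
    have -> : \sum_(t : k.-tuple X) #|D t|%:R = \sum_(x in X0) c x.
      rewrite /c; under [RHS]eq_bigr => x _ do rewrite -sum1_card natr_sum.
      rewrite (exchange_big_dep predT) //=; apply: eq_bigr => t _.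
      rewrite -sum1_card natr_sum; apply: eq_bigl => x.
      by rewrite !inE.
    apply: ler_sum => x xX0; rewrite mul1r.
    by have := fintype.subsetP X0sub _ xX0; rewrite inE.
  have h2 : \sum_(t : k.-tuple X) #|D t|%:R <= r%:R * #|good|%:R + s%:R * N ^+ k :> R.
    rewrite (bigID (fun t : k.-tuple X => t \in good)) /=; apply: lerD.
      apply: (@le_trans _ _ (\sum_(t in good) r%:R)).
        by apply: ler_sum => t _; rewrite ler_nat.
      by rewrite sumr_const -[X in X <= _]mulr_natr.
    apply: (@le_trans _ _ (\sum_(t : k.-tuple X) s%:R)).
      rewrite big_mkcond; apply: ler_sum => t _; case: ifP => // .
      by rewrite inE -ltnNge ler_nat => /ltnW.
    by rewrite sumr_const -[X in X <= _]mulr_natr card_tuple natrX.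
  have h3 : 4 * s%:R * N ^+ k <= d * r%:R * N ^+ k by rewrite ler_pM2r.
  rewrite -(ler_pM2l r0).
  by lra.
have [D0 D0s D0big] : exists2 D0 : {set X}, (s <= #|D0|)%N &
    d' * N ^+ k <= #|[set t : k.-tuple X | D t == D0]|%:R.
  apply: contrapT => no.
  have : #|good|%:R < d / 4 * N ^+ k; last by rewrite ltNge goodbig.
  have e : #|good|%:R = \sum_(D0 in powerset X0) #|[set t in good | D t == D0]|%:R :> R.
    rewrite -natr_sum -sum1_card (partition_big (fun t : k.-tuple X => D t) (mem (powerset X0))) /=.
      by congr (_%:R); apply: eq_bigr => D0 _; rewrite -sum1_card; apply: eq_bigl => t; rewrite [RHS]inE.
    by move=> t _; rewrite inE; apply/fintype.subsetP => x; rewrite inE => /andP[].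
  rewrite e; apply: (@lt_le_trans _ _ (\sum_(D0 in powerset X0) d' * N ^+ k)).
    apply: ltr_sum => [|D0 _].
      by apply/hasP; exists finset.set0; rewrite ?mem_index_enum // inE finset.sub0set.
    have [sD|Ds] := leqP s #|D0|.
      rewrite ltNge; apply/negP => big; apply: no; exists D0 => //.
      apply: le_trans big _; rewrite ler_nat; apply: subset_leq_card.
      by apply/fintype.subsetP => t; rewrite !inE => /andP[].
    rewrite (_ : [set _ in _ | _] = finset.set0) ?cards0 ?mulr_gt0 //.
    apply/finset.setP => t; rewrite !inE; apply/negP => /andP[gt /eqP tD].
    by rewrite tD leqNgt Ds in gt.
  rewrite sumr_const card_powerset X0card -[X in X <= _]mulr_natl natrX mulrA.
  by rewrite /d' [2 ^+ r * _]mulrC mulfVK ?lexx // lt0r_neq0 // exprn_gt0.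
have [|S [szS Sbig SE]] := HM X (fun t => D t == D0) _ D0big.
  by apply: leq_trans XM; apply: leq_maxl.
exists (D0 :: S); split; rewrite /= ?szS ?D0s //.
case=> [|x t] //= [szt] /andP[xD tS].
by have /eqP DE := SE t szt tS; move: xD; rewrite -DE inE => /andP[].
Qed.

(** * Averaging over vertex colourings *)

(** Under the product weight the coordinates of [z] are independent of law [wt]; the right side is
    the expectation of [om] at two of them. *)
Lemma sum_ffun_pair (R : comNzRingType) (I C : finType) (wt : C -> R)
    (om : C -> C -> R) (i j : I) : \sum_c wt c = 1 -> i != j ->
  \sum_(z : {ffun I -> C}) (\prod_l wt (z l)) * om (z i) (z j) =
  \sum_a \sum_b wt a * wt b * om a b.
Proof.
move=> wt1 ij.
have omE a b : om a b = \sum_a' \sum_b' (a == a')%:R * (b == b')%:R * om a' b'.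
  rewrite (bigD1 a) //= (bigD1 b) //= !eqxx !mul1r !big1 ?addr0 // => [a'|b'] ne.
    by rewrite big1 // => b' _; rewrite eq_sym (negbTE ne) !mul0r.
  by rewrite [b == b']eq_sym (negbTE ne) mulr0 mul0r.
transitivity (\sum_(z : {ffun I -> C}) \sum_a \sum_b
    (\prod_l wt (z l)) * ((z i == a)%:R * (z j == b)%:R) * om a b).
  apply: eq_bigr => z _; rewrite {1}omE mulr_sumr; apply: eq_bigr => a _.
  by rewrite mulr_sumr; apply: eq_bigr => b _; rewrite !mulrA.
rewrite exchange_big /=; apply: eq_bigr => a _.
rewrite exchange_big /=; apply: eq_bigr => b _.
rewrite -mulr_suml; congr (_ * _).
pose F l c : R := wt c * (if l == i then (c == a)%:R else if l == j then (c == b)%:R else 1).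
transitivity (\sum_(z : {ffun I -> C}) \prod_l F l (z l)).
  apply: eq_bigr => z _; rewrite /F big_split /=; congr (_ * _).
  rewrite (bigD1 i) //= eqxx; congr (_ * _).
  rewrite (bigD1 j) /=; last by rewrite eq_sym.
  rewrite [j == i]eq_sym (negbTE ij) eqxx big1 ?mulr1 // => l /andP[li lj].
  by rewrite (negbTE li) (negbTE lj).
rewrite -bigA_distr_bigA /= (bigD1 i) //= (bigD1 j) /=; last by rewrite eq_sym.
rewrite [\prod_(_ | _) _]big1 => [|l /andP[li lj]]; last first.
  by rewrite /F (negbTE li) (negbTE lj) -[RHS]wt1; apply: eq_bigr => c _; rewrite mulr1.
rewrite mulr1 /F eqxx [j == i]eq_sym (negbTE ij) eqxx; congr (_ * _).
  rewrite (bigD1 a) //= eqxx mulr1 big1 ?addr0 // => c /negbTE->; exact: mulr0.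
rewrite (bigD1 b) //= eqxx mulr1 big1 ?addr0 // => c /negbTE->; exact: mulr0.
Qed.

Lemma sum_ffun_weight (R : comNzRingType) (I C : finType) (wt : C -> R) :
  \sum_c wt c = 1 -> \sum_(z : {ffun I -> C}) \prod_l wt (z l) = 1.
Proof.
by move=> wt1; rewrite -(bigA_distr_bigA (fun _ => wt)) big1.
Qed.

Definition pair_sum (R : nmodType) (I C : finType) (om : I -> I -> C -> C -> R)
    (z : I -> C) : R :=
  \sum_i \sum_(j | i != j) om i j (z i) (z j).

Lemma sum_pair_sum (R : comNzRingType) (I C : finType) (wt : C -> R)
    (om : I -> I -> C -> C -> R) : \sum_c wt c = 1 ->
  \sum_(z : {ffun I -> C}) (\prod_l wt (z l)) * pair_sum om z =
  \sum_i \sum_(j | i != j) \sum_a \sum_b wt a * wt b * om i j a b.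
Proof.
move=> wt1; rewrite /pair_sum.
under eq_bigr => z _ do rewrite mulr_sumr.
rewrite exchange_big /=; apply: eq_bigr => i _.
under eq_bigr => z _ do rewrite mulr_sumr.
by rewrite exchange_big /=; apply: eq_bigr => j ij; apply: sum_ffun_pair.
Qed.

(** First moment method. It serves both the random colouring of the upper bound and the random
    sample of vertices in the lower bound. *)
Lemma exists_pair_sum_le (R : realFieldType) (I C : finType) (wt : C -> R)
    (om : I -> I -> C -> C -> R) :
  (forall c, 0 <= wt c) -> \sum_c wt c = 1 ->
  exists z : {ffun I -> C}, pair_sum om z <=
    \sum_i \sum_(j | i != j) \sum_a \sum_b wt a * wt b * om i j a b.
Proof.
move=> wt0 wt1.
pose E := \sum_i \sum_(j | i != j) \sum_a \sum_b wt a * wt b * om i j a b; rewrite -/E.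
apply: contrapT => /forallNP no.
pose P (z : {ffun I -> C}) := \prod_l wt (z l).
have P0 z : 0 <= P z by apply: prodr_ge0.
have PE : \sum_z P z * (pair_sum om z - E) = 0.
  under eq_bigr => z _ do rewrite mulrBr.
  rewrite sumrB -mulr_suml /P sum_ffun_weight // mul1r.
  by apply/eqP; rewrite subr_eq0; apply/eqP; apply: sum_pair_sum.
have gap (z : {ffun I -> C}) : 0 < pair_sum om z - E by rewrite subr_gt0 ltNge; apply/negP; apply: no.
have Pz z : P z = 0.
  have ge0 z' : true -> 0 <= P z' * (pair_sum om z' - E).
    by move=> _; rewrite mulr_ge0 // ltW.
  have /(_ z isT)/eqP := psumr_eq0P ge0 PE.
  by rewrite mulf_eq0 (gt_eqF (gap z)) orbF => /eqP.
have := sum_ffun_weight I wt1; rewrite big1 => [/esym/eqP|z _]; last exact: Pz.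
by rewrite oner_eq0.
Qed.

Lemma card_adj_pairs (V : finType) (D : {set {set V}}) :
  (forall e, e \in D -> #|e| = 2%N) ->
  #|[set xy : V * V | [set xy.1; xy.2] \in D]| = (2 * #|D|)%N.
Proof.
move=> D2; rewrite -sum1_card.
rewrite (partition_big (fun xy : V * V => [set xy.1; xy.2]) (mem D)) /=; last first.
  by move=> xy; rewrite inE.
rewrite -sum1_card big_distrr /=; apply: eq_bigr => e eD.
have /eqP/cards2P[a [b [ab eE]]] := D2 e eD.
transitivity #|[set (a, b); (b, a)]|; last by rewrite cards2 xpair_eqE negb_and ab.
rewrite -sum1_card; apply: eq_bigl => -[x y]; rewrite !inE /= !xpair_eqE.
apply/andP/orP => [[_ /eqP xyE]|[] /andP[/eqP-> /eqP->]]; last first.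
- by rewrite finset.setUC -eE eD.
- by rewrite -eE eD.
have : x \in e by rewrite -xyE !inE eqxx.
have : y \in e by rewrite -xyE !inE eqxx orbT.
have : x != y by apply/eqP => E; move: (D2 e eD); rewrite -xyE E finset.setUid cards1.
rewrite eE !inE => xy /orP[] /eqP yE /orP[] /eqP xE; subst x y.
- by rewrite eqxx in xy.
- by right; rewrite !eqxx.
- by left; rewrite !eqxx.
- by rewrite eqxx in xy.
Qed.

(** * Szemeredi's regularity lemma *)

Section Density.
Variables (R : realType) (V : finType) (A : rel V).

Definition edge_sum (X Y : {set V}) : R := \sum_(x in X) \sum_(y in Y) (A x y)%:R.

Definition density (X Y : {set V}) : R := edge_sum X Y / (#|X|%:R * #|Y|%:R).

Definition regular_pair (e : R) (X Y : {set V}) : bool :=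
  [forall U : {set V}, forall W : {set V},
    [&& U \subset X, W \subset Y, e * #|X|%:R <= #|U|%:R & e * #|Y|%:R <= #|W|%:R]
    ==> (`|density U W - density X Y| <= e)].

Lemma edge_sum_le (X Y : {set V}) : 0 <= edge_sum X Y <= #|X|%:R * #|Y|%:R.
Proof.
apply/andP; split; first by apply: sumr_ge0 => x _; apply: sumr_ge0.
rewrite -sum1_card natr_sum mulr_suml; apply: ler_sum => x _.
rewrite mul1r -sum1_card natr_sum; apply: ler_sum => y _.
by rewrite ler_nat leq_b1.
Qed.

Lemma edge_sumE (X Y : {set V}) : edge_sum X Y = density X Y * (#|X|%:R * #|Y|%:R).
Proof.
rewrite /density; have [E|ne] := eqVneq (#|X|%:R * #|Y|%:R : R) 0; last by rewrite mulfVK.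
by have := edge_sum_le X Y; rewrite E mulr0 -eq_le => /eqP.
Qed.

Lemma density01 (X Y : {set V}) : 0 <= density X Y <= 1.
Proof.
have /andP[e0 e1] := edge_sum_le X Y.
have XY0 : 0 <= #|X|%:R * #|Y|%:R :> R by rewrite mulr_ge0.
apply/andP; split; first by rewrite divr_ge0.
have [E|ne] := eqVneq (#|X|%:R * #|Y|%:R : R) 0; first by rewrite /density E invr0 mulr0.
by rewrite ler_pdivrMr ?mul1r // lt_neqAle eq_sym ne.
Qed.

Section Cells.
Variables (T : finType) (f : V -> T).

Definition cell (a : T) : {set V} := [set x | f x == a].

(** The conditional expectation of [A] on the product partition, kept as a function of vertices;
    [sum_cell_density] is its defining property. *)
Definition cell_density (x y : V) : R := density (cell (f x)) (cell (f y)).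

Lemma sum_cells (G : V -> V -> R) :
  \sum_x \sum_y G x y = \sum_a \sum_b \sum_(x in cell a) \sum_(y in cell b) G x y.
Proof.
rewrite (partition_big f predT) //=; apply: eq_bigr => a _.
rewrite [RHS]exchange_big /=; apply: eq_big => [x|x _]; first by rewrite inE.
rewrite (partition_big f predT) //=; apply: eq_bigr => b _.
by apply: eq_bigl => y; rewrite inE.
Qed.

Lemma sum_cell_density (psi : T -> T -> R) :
  \sum_x \sum_y psi (f x) (f y) * cell_density x y =
  \sum_x \sum_y psi (f x) (f y) * (A x y)%:R.
Proof.
rewrite !sum_cells; apply: eq_bigr => a _; apply: eq_bigr => b _.
transitivity (psi a b * edge_sum (cell a) (cell b)).
  transitivity (\sum_(x in cell a) \sum_(y in cell b) psi a b * density (cell a) (cell b)).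
    apply: eq_bigr => x; rewrite inE => /eqP xa; apply: eq_bigr => y.
    by rewrite inE => /eqP yb; rewrite /cell_density xa yb.
  under eq_bigr => x _ do rewrite sumr_const.
  by rewrite sumr_const -!mulrnA -mulr_natr edge_sumE -mulrA natrM [#|cell b|%:R * _]mulrC.
rewrite /edge_sum mulr_sumr; apply: eq_bigr => x; rewrite inE => /eqP xa.
by rewrite mulr_sumr; apply: eq_bigr => y; rewrite inE => /eqP yb; rewrite xa yb.
Qed.

Definition energy : R := \sum_x \sum_y cell_density x y ^+ 2.

Lemma energy_le : energy <= #|V|%:R ^+ 2.
Proof.
rewrite expr2 -sum1_card natr_sum mulr_suml; apply: ler_sum => x _.
rewrite mul1r; apply: ler_sum => y _.
by have /andP[d0 d1] := density01 (cell (f x)) (cell (f y)); rewrite expr_le1.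
Qed.

(** Vertex pairs rather than cell pairs are counted, so the partitions need not be equitable. *)
Definition irregular_weight (e : R) : R :=
  \sum_x \sum_y (~~ regular_pair e (cell (f x)) (cell (f y)))%:R.

Definition refinement (W : T * T -> {set V} * {set V}) (x : V) :
    T * {ffun T * T -> bool * bool} :=
  (f x, [ffun ab => (x \in (W ab).1, x \in (W ab).2)]).
End Cells.

(** Pythagoras: the coarse density is the orthogonal projection of the fine one. *)
Lemma energy_refine (T T' : finType) (f : V -> T) (f' : V -> T') (g : T' -> T) :
  (forall x, g (f' x) = f x) ->
  energy f' = energy f + \sum_x \sum_y (cell_density f' x y - cell_density f x y) ^+ 2.
Proof.
move=> gf.
have dd : \sum_x \sum_y cell_density f x y * cell_density f' x y = energy f.
  pose psi u v : R := density (cell f (g u)) (cell f (g v)).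
  have e x y : psi (f' x) (f' y) = cell_density f x y by rewrite /psi !gf.
  have := sum_cell_density f' psi.
  under eq_bigr => x _ do under eq_bigr => y _ do rewrite e.
  under [RHS]eq_bigr => x _ do under eq_bigr => y _ do rewrite e.
  move=> ->; have := sum_cell_density f (fun a b => density (cell f a) (cell f b)).
  by move=> <-; apply: eq_bigr => x _; apply: eq_bigr => y _; rewrite expr2.
have -> : \sum_x \sum_y (cell_density f' x y - cell_density f x y) ^+ 2 =
    energy f' - 2 * (\sum_x \sum_y cell_density f x y * cell_density f' x y) + energy f.
  rewrite /energy mulr_sumr -sumrB -big_split; apply: eq_bigr => x _.
  by rewrite mulr_sumr -sumrB -big_split; apply: eq_bigr => y _ /=; ring.
by rewrite dd; ring.
Qed.

(* Only the lower bound (d' - d)^2 >= 2 delta (d' - d) - delta^2 with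
   delta = density U W - density X Y is used on the witnesses U, W of
   irregularity. *)
Lemma energy_increment (e : R) (T : finType) (f : V -> T) : 0 < e ->
  e * #|V|%:R ^+ 2 < irregular_weight f e ->
  exists W, energy f + e ^+ 5 * #|V|%:R ^+ 2 <= energy (refinement f W).
Proof.
move=> e0 irr.
have wit (ab : T * T) : exists UW : {set V} * {set V},
    ~~ regular_pair e (cell f ab.1) (cell f ab.2) ->
    [/\ UW.1 \subset cell f ab.1, UW.2 \subset cell f ab.2,
        e * #|cell f ab.1|%:R <= #|UW.1|%:R, e * #|cell f ab.2|%:R <= #|UW.2|%:R &
        e < `|density UW.1 UW.2 - density (cell f ab.1) (cell f ab.2)|].
  have [//|] := boolP (regular_pair e (cell f ab.1) (cell f ab.2)).
    by move=> _; exists (finset.set0, finset.set0).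
  rewrite negb_forall => /existsP[U]; rewrite negb_forall => /existsP[W].
  rewrite negb_imply -ltNge => /andP[/and4P[? ? ? ?] ?].
  by exists (U, W).
have [W WP] := choice wit; exists W.
pose f' := refinement f W.
rewrite (@energy_refine _ _ f f' fst) // lerD2l.
(* An irregular pair of cells gains [e ^+ 4] per vertex pair: [e ^+ 2] from the squared deviation,
   [e ^+ 2] from the share of the witnesses. *)
apply: (@le_trans _ _ (e ^+ 4 * irregular_weight f e)).
  by rewrite exprS -mulrA [e * _]mulrC -mulrA ler_pM2l ?exprn_gt0 // mulrC ltW.
rewrite /irregular_weight !(sum_cells f) mulr_sumr; apply: ler_sum => a _.
rewrite mulr_sumr; apply: ler_sum => b _.
pose D := density (cell f a) (cell f b).
have cellE x y : x \in cell f a -> y \in cell f b -> cell_density f x y = D.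
  by rewrite !inE => /eqP xa /eqP yb; rewrite /cell_density xa yb.
have -> : \sum_(x in cell f a) \sum_(y in cell f b)
     (~~ regular_pair e (cell f (f x)) (cell f (f y)))%:R =
   (#|cell f a|%:R * #|cell f b|%:R) * (~~ regular_pair e (cell f a) (cell f b))%:R :> R.
  rewrite -mulrA -sum1_card natr_sum mulr_suml; apply: eq_bigr => x; rewrite inE => /eqP xa.
  rewrite mul1r -sum1_card natr_sum mulr_suml; apply: eq_bigr => y; rewrite inE => /eqP yb.
  by rewrite mul1r xa yb.
have [reg|nreg] := boolP (regular_pair e (cell f a) (cell f b)).
  rewrite !mulr0; apply: sumr_ge0 => x _; apply: sumr_ge0 => y _; exact: sqr_ge0.
rewrite mulr1; have [Ua Wb eU eW dev] := WP (a, b) nreg.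
set U := (W (a, b)).1 in Ua eU dev; set X := (W (a, b)).2 in Wb eW dev.
rewrite /= in Ua Wb eU eW dev; rewrite -/D in dev.
pose G x y := (cell_density f' x y - cell_density f x y) ^+ 2.
pose del := density U X - D.
have G0 x y : 0 <= G x y by exact: sqr_ge0.
apply: (@le_trans _ _ (\sum_(x in U) \sum_(y in X) G x y)); last first.
  have sub (S S' : {set V}) (F : V -> R) : S \subset S' -> (forall x, 0 <= F x) ->
      \sum_(x in S) F x <= \sum_(x in S') F x.
    move=> SS' F0; rewrite [leLHS]big_mkcond [leRHS]big_mkcond; apply: ler_sum => x _.
    by case: ifP => [/(fintype.subsetP SS')->//|_]; case: ifP.
  apply: (@le_trans _ _ (\sum_(x in U) \sum_(y in cell f b) G x y)).
    by apply: ler_sum => x _; apply: sub.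
  by apply: sub => // x; apply: sumr_ge0.
apply: (@le_trans _ _ (\sum_(x in U) \sum_(y in X)
    (2 * del * (cell_density f' x y - cell_density f x y) - del ^+ 2))); last first.
  apply: ler_sum => x _; apply: ler_sum => y _; rewrite /G -subr_ge0.
  set z := cell_density f' x y - cell_density f x y.
  have -> : z ^+ 2 - (2 * del * z - del ^+ 2) = (z - del) ^+ 2 by ring.
  exact: sqr_ge0.
have sumc (c : R) : \sum_(x in U) \sum_(y in X) c = c * (#|U|%:R * #|X|%:R).
  by rewrite !sumr_const -[LHS]mulr_natr -[c *+ _]mulr_natr -mulrA [#|X|%:R * _]mulrC.
have sumf : \sum_(x in U) \sum_(y in X) cell_density f x y = D * (#|U|%:R * #|X|%:R).
  rewrite -sumc; apply: eq_bigr => x xU; apply: eq_bigr => y yX.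
  by apply: cellE; [apply: (fintype.subsetP Ua)|apply: (fintype.subsetP Wb)].
have sumf' : \sum_(x in U) \sum_(y in X) cell_density f' x y = edge_sum U X.
  pose psi (u v : T * {ffun T * T -> bool * bool}) : R :=
    (u.2 (a, b)).1%:R * (v.2 (a, b)).2%:R.
  have psiE x y : psi (f' x) (f' y) = (x \in U)%:R * (y \in X)%:R.
    by rewrite /psi /f' /refinement /= !ffunE.
  have key (H : V -> V -> R) : \sum_(x in U) \sum_(y in X) H x y =
      \sum_x \sum_y psi (f' x) (f' y) * H x y.
    rewrite big_mkcond; apply: eq_bigr => x _; case xU : (x \in U); last first.
      by rewrite big1 // => y _; rewrite psiE xU !mul0r.
    rewrite big_mkcond; apply: eq_bigr => y _; rewrite psiE xU mul1r.
    by case: (y \in X); rewrite ?mul1r ?mul0r.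
  by rewrite key (sum_cell_density f' psi) /edge_sum key.
have -> : \sum_(x in U) \sum_(y in X)
    (2 * del * (cell_density f' x y - cell_density f x y) - del ^+ 2) =
    2 * del * (\sum_(x in U) \sum_(y in X) cell_density f' x y
      - \sum_(x in U) \sum_(y in X) cell_density f x y)
    - \sum_(x in U) \sum_(y in X) del ^+ 2.
  rewrite -sumrB mulr_sumr -sumrB; apply: eq_bigr => x _.
  by rewrite -sumrB mulr_sumr -sumrB.
rewrite sumc sumf sumf' edge_sumE.
have -> : 2 * del * (density U X * (#|U|%:R * #|X|%:R) - D * (#|U|%:R * #|X|%:R))
    - del ^+ 2 * (#|U|%:R * #|X|%:R) = del ^+ 2 * (#|U|%:R * #|X|%:R).
  by rewrite /del; ring.
rewrite (_ : e ^+ 4 * _ = e ^+ 2 * ((e * #|cell f a|%:R) * (e * #|cell f b|%:R))); last by ring.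
have e00 := ltW e0.
apply: ler_pM; rewrite ?sqr_ge0 ?mulr_ge0 //.
  by rewrite -[del ^+ 2]real_normK ?num_real // ler_pXn2r ?nnegrE ?normr_ge0 // ltW.
by apply: ler_pM; rewrite ?mulr_ge0.
Qed.
End Density.

(** The number of labels of [refinement]: an old label and two bits for each of the [k * k] pairs of
    cells. *)
Definition refinement_bound (k : nat) : nat := (k * 4 ^ (k * k))%N.

Lemma leq_refinement_bound (k : nat) : (k <= refinement_bound k)%N.
Proof. by rewrite leq_pmulr // expn_gt0. Qed.

Lemma refinement_bound_mono (k k' : nat) : (k <= k')%N ->
  (refinement_bound k <= refinement_bound k')%N.
Proof. by move=> kk; rewrite leq_mul // leq_pexp2l // leq_mul. Qed.

(** The energy is at most [#|V| ^ 2] and each irregular step adds [e ^+ 5 * #|V| ^ 2], so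
    [N > e ^- 5] steps cannot all be irregular. Refining [f0] lets the caller keep the cells
    small. *)
Lemma regularity_lemma (R : realType) (e : R) (k0 : nat) : 0 < e ->
  exists K : nat, forall (V T0 : finType) (A : rel V) (f0 : V -> T0),
  (#|T0| <= k0)%N ->
  exists (T : finType) (f : V -> T), [/\ (#|T| <= K)%N,
    forall x y, f x = f y -> f0 x = f0 y &
    irregular_weight A f e <= e * #|V|%:R ^+ 2].
Proof.
move=> e0; have e5 : 0 < e ^+ 5 by rewrite exprn_gt0.
pose N := (Num.truncn (e ^- 5)).+1.
have N1 : 1 < N%:R * e ^+ 5.
  by rewrite -ltr_pdivrMr // div1r /N truncnS_gt.
exists (iter N refinement_bound k0) => V T0 A f0 T0k.
have step j : exists (T : finType) (f : V -> T),
    [/\ (#|T| <= iter j refinement_bound k0)%N, forall x y, f x = f y -> f0 x = f0 y &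
      irregular_weight A f e <= e * #|V|%:R ^+ 2 \/
      j%:R * e ^+ 5 * #|V|%:R ^+ 2 <= energy R A f].
  elim: j => [|j [T [f [Tk ff0 D]]]].
    exists T0, f0; split=> //; right; rewrite !mul0r.
    by apply: sumr_ge0 => x _; apply: sumr_ge0 => y _; apply: sqr_ge0.
  have [small|large] := leP (irregular_weight A f e) (e * #|V|%:R ^+ 2).
    by exists T, f; split=> //; [apply: leq_trans Tk (leq_refinement_bound _)|left].
  have [W EW] := energy_increment e0 large.
  case: D => [|Ef]; first by rewrite leNgt large.
  exists _, (refinement f W); split.
  - rewrite card_prod card_ffun !card_prod card_bool.
    exact: refinement_bound_mono.
  - by move=> x y [/ff0].
  - right; apply: le_trans EW; rewrite -natr1 !mulrDl mul1r lerD2r //.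
have [T [f [Tk ff0 [small|large]]]] := step N; exists T, f; split => //.
have := le_trans large (energy_le R A f).
have [V0|V0] := posnP #|V|.
  move=> _; rewrite V0 expr0n /= mulr0 /irregular_weight big_pred0 // => x.
  by have := card0_eq V0 x; rewrite inE.
rewrite -subr_le0 -{2}[_ ^+ 2]mul1r -mulrBl pmulr_lle0 ?subr_le0 ?leNgt ?N1 //.
by rewrite exprn_gt0 // ltr0n.
Qed.

(* The vertices are chosen one after the other; at each step every candidate set
   keeps at least a proportion al of its elements. *)
Lemma induced_embedding (R : realType) (V : finType) (A : rel V) (al : R) :
  symmetric A -> 0 < al -> al <= 1 ->
  forall (n : nat) (sg : rel 'I_n) (C : 'I_n -> {set V}) (mu : 'I_n -> R),
  symmetric sg ->
  (forall i, 0 < mu i) ->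
  (forall i, n%:R * mu i < al ^+ n * #|C i|%:R) ->
  (forall i j (U W : {set V}), i != j -> U \subset C i -> W \subset C j ->
     mu i <= #|U|%:R -> mu j <= #|W|%:R ->
     al * (#|U|%:R * #|W|%:R) <= \sum_(x in U) #|[set y in W | A x y == sg i j]|%:R) ->
  exists f : 'I_n -> V, (forall i, f i \in C i) /\
    forall i j, i != j -> A (f i) (f j) = sg i j.
Proof.
move=> symA al0 al1; elim=> [|n IHn] sg C mu symsg mu0 Cbig reg.
  by exists (fun i : 'I_0 => False_rect V (notF (ltn_ord i))); split=> -[].
pose B j := [set x in C ord0 | #|[set y in C (lift ord0 j) | A x y == sg ord0 (lift ord0 j)]|%:R
  < al * #|C (lift ord0 j)|%:R].
have aln m : al ^+ m <= 1 by apply: exprn_ile1 => //; apply: ltW.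
have Cmu i : n.+1%:R * mu i < #|C i|%:R.
  by apply: lt_le_trans (Cbig i) _; rewrite ler_piMl.
have Cge i : mu i <= #|C i|%:R.
  by apply: le_trans (ltW (Cmu i)); rewrite ler_peMl ?(ltW (mu0 i)) // ler1n.
(* A larger set of vertices bad for [j] could itself be taken as [U] in [reg] and would violate
   it. *)
have Bsmall j : #|B j|%:R < mu ord0.
  rewrite ltNge; apply/negP => Bge.
  have Bsub : B j \subset C ord0 by apply/fintype.subsetP => x; rewrite inE => /andP[].
  have := reg ord0 (lift ord0 j) (B j) (C (lift ord0 j)) (neq_lift _ _) Bsub (subxx _) Bge (Cge _).
  apply/negP; rewrite -ltNge.
  have -> : al * (#|B j|%:R * #|C (lift ord0 j)|%:R) =
      \sum_(x in B j) al * #|C (lift ord0 j)|%:R.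
    by rewrite sumr_const -[RHS]mulr_natl; ring.
  have Bpos : (0 < #|B j|)%N by rewrite -(ltr_nat R) (lt_le_trans _ Bge).
  apply: ltr_sum => [|x]; last by rewrite inE => /andP[].
  by have [x xB] := card_gt0P Bpos; apply/hasP; exists x; rewrite ?mem_index_enum.
have [x xC xB] : exists2 x, x \in C ord0 & forall j, x \notin B j.
  apply: contrapT => no; have : #|C ord0|%:R <= n.+1%:R * mu ord0; last by rewrite leNgt Cmu.
  have sub : C ord0 \subset \bigcup_j B j.
    apply/fintype.subsetP => x xC; apply/negPn/negP => /bigcupP nb; apply: no.
    by exists x => // j; apply/negP => xB; apply: nb; exists j.
  apply: (@le_trans _ _ (\sum_j #|B j|%:R)).
    rewrite -natr_sum ler_nat; apply: leq_trans (subset_leq_card sub) _.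
    elim/big_ind2: _ => [|D m D' m' Dm Dm'|j _]; [by rewrite cards0| |by []].
    by apply: leq_trans (leq_card_setU _ _) (leq_add Dm Dm').
  apply: (@le_trans _ _ (\sum_(j < n) mu ord0)).
    by apply: ler_sum => j _; apply: ltW.
  by rewrite sumr_const card_ord -[X in X <= _]mulr_natl ler_wpM2r ?ler_nat // ltW.
pose C' j := [set y in C (lift ord0 j) | A x y == sg ord0 (lift ord0 j)].
have C'big j : al * #|C (lift ord0 j)|%:R <= #|C' j|%:R.
  by have := xB j; rewrite inE xC /= -leNgt.
have C'sub j : C' j \subset C (lift ord0 j).
  by apply/fintype.subsetP => y; rewrite inE => /andP[].
have [||||f [fC fA]] := IHn (fun i j => sg (lift ord0 i) (lift ord0 j)) C' (fun i => mu (lift ord0 i)).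
- by move=> i j; apply: symsg.
- by move=> i; apply: mu0.
- move=> i; apply: (@le_lt_trans _ _ (n.+1%:R * mu (lift ord0 i))).
    by rewrite ler_wpM2r ?ler_nat // ltW.
  apply: lt_le_trans (Cbig _) _; rewrite exprSr -mulrA.
  by apply: ler_wpM2l; [apply: exprn_ge0; apply: ltW | apply: C'big].
- move=> i j U W ij Ui Wj; apply: reg; first by rewrite (inj_eq lift_inj).
    exact: fintype.subset_trans Ui (C'sub i).
  exact: fintype.subset_trans Wj (C'sub j).
exists (fun i => if unlift ord0 i is Some j then f j else x); split.
  move=> i; case: unliftP => [j ->|->] //.
  exact: (fintype.subsetP (C'sub j)).
move=> i j; case: (unliftP ord0 i) => [i' ->|->]; case: (unliftP ord0 j) => [j' ->|->].
- by rewrite (inj_eq lift_inj) => ij; apply: fA.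
- by move=> _; have := fC i'; rewrite inE symA symsg => /andP[_ /eqP].
- by move=> _; have := fC j'; rewrite inE => /andP[_ /eqP].
- by rewrite eqxx.
Qed.

(** * Quasirandom graphs *)

Lemma sum_square_le (R : realFieldType) (I : finType) (S : {set I}) (f : I -> R) :
  (\sum_(i in S) f i) ^+ 2 <= #|S|%:R * \sum_(i in S) f i ^+ 2.
Proof.
have [S0|S0] := posnP #|S|.
  by rewrite (cards0_eq S0) !big_set0 cards0 mul0r expr0n.
set s := \sum_(i in S) f i; have c0 : 0 < #|S|%:R :> R by rewrite ltr0n.
have : 0 <= \sum_(i in S) (f i - s / #|S|%:R) ^+ 2.
  by apply: sumr_ge0 => i _; apply: sqr_ge0.
have -> : \sum_(i in S) (f i - s / #|S|%:R) ^+ 2 =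
    \sum_(i in S) f i ^+ 2 - s ^+ 2 / #|S|%:R.
  transitivity (\sum_(i in S) f i ^+ 2 - 2 * (s / #|S|%:R) * s + \sum_(i in S) (s / #|S|%:R) ^+ 2).
    rewrite /s mulr_sumr -sumrB -big_split; apply: eq_bigr => i _ /=; ring.
  rewrite sumr_const -[_ *+ #|S|]mulr_natl; field.
  by rewrite pnatr_eq0 -lt0n.
by rewrite subr_ge0 ler_pdivrMr // mulrC.
Qed.

Section FieldGraph.
Variables (R : realType) (F : finFieldType) (S : {set F}).

Definition field_rel : rel (F * F) := fun x y => x.1 * y.1 + x.2 + y.2 \in S.

Let sigma : R := #|S|%:R / #|F|%:R.
Let phi (x y : F * F) : R := (field_rel x y)%:R - sigma.

Lemma field_rel_sym : symmetric field_rel.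
Proof.
move=> x y; rewrite /field_rel.
by have -> : x.1 * y.1 + x.2 + y.2 = y.1 * x.1 + y.2 + x.2 by ring.
Qed.

Let F0 : 0 < #|F|%:R :> R.
Proof. by rewrite ltr0n (cardD1 (0 : F)). Qed.

Let sum_chi : \sum_(u : F) ((u \in S)%:R - sigma) = 0.
Proof.
rewrite sumrB sumr_const -[_ *+ #|_|]mulr_natl /sigma [_ * (_ / _)]mulrC mulfVK ?lt0r_neq0 //.
by rewrite -[#|S| in X in _ - X]sum1_card natr_sum [X in _ - X]big_mkcond -sumrB big1 // => u _; case: (u \in S); rewrite subrr.
Qed.

(* If x.1 != x'.1 then y |-> (x.1 y.1 + x.2 + y.2, x'.1 y.1 + x'.2 + y.2) is a
   bijection of F * F. *)
Lemma field_pair_orthogonal (x x' : F * F) : x.1 != x'.1 ->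
  \sum_y phi x y * phi x' y = 0.
Proof.
move=> ne; have d0 : x.1 - x'.1 != 0 by rewrite subr_eq0.
pose g (y : F * F) := (x.1 * y.1 + x.2 + y.2, x'.1 * y.1 + x'.2 + y.2).
pose g' (u : F * F) :=
  let c := (u.1 - u.2 - x.2 + x'.2) / (x.1 - x'.1) in (c, u.1 - x.2 - x.1 * c).
have gK : cancel g g'.
  move=> [c d]; rewrite /g /g' /=.
  have e : (x.1 * c + x.2 + d - (x'.1 * c + x'.2 + d) - x.2 + x'.2) / (x.1 - x'.1) = c.
    by field.
  by rewrite e; congr (_, _); ring.
have gbij : bijective g by apply: injF_bij; apply: can_inj gK.
pose chi (u : F) : R := (u \in S)%:R - sigma.
transitivity (\sum_y chi (g y).1 * chi (g y).2); first by [].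
transitivity (\sum_(u : F * F) chi u.1 * chi u.2).
  by rewrite [RHS](reindex g) //; apply: onW_bij.
rewrite -(pair_big xpredT xpredT (fun a b => chi a * chi b)) /=.
by rewrite big1 // => a _; rewrite -mulr_sumr sum_chi mulr0.
Qed.

Let sigma01 : 0 <= sigma <= 1.
Proof.
rewrite /sigma divr_ge0 //= ler_pdivrMr // mul1r ler_nat; exact: max_card.
Qed.

Let phi_le x y x' : phi x y * phi x' y <= 1.
Proof.
apply: le_trans (ler_norm _) _; rewrite normrM.
have le1 z : `|phi z y| <= 1.
  by have /andP[s0 s1] := sigma01; rewrite ler_norml /phi; case: (field_rel z y) => /=; lra.
by rewrite -[1]mulr1 ler_pM.
Qed.

(** After Cauchy-Schwarz over [y], orthogonality leaves only pairs with [x'.1 == x.1]: [#|F|]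
    choices of [x'] for each [x], each contributing at most [#|F| ^ 2]. *)
Lemma field_discrepancy (U W : {set F * F}) :
  (\sum_(x in U) \sum_(y in W) phi x y) ^+ 2 <= #|W|%:R * #|U|%:R * #|F|%:R ^+ 3.
Proof.
rewrite exchange_big /=; apply: le_trans (sum_square_le _ _) _.
rewrite -mulrA ler_wpM2l //.
apply: (@le_trans _ _ (\sum_y (\sum_(x in U) phi x y) ^+ 2)).
  rewrite [leLHS]big_mkcond; apply: ler_sum => y _; case: ifP => // _; exact: sqr_ge0.
have -> : \sum_y (\sum_(x in U) phi x y) ^+ 2 =
    \sum_(x in U) \sum_(x' in U) \sum_y phi x y * phi x' y.
  under eq_bigr => y _ do rewrite expr2 mulr_suml.
  rewrite exchange_big /=; apply: eq_bigr => x _.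
  under eq_bigr => y _ do rewrite mulr_sumr.
  by rewrite exchange_big.
rewrite -sum1_card natr_sum mulr_suml; apply: ler_sum => x _.
rewrite mul1r (bigID (fun x' => x'.1 == x.1)) /= [X in _ + X]big1 ?addr0; last first.
  by move=> x' /andP[_ ne]; apply: field_pair_orthogonal; rewrite eq_sym.
apply: (@le_trans _ _ (\sum_(x' | x'.1 == x.1) #|F|%:R ^+ 2)).
  have -> : #|F|%:R ^+ 2 = \sum_(y : F * F) 1 :> R.
    by rewrite sumr_const card_prod expr2 natrM.
  rewrite [leLHS]big_mkcond [leRHS]big_mkcond; apply: ler_sum => x' _.
  case: ifP => [/andP[_ ->]|_]; first by apply: ler_sum.
  by case: ifP => // _; apply: sumr_ge0.
rewrite sumr_const -[X in X <= _]mulr_natl exprS ler_wpM2r ?exprn_ge0 // ler_nat.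
apply: leq_trans (leq_imset_card (fun b : F => (x.1, b)) predT).
apply: subset_leq_card; apply/fintype.subsetP => -[a b]; rewrite unfold_in /= => /eqP->.
by apply/imsetP; exists b.
Qed.
End FieldGraph.

(** Characteristic 2 is enough: the squares of the orders [2 ^ k] are the powers of 4. *)
Lemma field_size (n : nat) : (1 < n)%N ->
  exists F : finFieldType, (n <= #|F| ^ 2)%N /\ (#|F| ^ 2 < 4 * n)%N.
Proof.
move=> n1; have ex : exists k, (0 < k)%N && (n <= 4 ^ k)%N.
  by exists n; rewrite (ltnW n1) ltnW // ltn_expl.
case: (ex_minnP ex) => k /andP[k0 nk] kmin.
have [F _ cF] := PrimePowerField (isT : prime 2) k0; exists F.
have qE : (#|F| ^ 2 = 4 ^ k)%N by rewrite cF -!expnM mulnC expnM.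
rewrite qE; split=> //; case: k k0 nk kmin {cF qE} => // -[|k] _ nk kmin.
  by rewrite expn1; lia.
rewrite expnS ltn_mul2l /= ltnNge; apply/negP => nk'.
by have := kmin k.+1; rewrite nk' /= => /(_ isT); rewrite ltnn.
Qed.


(** * Edge counts and their adjustment *)

Lemma edge_sum_card (R : realType) (V : finType) (A : rel V) (U W : {set V}) :
  edge_sum R A U W = #|[set xy : V * V | [&& xy.1 \in U, xy.2 \in W & A xy.1 xy.2]]|%:R.
Proof.
rewrite -sum1_card natr_sum [RHS]big_mkcond /=.
pose F x y : R := if [&& x \in U, y \in W & A x y] then 1 else 0.
transitivity (\sum_(p : V * V) F p.1 p.2); last first.
  by apply: eq_bigr => p _; rewrite inE.
rewrite -(pair_bigA _ F) /edge_sum /= big_mkcond; apply: eq_bigr => x _.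
rewrite /F; case: (x \in U) => /=; last by rewrite big1.
by rewrite big_mkcond; apply: eq_bigr => y _; case: (y \in W); case: (A x y).
Qed.

Lemma edge_card2 (V : finType) (G : graph V) e : e \in edges G -> #|e| = 2%N.
Proof. by move=> eG; apply/eqP; have /forall_inP := edgesP G; apply. Qed.

Lemma edge_sum_edges (R : realType) (V : finType) (G : graph V) :
  edge_sum R (adj G) [set: V] [set: V] = 2 * #|edges G|%:R.
Proof.
rewrite edge_sum_card -natrM -card_adj_pairs; last exact: edge_card2.
by congr (_%:R); apply: eq_card => xy; rewrite !inE.
Qed.

Lemma edge_sum_symdiff (R : realType) (V : finType) (G G' : graph V) (U W : {set V}) :
  `|edge_sum R (adj G) U W - edge_sum R (adj G') U W| <=
  2 * #|(edges G :\: edges G') :|: (edges G' :\: edges G)|%:R.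
Proof.
rewrite -natrM -card_adj_pairs; last first.
  by move=> e; rewrite !inE => /orP[] /andP[_]; apply: edge_card2.
set D := (_ :|: _).
apply: (@le_trans _ _ (edge_sum R (fun x y => [set x; y] \in D) U W)).
  rewrite /edge_sum -sumrB; apply: le_trans (ler_norm_sum _ _ _) _.
  apply: ler_sum => x _; rewrite -sumrB; apply: le_trans (ler_norm_sum _ _ _) _.
  apply: ler_sum => y _; rewrite /adj /D !inE.
  by case: (_ \in edges G); case: (_ \in edges G'); rewrite /= ?subrr ?subr0 ?sub0r ?normrN ?normr0 ?normr1.
rewrite edge_sum_card ler_nat; apply: subset_leq_card.
by apply/fintype.subsetP => xy; rewrite !inE => /and3P[].
Qed.

Lemma card_all_edges (V : finType) : #|[set e : {set V} | #|e| == 2%N]| = 'C(#|V|, 2).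
Proof. by rewrite -[RHS](card_draws V 2); apply: eq_card => e; rewrite !inE. Qed.

(** The edge distance function prescribes the number of edges exactly, which the field construction
    meets only approximately. *)
Lemma adjust_edges (V : finType) (G0 : graph V) (m : nat) : (m <= 'C(#|V|, 2))%N ->
  exists G : graph V, #|edges G| = m /\
    #|(edges G :\: edges G0) :|: (edges G0 :\: edges G)| =
      ((m - #|edges G0|) + (#|edges G0| - m))%N.
Proof.
move=> mC; have [me|em] := leqP m #|edges G0|.
  have [B BG Bm] := exists_subset_card me.
  have BP : [forall e in B, #|e| == 2%N].
    by apply/forall_inP => e /(fintype.subsetP BG)/edge_card2 ->.
  exists (Graph BP); split => //=.
  have -> : B :\: edges G0 = finset.set0 by apply/eqP; rewrite finset.setD_eq0.
  rewrite finset.set0U cardsD (finset.setIidPr BG) Bm.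
  by move: me; rewrite -subn_eq0 => /eqP->; rewrite add0n.
pose P := [set e : {set V} | #|e| == 2%N].
have GP : edges G0 \subset P.
  by apply/fintype.subsetP => e /edge_card2; rewrite inE => ->.
have [|B BG Bm] := @exists_subset_card _ (P :\: edges G0) (m - #|edges G0|).
  by rewrite cardsD (finset.setIidPr GP) card_all_edges leq_sub2r.
have BP : [forall e in edges G0 :|: B, #|e| == 2%N].
  apply/forall_inP => e; rewrite inE => /orP[/edge_card2->//|/(fintype.subsetP BG)].
  by rewrite !inE => /andP[].
have dis : edges G0 :&: B = finset.set0.
  apply/finset.setP => e; rewrite !inE; apply/negP => /andP[eG /(fintype.subsetP BG)].
  by rewrite !inE eG.
exists (Graph BP); split => /=.
  by rewrite cardsU dis cards0 subn0 Bm subnKC // ltnW.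
have -> : edges G0 :\: (edges G0 :|: B) = finset.set0.
  by apply/eqP; rewrite finset.setD_eq0 finset.subsetUl.
rewrite finset.setU0 finset.setDUl finset.setDv finset.set0U cardsD finset.setIC dis cards0 Bm.
by move: (ltnW em); rewrite -subn_eq0 => /eqP->; rewrite addn0 subn0.
Qed.

Lemma bin2R (R : realType) (n : nat) : 2 * 'C(n, 2)%:R = n%:R * (n%:R - 1) :> R.
Proof.
case: n => [|n]; first by rewrite bin_small // mulr0 mul0r.
rewrite -[in RHS]natr1 addrK natr1 -!natrM mulnC; congr (_%:R).
by have := bin_ffact n.+1 2; rewrite /= !ffactnS ffactn0 muln1.
Qed.

Lemma quasirandom_graph (R : realType) (p xi : R) : 0 <= p <= 1 -> 0 < xi ->
  exists N : nat, forall n, (N <= n)%N -> exists G : graph 'I_n,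
    #|edges G|%:Z = Num.floor (p * 'C(n, 2)%:R) /\
    forall U W : {set 'I_n},
      `|edge_sum R (adj G) U W - p * (#|U|%:R * #|W|%:R)| <= xi * n%:R ^+ 2.
Proof.
move=> /andP[p0 p1] xi0.
(* At most 3 parts of 8 go to [G0] (discrepancy, loops, rounding of the density) and 4 to the
   adjustment of the edge number. *)
pose ep := xi / 8; have ep0 : 0 < ep by rewrite divr_gt0.
have big (c : R) : exists N : nat, forall n, (N <= n)%N -> c <= n%:R.
  exists (Num.truncn c).+1 => n Nn; apply: le_trans (ltW (truncnS_gt c)) _.
  by rewrite ler_nat.
have [N1 HN1] := big (64 / ep ^+ 4); have [N2 HN2] := big (1 / ep ^+ 2).
have [N3 HN3] := big (2 / ep).
exists (maxn (maxn 2 N1) (maxn N2 N3)) => n.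
rewrite !geq_max => /andP[/andP[n2 n1] /andP[n3 n4]].
have {HN1 n1} n1 := HN1 _ n1; have {HN2 n3} n3 := HN2 _ n3; have {HN3 n4} n4 := HN3 _ n4.
have nR : 2 <= n%:R :> R by rewrite (ler_nat _ 2).
have nR0 : 0 < n%:R :> R by lra.
have [F [nq qn]] := field_size n2.
set q := #|F| in nq qn.
have q0 : 0 < q%:R :> R.
  by rewrite ltr0n; case: (q) nq => //; rewrite leqNgt => /negP; case; apply: ltnW.
have pq0 : 0 <= p * q%:R by rewrite mulr_ge0 // ltW.
have Sle : (Num.truncn (p * q%:R) <= #|[set: F]|)%N.
  rewrite cardsT truncn_le_nat -natr1 ltr_pwDr // -[leRHS]mul1r ler_wpM2r //.
have [S _ Sq] := exists_subset_card Sle.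
have /andP[S1 S2] := truncn_itv pq0; rewrite -Sq -natr1 in S1 S2.
pose sigma : R := #|S|%:R / q%:R.
have sq : sigma * q%:R = #|S|%:R by rewrite mulfVK // lt0r_neq0.
have q2 : n%:R <= q%:R ^+ 2 :> R by rewrite -natrX ler_nat.
have q2' : q%:R ^+ 2 < 4 * n%:R :> R by rewrite -natrX -natrM ltr_nat.
have epn : 2 <= ep * n%:R by rewrite mulrC -ler_pdivrMr.
have epq : 1 <= ep * q%:R.
  have : 1 <= (ep * q%:R) ^+ 2.
    rewrite exprMn; apply: (@le_trans _ _ (ep ^+ 2 * n%:R)).
      by rewrite mulrC -ler_pdivrMr // exprn_gt0.
    by rewrite ler_pM2l // exprn_gt0.
  by rewrite -[X in X <= _](expr1n _ 2) ler_pXn2r // nnegrE ?ler01 // mulr_ge0 // ltW.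
have sp : `|sigma - p| <= ep.
  rewrite ler_norml -(ler_pM2r q0) -[X in _ && X](ler_pM2r q0) mulrBl sq.
  by apply/andP; split; lra.
have nqF : (n <= #|{: F * F}|)%N by rewrite card_prod mulnn.
pose io (i : 'I_n) : F * F := enum_val (widen_ord nqF i).
have io_inj : injective io by move=> i j /enum_val_inj/(congr1 val)/= /val_inj.
pose rel0 (i j : 'I_n) := field_rel S (io i) (io j).
pose G0 := graph_of_rel rel0.
have adj0 i j : adj G0 i j = (i != j) && rel0 i j.
  by rewrite adj_graph_of_rel /rel0 [field_rel S (io j) _]field_rel_sym orbb.
have cardn (U : {set 'I_n}) : #|U|%:R <= n%:R :> R.
  by rewrite ler_nat -[X in (_ <= X)%N](card_ord n) max_card.
have disc (U W : {set 'I_n}) :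
    `|\sum_(i in U) \sum_(j in W) ((rel0 i j)%:R - sigma)| <= ep * n%:R ^+ 2.
  set Phi := \sum_(i in U) _.
  have PhiE : Phi = \sum_(x in io @: U) \sum_(y in io @: W) ((field_rel S x y)%:R - sigma).
    rewrite big_imset /=; last by move=> x y _ _; apply: io_inj.
    by apply: eq_bigr => i _; rewrite big_imset //= => x y _ _; apply: io_inj.
  have := field_discrepancy R S (io @: U) (io @: W); rewrite -PhiE.
  rewrite !card_imset // -/q => h1.
  have h2 : Phi ^+ 2 <= n%:R ^+ 2 * q%:R ^+ 3.
    apply: le_trans h1 _; rewrite ler_wpM2r ?exprn_ge0 ?(ltW q0) //.
    by rewrite expr2 ler_pM ?cardn.
  (* Fourth powers avoid square roots: [Phi ^+ 2 <= n ^+ 2 * q ^+ 3] and [q ^+ 2 < 4 * n] give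
     [Phi ^+ 4 <= 64 * n ^+ 7]. *)
  have h3 : (Phi ^+ 2) ^+ 2 <= (ep * n%:R ^+ 2) ^+ 4.
    apply: (@le_trans _ _ ((n%:R ^+ 2 * q%:R ^+ 3) ^+ 2)).
      by rewrite ler_pXn2r // nnegrE ?sqr_ge0 // mulr_ge0 ?exprn_ge0 // ltW.
    have -> : (n%:R ^+ 2 * q%:R ^+ 3) ^+ 2 = n%:R ^+ 4 * (q%:R ^+ 2) ^+ 3 :> R by ring.
    apply: (@le_trans _ _ (n%:R ^+ 4 * (4 * n%:R) ^+ 3)).
      rewrite ler_pM2l ?exprn_gt0 //.
      by rewrite ler_pXn2r ?nnegrE ?exprn_ge0 ?mulr_ge0 ?(ltW q0) ?(ltW nR0) ?(ltW q2').
    have -> : (ep * n%:R ^+ 2) ^+ 4 = (ep ^+ 4 * n%:R) * n%:R ^+ 7 :> R by ring.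
    have -> : n%:R ^+ 4 * (4 * n%:R) ^+ 3 = 64 * n%:R ^+ 7 :> R by ring.
    rewrite ler_pM2r ?exprn_gt0 //.
    by rewrite [ep ^+ 4 * _]mulrC -ler_pdivrMr // exprn_gt0.
  have {}h3 : `|Phi| ^+ 4 <= (ep * n%:R ^+ 2) ^+ 4.
    by rewrite -[in leLHS](mulnK 2 (isT : 0 < 2)%N) /= (exprM _ 2 2) real_normK ?num_real.
  by move: h3; rewrite ler_pXn2r // nnegrE ?normr_ge0 // mulr_ge0 ?exprn_ge0 // ltW.
have n2ep : 2 * n%:R <= ep * n%:R ^+ 2.
  by rewrite expr2 mulrA ler_pM2r.
have dev0 (U W : {set 'I_n}) :
    `|edge_sum R (adj G0) U W - p * (#|U|%:R * #|W|%:R)| <= 3 * ep * n%:R ^+ 2.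
  have UW0 : 0 <= #|U|%:R * #|W|%:R :> R by rewrite mulr_ge0.
  have UW1 : #|U|%:R * #|W|%:R <= n%:R ^+ 2 :> R by rewrite expr2 ler_pM.
  pose diag := \sum_(i in U) \sum_(j in W) ((i == j) && rel0 i j)%:R : R.
  have diag0 : 0 <= diag by apply: sumr_ge0 => i _; apply: sumr_ge0.
  have diagn : diag <= n%:R.
    apply: le_trans (cardn U); rewrite -sum1_card natr_sum; apply: ler_sum => i _.
    apply: (@le_trans _ _ (\sum_j (i == j)%:R)).
      rewrite big_mkcond; apply: ler_sum => j _.
      by case: (j \in W); case: (i == j); case: (rel0 i j).
    by rewrite (bigD1 i) //= eqxx big1 ?addr0 // => j ji; rewrite eq_sym (negbTE ji).
  have := disc U W; set Phi := \sum_(i in U) _ => dPhi.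
  have -> : edge_sum R (adj G0) U W - p * (#|U|%:R * #|W|%:R) =
      Phi - diag + (sigma - p) * (#|U|%:R * #|W|%:R).
    have -> : Phi = edge_sum R (adj G0) U W + diag - sigma * (#|U|%:R * #|W|%:R).
      have -> : sigma * (#|U|%:R * #|W|%:R) = \sum_(i in U) \sum_(j in W) sigma.
        by rewrite !sumr_const -[RHS]mulr_natl -[sigma *+ _]mulr_natl; ring.
      rewrite /Phi /edge_sum /diag -big_split -sumrB; apply: eq_bigr => i _ /=.
      rewrite -big_split -sumrB; apply: eq_bigr => j _ /=; rewrite adj0.
      by case: (i == j); case: (rel0 i j); rewrite /= ?addr0 ?add0r.
    by ring.
  have h4 : `|(sigma - p) * (#|U|%:R * #|W|%:R)| <= ep * n%:R ^+ 2.
    by rewrite normrM [X in _ * X]ger0_norm // ler_pM.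
  move: dPhi h4; rewrite !ler_norml => /andP[? ?] /andP[? ?].
  by apply/andP; split; lra.
have pC0 : 0 <= p * 'C(n, 2)%:R by rewrite mulr_ge0.
pose m := Num.truncn (p * 'C(n, 2)%:R).
have /andP[m1 m2] := truncn_itv pC0; rewrite -/m -natr1 in m1 m2.
have mC : (m <= 'C(#|'I_n|, 2))%N.
  rewrite card_ord /m truncn_le_nat -natr1 ltr_pwDr // -[leRHS]mul1r ler_wpM2r //.
have [G [Gm Gd]] := adjust_edges G0 mC.
exists G; split.
  by rewrite Gm /m truncn_floor pC0 gez0_abs // floor_ge0.
move=> U W; have e0 := dev0 [set: 'I_n] [set: 'I_n].
rewrite edge_sum_edges !cardsT !card_ord in e0.
have := edge_sum_symdiff R G G0 U W; rewrite Gd.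
have C2 := bin2R R n.
have md : 2 * ((m - #|edges G0|) + (#|edges G0| - m))%:R <= 4 * ep * n%:R ^+ 2 :> R.
  have pn : 0 <= p * n%:R by rewrite mulr_ge0 // ltW.
  have pn' : p * n%:R <= n%:R by rewrite -[leRHS]mul1r ler_wpM2r // ltW.
  have pC2 : 2 * (p * 'C(n, 2)%:R) = p * n%:R ^+ 2 - p * n%:R.
    by rewrite mulrCA C2; ring.
  move: e0; rewrite ler_norml => /andP[e1 e2].
  have [me|em] := leqP m #|edges G0|.
    have -> : (m - #|edges G0| = 0)%N by apply/eqP; rewrite subn_eq0.
    by rewrite add0n natrB //; lra.
  have -> : (#|edges G0| - m = 0)%N by apply/eqP; rewrite subn_eq0 ltnW.
  by rewrite addn0 natrB ?(ltnW em) //; lra.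
have := dev0 U W.
have -> : xi = 8 * ep by rewrite /ep; field.
have n20 : 0 <= ep * n%:R ^+ 2 by rewrite mulr_ge0 ?exprn_ge0 // ltW.
rewrite !ler_norml => /andP[? ?] /andP[? ?]; apply/andP; split; lra.
Qed.

(** * From dense graphs to reduced graphs *)

Lemma edit_cost01 (R : realType) (T : Type) (p : R) (al : bool -> rel T) (u v : T) :
  0 <= p <= 1 -> 0 <= edit_cost p al u v <= 1.
Proof.
move=> /andP[p0 p1]; rewrite /edit_cost.
by case: (al true u v); case: (al false u v) => /=; lra.
Qed.

Lemma pair_sum_ge (R : realDomainType) (I C : finType) (om : I -> I -> C -> C -> R)
    (z : I -> C) (i j : I) : (forall i j a b, 0 <= om i j a b) -> i != j ->
  om i j (z i) (z j) <= pair_sum om z.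
Proof.
move=> om0 ij; rewrite /pair_sum (bigD1 i) //= (bigD1 j) //= -addrA lerDl.
by apply: addr_ge0; apply: sumr_ge0 => i' _ //; apply: sumr_ge0.
Qed.

Lemma sum_tuple_ffun (R : nmodType) (X : finType) (k : nat) (x0 : X)
    (F : ('I_k -> X) -> R) : (forall f g, f =1 g -> F f = F g) ->
  \sum_(t : k.-tuple X) F (fun i => nth x0 t i) = \sum_(z : {ffun 'I_k -> X}) F z.
Proof.
move=> Fext; pose g (t : k.-tuple X) : {ffun 'I_k -> X} := [ffun i => tnth t i].
have gbij : bijective g.
  exists (fun z : {ffun 'I_k -> X} => [tuple z i | i < k]).
    by move=> t; apply/eq_from_tnth => i; rewrite tnth_mktuple ffunE.
  by move=> z; apply/ffunP => i; rewrite ffunE tnth_mktuple.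
rewrite [RHS](reindex g) /=; last exact: onW_bij.
by apply: eq_bigr => t _; apply: Fext => i; rewrite ffunE (tnth_nth x0).
Qed.

Section Blowup.
Variables (R : realType) (h : nat) (H : graph 'I_h) (p g : R).
Hypotheses (p01 : 0 <= p <= 1) (g1 : g <= 1).
Hypothesis crg : forall (k : nat) (al : bool -> rel 'I_k) (x : 'I_k -> R),
  (forall be u v, al be u v = al be v u) ->
  (forall u v, al true u v || al false u v) ->
  (forall u, ~~ (al true u u && al false u u)) ->
  ~ embeds H al ->
  (forall u, 0 <= x u) -> \sum_u x u = 1 -> g <= quad_form (edit_cost p al) x.

(* By the box lemma and Ramsey's theorem a cheap coloured complete graph contains
   a blow-up, with homogeneous parts, of a cheap weighted reduced graph. *)
Lemma colored_graph_bound (e : R) : 0 < e -> exists M : nat, (0 < M)%N /\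
  forall al : bool -> rel 'I_M,
  (forall be u v, al be u v = al be v u) ->
  (forall u v, u != v -> al true u v || al false u v) ->
  ~ (exists f : 'I_h -> 'I_M, forall u v, u != v ->
       f u != f v /\ al (adj H u v) (f u) (f v)) ->
  (g - e) * M%:R ^+ 2 <= \sum_u \sum_(v | u != v) edit_cost p al u v.
Proof.
move=> e0.
have [ge|ge] := leP g e.
  exists 1%N; split=> // al _ _ _; apply: (@le_trans _ _ 0).
    by rewrite expr1n mulr1 subr_le0.
  apply: sumr_ge0 => u _; apply: sumr_ge0 => v _.
  by have /andP[] := edit_cost01 al u v p01.
(* [k] is the order of the reduced graph to be found; [1 / k < e / 2] absorbs the cost of its
   diagonal. *)
pose k := (Num.truncn (2 / e)).+1.
have k0 : 0 < k%:R :> R by rewrite ltr0n.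
have ke : 2 < k%:R * e by rewrite -ltr_pdivrMr // truncnS_gt.
have k1 : 1 <= k%:R :> R by rewrite (ler_nat _ 1).
pose s := (2 ^ (h + h))%N.
pose d := e / 4 / (4 ^ (k * k))%N%:R.
have d0 : 0 < d by rewrite !divr_gt0 // ltr0n expn_gt0.
have [M0 boxP] := box_lemma k s d0.
pose M1 := (Num.truncn ((1 + k%:R ^+ 2) * 4 / e)).+1.
pose M := maxn M0 M1.
have MM0 : (M0 <= M)%N by apply: leq_maxl.
have MM1 : (1 + k%:R ^+ 2) * 4 <= M%:R * e.
  rewrite -ler_pdivrMr //; apply: le_trans (ltW (truncnS_gt _)) _.
  by rewrite ler_nat leq_maxr.
have Mpos : (0 < M)%N by apply: leq_trans (leq_maxr _ _).
exists M; split=> // al alC cover noemb; rewrite leNgt; apply/negP => small.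
have MR : 0 < M%:R :> R by rewrite ltr0n.
pose x0 : 'I_M := Ordinal Mpos.
(* A repeated entry costs [k ^+ 2], more than the threshold [tau] below, so cheap tuples have
   distinct entries. *)
pose om (_ _ : 'I_k) (a b : 'I_M) : R := edit_cost p al a b + k%:R ^+ 2 * (a == b)%:R.
have c01 a b := edit_cost01 al a b p01.
have om0 i j a b : 0 <= om i j a b.
  by have /andP[? _] := c01 a b; rewrite addr_ge0 // mulr_ge0 ?exprn_ge0 // ltW.
pose v (z : 'I_k -> 'I_M) := pair_sum om z.
have v0 z : 0 <= v z by apply: sumr_ge0 => i _; apply: sumr_ge0.
pose vt (t : seq 'I_M) := v (fun i => nth x0 t i).
have sumab : \sum_a \sum_b (edit_cost p al a b + k%:R ^+ 2 * (a == b)%:R) <=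
    (g - 3 * e / 4) * M%:R ^+ 2.
  have -> : \sum_a \sum_b (edit_cost p al a b + k%:R ^+ 2 * (a == b)%:R) =
      \sum_a \sum_(b | a != b) edit_cost p al a b +
      \sum_a (edit_cost p al a a + k%:R ^+ 2).
    rewrite -big_split; apply: eq_bigr => a _ /=.
    rewrite (bigD1 a) //= eqxx mulr1 addrC; congr (_ + _).
    apply: eq_big => [b|b]; first by rewrite eq_sym.
    by rewrite eq_sym => /negbTE->; rewrite mulr0 addr0.
  have : \sum_(a : 'I_M) (edit_cost p al a a + k%:R ^+ 2) <= M%:R * (1 + k%:R ^+ 2).
    apply: (@le_trans _ _ (\sum_(a : 'I_M) (1 + k%:R ^+ 2))).
      by apply: ler_sum => a _; rewrite lerD2r; have /andP[] := c01 a a.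
    by rewrite sumr_const card_ord -[X in X <= _]mulr_natl.
  have : M%:R * ((1 + k%:R ^+ 2) * 4) <= M%:R * (M%:R * e) by rewrite ler_pM2l.
  by move: small; rewrite expr2; lra.
have Mk0 : 0 < M%:R ^+ k :> R by rewrite exprn_gt0.
have avg : \sum_(t : k.-tuple 'I_M) vt t <= M%:R ^+ k * (k%:R ^+ 2 * (g - 3 * e / 4)).
  rewrite /vt (sum_tuple_ffun x0 (F := v)); last first.
    move=> f f' ff; rewrite /v /pair_sum; apply: eq_bigr => i _; apply: eq_bigr => j _.
    by rewrite !ff.
  pose wt (_ : 'I_M) : R := M%:R^-1.
  have wt1 : \sum_c wt c = 1.
    by rewrite sumr_const card_ord -[LHS]mulr_natl divff // lt0r_neq0.
  have := sum_pair_sum om wt1.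
  under eq_bigr => z _ do rewrite prodr_const card_ord.
  rewrite -mulr_sumr => E.
  have -> : \sum_(z : {ffun 'I_k -> 'I_M}) v z = M%:R ^+ k *
      (M%:R^-1 ^+ k * \sum_(z : {ffun 'I_k -> 'I_M}) v z).
    by rewrite mulrA -exprMn divff ?expr1n ?mul1r // lt0r_neq0.
  rewrite E ler_pM2l //.
  have gpos : 0 <= g - 3 * e / 4 by lra.
  have inner : \sum_a \sum_b wt a * wt b * (edit_cost p al a b + k%:R ^+ 2 * (a == b)%:R)
       <= g - 3 * e / 4.
    have -> : \sum_a \sum_b wt a * wt b * (edit_cost p al a b + k%:R ^+ 2 * (a == b)%:R) =
        M%:R ^- 2 * \sum_a \sum_b (edit_cost p al a b + k%:R ^+ 2 * (a == b)%:R).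
      rewrite mulr_sumr; apply: eq_bigr => a _; rewrite mulr_sumr.
      by apply: eq_bigr => b _; rewrite /wt -exprVn expr2.
    by rewrite mulrC ler_pdivrMr // exprn_gt0.
  apply: (@le_trans _ _ (\sum_(i < k) \sum_(j < k) (g - 3 * e / 4))).
    apply: ler_sum => i _; rewrite big_mkcond; apply: ler_sum => j _.
    by case: ifP => _.
  by rewrite !sumr_const card_ord -mulrnA -[X in X <= _]mulr_natl natrM expr2.
(* Markov's inequality: the average is at most [k ^+ 2 * (g - 3 * e / 4)], so this threshold leaves
   a share [e / 4] of good tuples. *)
pose tau := k%:R ^+ 2 * (g - e / 2).
have tau0 : 0 < tau by rewrite mulr_gt0 ?exprn_gt0 //; lra.
pose good := [set t : k.-tuple 'I_M | vt t <= tau].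
have goodbig : e / 4 * M%:R ^+ k <= #|good|%:R.
  have h1 : (M%:R ^+ k - #|good|%:R) * tau <= M%:R ^+ k * (k%:R ^+ 2 * (g - 3 * e / 4)).
    apply: le_trans avg.
    rewrite (bigID (fun t : k.-tuple 'I_M => t \in good)) /=; apply: ler_wpDl.
      by apply: sumr_ge0 => t _; apply: v0.
    apply: (@le_trans _ _ (\sum_(t : k.-tuple 'I_M | t \notin good) tau)).
      rewrite sumr_const -[X in _ <= X]mulr_natl; apply: ler_wpM2r; first exact: ltW.
      have cE : (#|good| + #|[predC good]| = M ^ k)%N by rewrite cardC card_tuple card_ord.
      rewrite lerBlDl -natrD -natrX ler_nat -cE leq_add2l.
      by apply: eq_leq; apply: eq_card => t; rewrite /in_mem.
    by apply: ler_sum => t; rewrite inE -ltNge => /ltW.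
  have k20 : 0 < k%:R ^+ 2 :> R by rewrite exprn_gt0.
  have {}h1 : (M%:R ^+ k - #|good|%:R) * (g - e / 2) <= M%:R ^+ k * (g - 3 * e / 4).
    rewrite -(ler_pM2r k20); move: h1; rewrite /tau; lra.
  have c0 : 0 <= #|good|%:R :> R by [].
  have : #|good|%:R * (g - e / 2) <= #|good|%:R * 1 by rewrite ler_wpM2l //; move: g1; lra.
  by lra.
(* Fixing the pattern by pigeonhole, at the price of the factor [4 ^ (k * k)] in [d], makes all
   pairs between two parts of the box behave alike. *)
pose pat (t : seq 'I_M) : {ffun 'I_k * 'I_k -> bool * bool} :=
  [ffun ij : 'I_k * 'I_k => (al true (nth x0 t ij.1) (nth x0 t ij.2),
               al false (nth x0 t ij.1) (nth x0 t ij.2))].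
have [pi pibig] : exists pi, d * M%:R ^+ k <= #|[set t : k.-tuple 'I_M | (vt t <= tau) && (pat t == pi)]|%:R.
  apply: contrapT => /forallNP no.
  have : #|good|%:R < e / 4 * M%:R ^+ k; last by rewrite ltNge goodbig.
  have -> : #|good|%:R = \sum_pi #|[set t : k.-tuple 'I_M | (vt t <= tau) && (pat t == pi)]|%:R :> R.
    rewrite -natr_sum -sum1_card (partition_big (fun t : k.-tuple 'I_M => pat t) predT) //=.
    by congr (_%:R); apply: eq_bigr => pi _; rewrite -sum1_card; apply: eq_bigl => t; rewrite !inE.
  apply: (@lt_le_trans _ _ (\sum_(pi : {ffun 'I_k * 'I_k -> bool * bool}) d * M%:R ^+ k)).
    apply: ltr_sum => [|pi _]; last by rewrite ltNge; apply/negP; apply: no.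
    by apply/hasP; exists [ffun=> (true, true)]; rewrite ?mem_index_enum.
  rewrite sumr_const card_ffun !card_prod card_bool !card_ord -[X in X <= _]mulr_natl mulrA.
  by rewrite /d [_ * (e / 4 / _)]mulrC mulfVK ?lexx // lt0r_neq0 // ltr0n expn_gt0.
have [||S [szS Sbig SE]] := boxP 'I_M (fun t => (vt t <= tau) && (pat t == pi)).
- by rewrite card_ord.
- by rewrite card_ord.
pose A (i : 'I_k) : {set 'I_M} := nth finset.set0 S i.
have Abig i : (s <= #|A i|)%N by apply: (all_nthP finset.set0 Sbig); rewrite szS.
have Ane i : exists a, a \in A i.
  by apply/card_gt0P; apply: leq_trans (Abig i); rewrite expn_gt0.
have [a0 a0P] := choice Ane.
have AE (z : 'I_k -> 'I_M) : (forall i, z i \in A i) ->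
    v z <= tau /\ forall i j, pi (i, j) = (al true (z i) (z j), al false (z i) (z j)).
  move=> zA; pose t := [seq z i | i <- enum 'I_k].
  have szt : size t = k by rewrite size_map size_enum_ord.
  have tE (i : 'I_k) : nth x0 t i = z i.
    by rewrite (nth_map i) ?size_enum_ord // nth_ord_enum.
  have /SE : size t = k by [].
  have -> : all2 (fun x (B : {set 'I_M}) => x \in B) t S.
    rewrite all2E szt szS eqxx /=; apply/(all_nthP (x0, finset.set0)) => i.
    rewrite size_zip szt szS minnn => ik; rewrite nth_zip ?szt ?szS //=.
    by have := zA (Ordinal ik); rewrite /A -(tE (Ordinal ik)).
  move=> /(_ isT)/andP[vle /eqP pE]; split.
    rewrite (_ : v z = vt t) //; rewrite /vt /v /pair_sum; apply: eq_bigr => i _.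
    by apply: eq_bigr => j _; rewrite !tE.
  by move=> i j; rewrite -pE ffunE /= !tE.
have pairE (i j : 'I_k) a b : i != j -> a \in A i -> b \in A j ->
    a != b /\ pi (i, j) = (al true a b, al false a b).
  move=> ij aA bA; pose z l := if l == i then a else if l == j then b else a0 l.
  have zi : z i = a by rewrite /z eqxx.
  have zj : z j = b by rewrite /z eq_sym (negbTE ij) eqxx.
  have [|vz /(_ i j)] := AE z.
    by move=> l; rewrite /z; case: eqP => [->//|_]; case: eqP => [->//|_].
  rewrite zi zj => piE; split=> //; apply/eqP => ab.
  have := pair_sum_ge z om0 ij; rewrite zi zj ab /om eqxx mulr1 => h2.
  have /andP[c0 _] := c01 b b.
  have : k%:R ^+ 2 <= tau by apply: le_trans vz; apply: le_trans h2; rewrite lerDr.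
  have k20 : 0 < k%:R ^+ 2 :> R by rewrite exprn_gt0.
  by rewrite /tau -[X in X <= _]mulr1 ler_pM2l //; move: g1; lra.
have hom i : exists es : bool * seq 'I_M, [/\ size es.2 = h, {subset es.2 <= A i}, uniq es.2 &
    {in es.2 &, forall a b, a != b -> al es.1 a b}].
  have := ramsey (alC false) (n := h + h) (a := h) (b := h) (A := A i) (leqnn _) (Abig i).
  case=> [[q [szq qA uq Pq]]|[q [szq qA uq Pq]]].
    by exists (false, q).
  exists (true, q); split=> // a b aq bq ab /=.
  by have := cover a b ab; rewrite (negbTE (Pq a b aq bq ab)) orbF.
have [es esP] := choice hom.
pose alK (be : bool) (i j : 'I_k) : bool :=
  if i == j then be == (es i).1 else if be then (pi (i, j)).1 else (pi (i, j)).2.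
have alK_al be i j a b : i != j -> a \in A i -> b \in A j -> alK be i j = al be a b.
  move=> ij aA bA; have [_ piE] := pairE i j a b ij aA bA.
  by rewrite /alK (negbTE ij) piE; case: be.
have := @crg k alK (fun=> k%:R^-1).
have ks : \sum_(i < k) k%:R^-1 = 1 :> R.
  by rewrite sumr_const card_ord -[LHS]mulr_natl divff // lt0r_neq0.
(* Under uniform weights the reduced graph costs at most [(tau + k) / k ^+ 2 = g - e / 2 + 1 / k],
   which is below [g]. *)
move=> /(_ _ _ _ _ _ ks) F; suff : g <= k%:R^-1 ^+ 2 * (tau + k%:R).
  rewrite exprVn mulrC ler_pdivlMr ?exprn_gt0 // /tau => h3.
  have h5 : 2 * k%:R < k%:R * (k%:R * e) by rewrite [2 * _]mulrC ltr_pM2l.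
  by clear F; move: h3 h5; rewrite expr2; lra.
apply: le_trans (F _ _ _ _ _) _.
- move=> be i j; have [->//|ij] := eqVneq i j.
  rewrite (alK_al be i j _ _ ij (a0P i) (a0P j)).
  by rewrite (alK_al be j i _ _ _ (a0P j) (a0P i)) 1?eq_sym.
- move=> i j; have [->|ij] := eqVneq i j; first by rewrite /alK eqxx; case: (es j).1.
  rewrite !(alK_al _ i j _ _ ij (a0P i) (a0P j)).
  by have [ab _] := pairE i j _ _ ij (a0P i) (a0P j); apply: cover.
- by move=> i; rewrite /alK eqxx; case: (es i).1.
(* Vertex [u] takes the [u]-th entry of the homogeneous sequence of its part, so vertices sent to
   one part stay distinct; hence sequences of length [h]. *)
- case=> f fP; apply: noemb; exists (fun u => nth x0 (es (f u)).2 u) => u w uw.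
  have inA u' : nth x0 (es (f u')).2 u' \in A (f u').
    by have [sz sub _ _] := esP (f u'); apply: sub; apply: mem_nth; rewrite sz.
  have := fP u w uw; have [fuw|fuw] := eqVneq (f u) (f w); last first.
    rewrite (alK_al _ _ _ _ _ fuw (inA u) (inA w)) => ->; split=> //.
    by have [] := pairE _ _ _ _ fuw (inA u) (inA w).
  rewrite fuw /alK eqxx => /eqP ->; have [sz sub un Pq] := esP (f w).
  have ne : nth x0 (es (f w)).2 u != nth x0 (es (f w)).2 w by rewrite nth_uniq ?sz.
  by split=> //; apply: Pq => //; apply: mem_nth; rewrite sz.
- by move=> i; rewrite invr_ge0 ltW.
have -> : quad_form (edit_cost p alK) (fun=> k%:R^-1) =
    k%:R^-1 ^+ 2 * \sum_i \sum_j edit_cost p alK i j.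
  rewrite /quad_form mulr_sumr; apply: eq_bigr => i _.
  by rewrite /mulv -mulr_suml expr2 -mulrA; congr (_ * _); rewrite mulrC.
rewrite ler_pM2l; last by rewrite exprn_gt0 // invr_gt0.
have [vle _] := AE a0 a0P.
apply: (@le_trans _ _ (v a0 + k%:R)); last by rewrite lerD2r.
have -> : k%:R = \sum_(i < k) 1 :> R by rewrite sumr_const card_ord.
rewrite /v /pair_sum -big_split; apply: ler_sum => i _ /=.
rewrite (bigD1 i) //= addrC; apply: lerD; last by have /andP[] := edit_cost01 alK i i p01.
rewrite (eq_bigl (fun j => i != j)); last by move=> j; rewrite eq_sym.
apply: ler_sum => j ij; rewrite /om.
have -> : edit_cost p alK i j = edit_cost p al (a0 i) (a0 j).
  by rewrite /edit_cost !(alK_al _ i j _ _ ij (a0P i) (a0P j)).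
by rewrite lerDl mulr_ge0 // exprn_ge0 // ltW.
Qed.
End Blowup.

Lemma sum_adj_neq (R : realType) (V : finType) (G G' : graph V) :
  \sum_x \sum_y (adj G x y != adj G' x y)%:R =
  2 * #|(edges G :\: edges G') :|: (edges G' :\: edges G)|%:R :> R.
Proof.
set D := (_ :|: _).
have D2 e : e \in D -> #|e| = 2%N.
  by rewrite !inE => /orP[] /andP[_]; apply: edge_card2.
rewrite -natrM -(card_adj_pairs D2).
have -> : [set xy : V * V | [set xy.1; xy.2] \in D] =
    [set xy : V * V | [&& xy.1 \in [set: V], xy.2 \in [set: V] &
      (fun x y => [set x; y] \in D) xy.1 xy.2]].
  by apply/finset.setP => xy; rewrite !inE.
rewrite -(edge_sum_card R (fun x y => [set x; y] \in D)) /edge_sum.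
apply: eq_big => [x|x _]; first by rewrite inE.
apply: eq_big => [y|y _]; first by rewrite inE.
by congr (_%:R); rewrite !inE /adj; case: (_ \in edges G); case: (_ \in edges G').
Qed.

Lemma edge_sum_sub_le (R : realType) (V : finType) (A B : rel V) (X Y : {set V}) :
  `|edge_sum R A X Y - edge_sum R B X Y| <=
  \sum_(x in X) \sum_(y in Y) (A x y != B x y)%:R.
Proof.
rewrite /edge_sum -sumrB; apply: le_trans (ler_norm_sum _ _ _) _.
apply: ler_sum => x _; rewrite -sumrB; apply: le_trans (ler_norm_sum _ _ _) _.
apply: ler_sum => y _.
by case: (A x y); case: (B x y); rewrite /= ?subrr ?subr0 ?sub0r ?normrN ?normr0 ?normr1.
Qed.

Lemma density_sym (R : realType) (V : finType) (A : rel V) (X Y : {set V}) :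
  symmetric A -> density R A X Y = density R A Y X.
Proof.
move=> symA; rewrite /density [#|X|%:R * _]mulrC; congr (_ / _).
rewrite /edge_sum exchange_big /=; apply: eq_bigr => y _; apply: eq_bigr => x _.
by rewrite symA.
Qed.

Lemma card_residue (n k c : nat) : (0 < k)%N ->
  (#|[pred y : 'I_n | y %% k == c]| <= (n %/ k).+1)%N.
Proof.
move=> k0; pose g (y : 'I_n) : 'I_(n %/ k).+1 := inord (y %/ k).
rewrite -[X in (_ <= X)%N](card_ord (n %/ k).+1).
rewrite -(@card_in_imset _ _ g) ?max_card // => x y; rewrite !inE => /eqP xc /eqP yc.
move=> /(congr1 val); rewrite /= !inordK; last first.
- by rewrite ltnS leq_div2r // ltnW.
- by rewrite ltnS leq_div2r // ltnW.
by move=> E; apply/val_inj => /=; rewrite (divn_eq x k) (divn_eq y k) xc yc E.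
Qed.

Section LowerBound.
Variables (R : realType) (h : nat) (H : graph 'I_h) (p g : R).
Hypotheses (p01 : 0 <= p <= 1) (g1 : g <= 1).
Hypothesis crg : forall (k : nat) (al : bool -> rel 'I_k) (x : 'I_k -> R),
  (forall be u v, al be u v = al be v u) ->
  (forall u v, al true u v || al false u v) ->
  (forall u, ~~ (al true u u && al false u u)) ->
  ~ embeds H al ->
  (forall u, 0 <= x u) -> \sum_u x u = 1 -> g <= quad_form (edit_cost p al) x.

(** Where [G'] has density near 0, nearly all edges of [G], a share [p], were deleted; where it has
    density near 1, nearly all nonedges were filled. *)
Lemma cell_cost_le (V : finType) (G G' : graph V) (X Y : {set V}) (e0 d : R) :
  0 < e0 -> e0 <= 1 / 4 ->
  `|edge_sum R (adj G) X Y - p * (#|X|%:R * #|Y|%:R)| <= d ->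
  (p * (~~ (e0 <= density R (adj G') X Y))%:R +
   (1 - p) * (~~ (density R (adj G') X Y <= 1 - e0))%:R) * (#|X|%:R * #|Y|%:R) <=
  \sum_(x in X) \sum_(y in Y) (adj G x y != adj G' x y)%:R
    + e0 * (#|X|%:R * #|Y|%:R) + d.
Proof.
move=> e00 e04; have := edge_sum_sub_le R (adj G) (adj G') X Y.
rewrite (edge_sumE R (adj G')).
set S := \sum_(x in X) _; set D := density _ _ _ _; set c := #|X|%:R * #|Y|%:R => dif dev.
have c0 : 0 <= c by rewrite mulr_ge0.
move: dev dif; rewrite !ler_norml => /andP[d1 d2] /andP[d3 d4].
have S0 : 0 <= S by apply: sumr_ge0 => x _; apply: sumr_ge0.
have ec0 : 0 <= e0 * c by rewrite mulr_ge0 // ltW.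
rewrite -!ltNge; case: ltP => D1; case: ltP => D2 /=.
- by lra.
- have : D * c <= e0 * c by rewrite ler_wpM2r // ltW.
  by rewrite mulr1 mulr0 addr0; lra.
- have : (1 - e0) * c <= D * c by rewrite ler_wpM2r // ltW.
  by rewrite mulr1 mulr0 add0r; lra.
- by rewrite !mulr0 addr0 mul0r; lra.
Qed.

Lemma edit_lower_bound (e : R) : 0 < e -> exists N : nat, forall n, (N <= n)%N ->
  exists G : graph 'I_n, #|edges G|%:Z = Num.floor (p * 'C(n, 2)%:R) /\
  forall G' : graph 'I_n, ~~ induced_subgraph H G' ->
  (g - e) * n%:R ^+ 2 <= 2 * #|(edges G :\: edges G') :|: (edges G' :\: edges G)|%:R.
Proof.
move=> e_gt0; have eh : 0 < e / 2 by rewrite divr_gt0.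
have [M [M0 MP]] := colored_graph_bound p01 g1 crg eh.
have MR : 1 <= M%:R :> R by rewrite (ler_nat _ 1).
have M2 : 0 < M%:R ^+ 2 :> R by rewrite exprn_gt0 // ltr0n.
(* Below density [e0] a pair counts as empty. After a regularity error [e1], at least [al] remains
   for one extension step, and [e1] is small enough for [h] such steps. *)
pose e0 := Num.min (e / 16) (1 / 4).
have e00 : 0 < e0 by rewrite lt_min !divr_gt0.
have e016 : e0 <= e / 16 by rewrite ge_min lexx.
have e04 : e0 <= 1 / 4 by rewrite ge_min lexx orbT.
pose al := e0 / 2.
have al0 : 0 < al by rewrite divr_gt0.
have al1 : al <= 1 by rewrite /al; lra.
pose e1 := Num.min al (Num.min (al ^+ h / (h%:R + 1)) (e / 32 / M%:R ^+ 2)).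
have h10 : 0 < h%:R + 1 :> R by rewrite ltr_wpDl.
have alh0 : 0 < al ^+ h by rewrite exprn_gt0.
have e10 : 0 < e1.
  by rewrite !lt_min al0 divr_gt0 // !divr_gt0.
have e1al : e1 <= al by rewrite ge_min lexx.
have e1h : h%:R * e1 < al ^+ h.
  have : e1 <= al ^+ h / (h%:R + 1) by rewrite !ge_min lexx orbT.
  by rewrite ler_pdivlMr // mulrDr mulr1 mulrC; lra.
have e1M : M%:R ^+ 2 * e1 <= e / 32.
  have : e1 <= e / 32 / M%:R ^+ 2 by rewrite !ge_min lexx !orbT.
  by rewrite ler_pdivlMr // mulrC.
pose c0 := 32 * M%:R ^+ 2 / e.
pose k0 := (Num.truncn c0).+1.
have k0e : M%:R ^+ 2 / k0%:R <= e / 32.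
  rewrite ler_pdivrMr ?ltr0n //; have := ltW (truncnS_gt c0).
  by rewrite {1}/c0 -/k0 ler_pdivrMr //; lra.
have [K KP] := regularity_lemma k0 e10.
(* The discrepancy is paid once for each of the at most [K ^ 2] pairs of cells. *)
pose xi := e / 16 / K.+1%:R ^+ 2.
have xi0 : 0 < xi by rewrite !divr_gt0 // exprn_gt0 // ltr0n.
have [N1 N1P] := quasirandom_graph p01 xi0.
exists (maxn N1 k0) => n; rewrite geq_max => /andP[nN nk0].
have [G [Gm Gdev]] := N1P n nN; exists G; split=> // G' noind.
have n0 : (0 < n)%N by apply: leq_trans nk0.
have nR : 0 < n%:R :> R by rewrite ltr0n.
have n2 : 0 < n%:R ^+ 2 :> R by rewrite exprn_gt0.
have ne : M%:R ^+ 2 / n%:R <= e / 32.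
  apply: le_trans k0e; rewrite ler_pM2l // lef_pV2 ?posrE ?ltr0n //.
  by rewrite ler_nat.
(* Refining the residue classes modulo [k0] keeps every cell small, so few pairs lie within one
   cell. *)
pose f0 (i : 'I_n) : 'I_k0 := Ordinal (ltn_pmod i (isT : 0 < k0)%N).
have [T [f [TK ff0 irr]]] := KP 'I_n 'I_k0 (adj G') f0 (eq_leq (card_ord k0)).
rewrite card_ord in irr.
rewrite leNgt; apply/negP => far.
pose dens := cell_density R (adj G') f.
have symG' : symmetric (adj G') by move=> x y; apply: adjC.
have densC x y : dens x y = dens y x by apply: density_sym.
pose alV (be : bool) (x y : 'I_n) : bool := if be then e0 <= dens x y else dens x y <= 1 - e0.
pose bad x y := (f x == f y) || ~~ regular_pair (adj G') e1 (cell f (f x)) (cell f (f y)).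
(* The penalty [M ^+ 2] exceeds the total cost allowed by [zle2], so no two sampled vertices share a
   cell or lie in an irregular pair. *)
pose om (_ _ : 'I_M) x y : R := edit_cost p alV x y + M%:R ^+ 2 * (bad x y)%:R.
have om0 i j x y : 0 <= om i j x y.
  have /andP[? _] := edit_cost01 alV x y p01.
  by rewrite addr_ge0 // mulr_ge0 // ltW.
have cost_sum : \sum_x \sum_y edit_cost p alV x y <= (g - e + e / 8) * n%:R ^+ 2.
  have cells : \sum_x \sum_y (edit_cost p alV x y - (adj G x y != adj G' x y)%:R - e0)
      <= \sum_(a : T) \sum_(b : T) xi * n%:R ^+ 2.
    rewrite (sum_cells f); apply: ler_sum => a _; apply: ler_sum => b _.
    have := @cell_cost_le _ G G' (cell f a) (cell f b) e0 _ e00 e04 (Gdev _ _).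
    set c := p * _ + _ => cle.
    rewrite (eq_bigr (fun x => \sum_(y in cell f b) (c - (adj G x y != adj G' x y)%:R - e0))).
      have sumc (d : R) : \sum_(x in cell f a) \sum_(y in cell f b) d =
          d * (#|cell f a|%:R * #|cell f b|%:R).
        by rewrite !sumr_const -mulrnA -[LHS]mulr_natr natrM [#|cell f b|%:R * _]mulrC.
      under eq_bigr => x _ do rewrite !sumrB.
      by rewrite !sumrB !sumc; lra.
    move=> x; rewrite inE => /eqP xa; apply: eq_bigr => y; rewrite inE => /eqP yb.
    by rewrite /c /edit_cost /alV /dens /cell_density xa yb.
  have TT : \sum_(a : T) \sum_(b : T) xi * n%:R ^+ 2 <= e / 16 * n%:R ^+ 2.
    rewrite !sumr_const -mulrnA -[X in X <= _]mulr_natr mulrAC ler_pM2r //.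
    rewrite /xi mulrAC ler_pdivrMr ?exprn_gt0 ?ltr0n // ler_pM2l ?divr_gt0 //.
    by rewrite natrM expr2 ler_pM // ler_nat ltnW // ltnS.
  have nn : \sum_(x : 'I_n) \sum_(y : 'I_n) e0 = e0 * n%:R ^+ 2.
    by rewrite !sumr_const !card_ord -mulrnA -[LHS]mulr_natr natrM expr2.
  have e0n : e0 * n%:R ^+ 2 <= e / 16 * n%:R ^+ 2 by rewrite ler_pM2r.
  have := le_trans cells TT.
  under eq_bigr => x _ do rewrite !sumrB.
  by rewrite !sumrB nn sum_adj_neq; lra.
have bad_sum : \sum_x \sum_y (bad x y)%:R <= n%:R * (n%:R / k0%:R + 1) + e1 * n%:R ^+ 2.
  apply: (@le_trans _ _ (\sum_x \sum_y (f x == f y)%:R + irregular_weight (adj G') f e1)).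
    rewrite /irregular_weight -big_split; apply: ler_sum => x _ /=.
    rewrite -big_split; apply: ler_sum => y _ /=; rewrite /bad.
    by case: (f x == f y); case: regular_pair; rewrite /= ?addr0 ?add0r ?lerDl.
  apply: lerD => //.
  have -> : n%:R * (n%:R / k0%:R + 1) = \sum_(x : 'I_n) (n%:R / k0%:R + 1) :> R.
    by rewrite sumr_const card_ord -[RHS]mulr_natl.
  apply: ler_sum => x _.
  apply: (@le_trans _ _ ((n %/ k0).+1)%:R); last first.
    by rewrite -natr1 lerD2r ler_pdivlMr ?ltr0n // -natrM ler_nat leq_trunc_div.
  apply: (@le_trans _ _ (#|[pred y : 'I_n | y %% k0 == x %% k0]%N|%:R : R)); last first.
    by rewrite ler_nat; apply: card_residue.
  rewrite -sum1_card natr_sum [leRHS]big_mkcond; apply: ler_sum => y _.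
  rewrite inE; case: (f x =P f y) => [/ff0/(congr1 val)/= fxy|_].
    by rewrite fxy eqxx.
  by case: ifP.
pose C := n%:R ^- 2 * (\sum_x \sum_y edit_cost p alV x y + M%:R ^+ 2 * \sum_x \sum_y (bad x y)%:R).
have C_le : C <= g - 3 * e / 4.
  rewrite /C mulrC ler_pdivrMr //.
  have b1 : M%:R ^+ 2 * \sum_x \sum_y (bad x y)%:R <=
      M%:R ^+ 2 * (n%:R * (n%:R / k0%:R + 1) + e1 * n%:R ^+ 2) by rewrite ler_pM2l.
  have b2 : M%:R ^+ 2 * (n%:R * (n%:R / k0%:R + 1) + e1 * n%:R ^+ 2) =
      (M%:R ^+ 2 / k0%:R + M%:R ^+ 2 / n%:R + M%:R ^+ 2 * e1) * n%:R ^+ 2.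
    by field; rewrite !lt0r_neq0 // ltr0n.
  have b3 : (M%:R ^+ 2 / k0%:R + M%:R ^+ 2 / n%:R + M%:R ^+ 2 * e1) * n%:R ^+ 2 <=
      (3 * e / 32) * n%:R ^+ 2 by rewrite ler_pM2r //; lra.
  by have en : 0 < e * n%:R ^+ 2 by [rewrite mulr_gt0]; move: cost_sum b1; rewrite b2; lra.
pose wt (_ : 'I_n) : R := n%:R^-1.
have wt0 c : 0 <= wt c by rewrite invr_ge0 ltW.
have wt1 : \sum_c wt c = 1.
  by rewrite sumr_const card_ord -[LHS]mulr_natl divff // lt0r_neq0.
have [z zle] := exists_pair_sum_le om wt0 wt1.
have {}zle : pair_sum om z <= M%:R ^+ 2 * C.
  apply: le_trans zle _.
  have CE i j : \sum_a \sum_b wt a * wt b * om i j a b = C.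
    rewrite /C mulr_sumr -big_split mulr_sumr; apply: eq_bigr => x _ /=.
    rewrite mulr_sumr -big_split mulr_sumr; apply: eq_bigr => y _ /=.
    by rewrite /wt /om -exprVn expr2.
  have C0 : 0 <= C.
    rewrite mulr_ge0 ?invr_ge0 ?(ltW n2) // addr_ge0 //.
      apply: sumr_ge0 => x _; apply: sumr_ge0 => y _.
      by have /andP[] := edit_cost01 alV x y p01.
    by rewrite mulr_ge0 ?(ltW M2) //; apply: sumr_ge0 => x _; apply: sumr_ge0.
  apply: (@le_trans _ _ (\sum_(i < M) \sum_(j < M) C)).
    apply: ler_sum => i _; rewrite big_mkcond; apply: ler_sum => j _.
    by rewrite CE; case: ifP.
  by rewrite !sumr_const card_ord -mulrnA -[X in X <= _]mulr_natl natrM expr2.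
have zle2 : pair_sum om z <= M%:R ^+ 2 * (g - 3 * e / 4).
  by apply: le_trans zle _; rewrite ler_pM2l.
have good i j : i != j -> ~~ bad (z i) (z j).
  move=> ij; apply/negP => bd; have := pair_sum_ge z om0 ij.
  rewrite /om bd mulr1 => le1; have /andP[ec _] := edit_cost01 alV (z i) (z j) p01.
  have : M%:R ^+ 2 <= M%:R ^+ 2 * (g - 3 * e / 4).
    by apply: le_trans zle2; apply: le_trans le1; rewrite lerDr.
  by rewrite -[X in X <= _]mulr1 ler_pM2l //; move: g1; lra.
have [psi psiP] : exists psi : 'I_h -> 'I_M, forall u v, u != v ->
    psi u != psi v /\ alV (adj H u v) (z (psi u)) (z (psi v)).
  apply: contrapT => noemb.
  pose alM be (i j : 'I_M) := alV be (z i) (z j).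
  have symM be i j : alM be i j = alM be j i by rewrite /alM /alV densC.
  have covM i j : i != j -> alM true i j || alM false i j.
    by move=> _; rewrite /alM /alV; case: leP => //= ?; lra.
  have low := MP alM symM covM noemb.
  have : \sum_u \sum_(v | u != v) edit_cost p alM u v <= pair_sum om z.
    apply: ler_sum => i _; apply: ler_sum => j _.
    by rewrite /om lerDl mulr_ge0 // ltW.
  have : 0 < M%:R ^+ 2 * (e / 4) by rewrite mulr_gt0 // divr_gt0.
  by lra.
pose Cu u := cell f (f (z (psi u))).
have Cpos u : 0 < #|Cu u|%:R :> R.
  by rewrite ltr0n; apply/card_gt0P; exists (z (psi u)); rewrite inE.
have [||||phi [phiC phiA]] := @induced_embedding R _ (adj G') al symG' al0 al1 h (adj H) Cu
    (fun u => e1 * #|Cu u|%:R).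
- by move=> u v; apply: adjC.
- by move=> u; rewrite mulr_gt0.
- by move=> u; rewrite mulrA ltr_pM2r.
- move=> u v U W uv Us Ws Ubig Wbig; have [psuv alvu] := psiP u v uv.
  have := good _ _ psuv; rewrite /bad negb_or negbK => /andP[_ reg].
  have /forallP/(_ U)/forallP/(_ W) := reg; rewrite Us Ws Ubig Wbig /=.
  rewrite ler_norml => /andP[r1 r2].
  have UW0 : 0 <= #|U|%:R * #|W|%:R :> R by rewrite mulr_ge0.
  have E : \sum_(x in U) #|[set y in W | adj G' x y]|%:R = density R (adj G') U W * (#|U|%:R * #|W|%:R).
    rewrite -edge_sumE /edge_sum; apply: eq_bigr => x _.
    rewrite -sum1_card natr_sum big_mkcond [RHS]big_mkcond; apply: eq_bigr => y _.
    by rewrite inE; case: (y \in W); case: (adj G' x y).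
  move: alvu; rewrite /alV /dens /cell_density -/(Cu u) -/(Cu v); case: (adj H u v) => D1.
    have -> : \sum_(x in U) #|[set y in W | adj G' x y == true]|%:R =
        \sum_(x in U) #|[set y in W | adj G' x y]|%:R :> R.
      by apply: eq_bigr => x _; congr (_%:R); apply: eq_card => y; rewrite !inE eqb_id.
    by rewrite E ler_wpM2r // /al; move: e1al; rewrite /al; lra.
  have -> : \sum_(x in U) #|[set y in W | adj G' x y == false]|%:R =
      #|U|%:R * #|W|%:R - \sum_(x in U) #|[set y in W | adj G' x y]|%:R :> R.
    have -> : #|U|%:R * #|W|%:R = \sum_(x in U) #|W|%:R :> R.
      by rewrite sumr_const -[RHS]mulr_natl.
    rewrite -sumrB; apply: eq_bigr => x _.
    have cW := cardsID [set y | adj G' x y] W.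
    have -> : [set y in W | adj G' x y == false] = W :\: [set y | adj G' x y].
      by apply/finset.setP => y; rewrite !inE andbC; case: (adj G' x y).
    have -> : [set y in W | adj G' x y] = W :&: [set y | adj G' x y].
      by apply/finset.setP => y; rewrite !inE.
    by rewrite -cW natrD addrC addKr.
  have : al * (#|U|%:R * #|W|%:R) <= (1 - density R (adj G') U W) * (#|U|%:R * #|W|%:R).
    by rewrite ler_wpM2r // /al; move: e1al; rewrite /al; lra.
  by rewrite E mulrBl mul1r.
move/negP: noind; apply; apply/existsP; exists [ffun u => phi u]; apply/andP; split.
  apply/injectiveP => u v; rewrite !ffunE => E; apply/eqP/negPn/negP => uv.
  have [psuv _] := psiP u v uv; have := good _ _ psuv; rewrite /bad negb_or => /andP[/eqP fne _].
  apply: fne; have := phiC u; have := phiC v; rewrite !inE E => /eqP <- /eqP <-.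
  by [].
apply/forallP => u; apply/forallP => v; rewrite !ffunE.
by have [->|uv] := eqVneq u v; [rewrite !adjxx|rewrite phiA].
Qed.
End LowerBound.

(** * Upper bound *)

Section UpperBound.
Variables (R : realType) (t h l : nat) (p : R).
Hypotheses (h3t : (3 * t < h)%N) (lh : (l.-1 * (2 * t + 1) < h)%N).
Hypotheses (p01 : 0 <= p <= 1).

Let D : R := t%:R * (1 - p) + l.-1%:R * p.
Hypothesis D0 : 0 < D.

Let weight (c : 'I_t + 'I_l.-1) : R := if is_inl c then (1 - p) / D else p / D.

Let weight_ge0 c : 0 <= weight c.
Proof.
have D0' := D0; have /andP[? ?] := p01.
by rewrite /weight; case: ifP => _; rewrite divr_ge0 ?(ltW D0) ?subr_ge0.
Qed.

Let sum_colors (F : 'I_t + 'I_l.-1 -> R) (a b : R) :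
  (forall c, F c = if is_inl c then a else b) ->
  \sum_c F c = t%:R * a + l.-1%:R * b.
Proof.
move=> FE; rewrite big_sumType /=.
rewrite (eq_bigr (fun=> a)); last by move=> c _; rewrite FE.
rewrite [X in _ + X](eq_bigr (fun=> b)); last by move=> c _; rewrite FE.
by rewrite !sumr_const !card_ord -[a *+ _]mulr_natl -[b *+ _]mulr_natl.
Qed.

Let weight_sum : \sum_c weight c = 1.
Proof.
rewrite (sum_colors (a := (1 - p) / D) (b := p / D)) //.
by rewrite !mulrA -mulrDl divff // lt0r_neq0.
Qed.

(** Rounding down the edge number leaves at most one extra nonedge; its expected cost is the last
    term, which disappears in the limit. *)
Lemma edit_upper_bound (n : nat) (G : graph 'I_n) :
  #|edges G|%:Z = Num.floor (p * 'C(n, 2)%:R) ->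
  exists G' : graph 'I_n, ~~ induced_subgraph (graph_power (cycle_graph h) t) G' /\
  #|(edges G :\: edges G') :|: (edges G' :\: edges G)|%:R <=
    p * (1 - p) / D * 'C(n, 2)%:R + l.-1%:R * (p / D) ^+ 2.
Proof.
move=> Gm; have /andP[p0 p1] := p01.
pose om (i j : 'I_n) (a b : 'I_t + 'I_l.-1) : R :=
  ((a == b) && (adj G i j == is_inl a))%:R.
have [z zle] := exists_pair_sum_le om weight_ge0 weight_sum.
pose r (i j : 'I_n) := if z i == z j then ~~ is_inl (z i) else adj G i j.
pose G' := graph_of_rel r.
have symr i j : r i j = r j i.
  by rewrite /r eq_sym; case: eqP => [->//|_]; rewrite adjC.
have adj' i j : adj G' i j = (i != j) && r i j.
  by rewrite adj_graph_of_rel (symr j i) orbb.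
exists G'; split.
  apply/negP => /existsP[f /andP[/injectiveP f_inj /forallP fadj]].
  have [x [y [xy zxy Axy]]] := cycle_power_unsplittable h3t lh (fun x => z (f x)).
  have /forallP/(_ y)/eqP := fadj x; rewrite Axy adj' (inj_eq f_inj) xy /r zxy eqxx /=.
  by case: (is_inl _).
have dif : 2 * #|(edges G :\: edges G') :|: (edges G' :\: edges G)|%:R <= pair_sum om z.
  rewrite -sum_adj_neq /pair_sum; apply: ler_sum => i _.
  rewrite (bigD1 i) //= !adjxx eqxx add0r [leLHS]big_mkcond [leRHS]big_mkcond.
  apply: ler_sum => j _; rewrite eq_sym; case: (boolP (i != j)) => // ij.
  rewrite adj' ij /= /om /r; case: (z i == z j); last by rewrite eqxx.
  by case: (adj G i j); case: (is_inl _).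
have inner i j : \sum_a \sum_b weight a * weight b * om i j a b =
    if adj G i j then t%:R * ((1 - p) / D) ^+ 2 else l.-1%:R * (p / D) ^+ 2.
  transitivity (\sum_a weight a ^+ 2 * (adj G i j == is_inl a)%:R).
    apply: eq_bigr => a _; rewrite (bigD1 a) //= big1 => [|b ba].
      by rewrite /om eqxx addr0 expr2.
    by rewrite /om eq_sym (negbTE ba) mulr0.
  rewrite (sum_colors (a := ((1 - p) / D) ^+ 2 * (adj G i j)%:R)
    (b := (p / D) ^+ 2 * (~~ adj G i j)%:R)).
    by case: (adj G i j); rewrite /= ?mulr1 ?mulr0 ?addr0 ?add0r.
  by move=> c; rewrite /weight; case: (is_inl c); rewrite ?eqb_id ?eqbF_neg.
pose al2 := t%:R * ((1 - p) / D) ^+ 2; pose be2 := l.-1%:R * (p / D) ^+ 2.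
have tot : \sum_i \sum_(j | i != j) \sum_a \sum_b weight a * weight b * om i j a b =
    2 * (al2 * #|edges G|%:R + be2 * ('C(n, 2)%:R - #|edges G|%:R)).
  have e1 : \sum_i \sum_j (adj G i j)%:R = 2 * #|edges G|%:R :> R.
    rewrite -edge_sum_edges /edge_sum; apply: eq_big => [i|i _]; first by rewrite inE.
    by apply: eq_bigl => j; rewrite inE.
  have e2 : \sum_(i : 'I_n) \sum_(j : 'I_n | i != j) 1 = 2 * 'C(n, 2)%:R :> R.
    have -> : 2 * 'C(n, 2)%:R = \sum_(i : 'I_n) (n%:R - 1) :> R.
      by rewrite bin2R sumr_const card_ord -[RHS]mulr_natl.
    apply: eq_bigr => i _; have := cardC1 i; rewrite card_ord => cE.
    rewrite sumr_const (_ : #|_| = n.-1); last first.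
      by rewrite -cE; apply: eq_card => j; rewrite !inE unfold_in /= eq_sym.
    have n0 : (0 < n)%N := leq_ltn_trans (leq0n i) (ltn_ord i).
    have <- : n.-1%:R + 1 = n%:R :> R by rewrite natr1 prednK.
    by rewrite addrK.
  transitivity (\sum_i (al2 * (\sum_j (adj G i j)%:R) +
      be2 * (\sum_(j | i != j) 1 - \sum_j (adj G i j)%:R))); last first.
    by rewrite big_split /= -!mulr_sumr sumrB e1 e2; ring.
  apply: eq_bigr => i _; have -> : \sum_j (adj G i j)%:R = \sum_(j | i != j) (adj G i j)%:R :> R.
    rewrite (bigD1 i) //= adjxx add0r; by apply: eq_bigl => j; rewrite eq_sym.
  rewrite -sumrB !mulr_sumr -big_split; apply: eq_bigr => j ij /=; rewrite inner.
  by case: (adj G i j); rewrite -/al2 -/be2 ?subrr ?subr0 ?mulr0 ?mulr1 ?addr0 ?add0r.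
have C0 : 0 <= p * 'C(n, 2)%:R by rewrite mulr_ge0.
have /andP[m1 m2] : #|edges G|%:R <= p * 'C(n, 2)%:R < #|edges G|%:R + 1.
  have := floor_itv (p * 'C(n, 2)%:R); rewrite -Gm => /andP[h1 h2].
  by rewrite h1 -[X in _ < X + _]/(#|edges G|%:Z%:~R) -[1]/(1%:~R) -intrD.
have al0 : 0 <= al2 by rewrite mulr_ge0 // sqr_ge0.
have be0 : 0 <= be2 by rewrite mulr_ge0 // sqr_ge0.
have := le_trans dif zle; rewrite tot -subr_ge0 => h1.
have h2 : al2 * #|edges G|%:R <= al2 * (p * 'C(n, 2)%:R) by rewrite ler_wpM2l.
have h3 : be2 * ('C(n, 2)%:R - #|edges G|%:R) <=
    be2 * ((1 - p) * 'C(n, 2)%:R + 1) by rewrite ler_wpM2l //; lra.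
(* [al2] and [be2] are the expected costs of an edge and of a nonedge; their mixture is
   [p * (1 - p) * D / D ^+ 2]. *)
have -> : p * (1 - p) / D = al2 * p + be2 * (1 - p).
  by have := lt0r_neq0 D0; rewrite /al2 /be2 /D => Dne; field.
by rewrite -/be2; lra.
Qed.
End UpperBound.

(** * The edit distance function *)

(** The two bounds themselves give the existence of the limit. [0 <= g <= 1] copes with the initial
    values 0 and 1 of the maximum and the minimum, and [c] is absorbed by [e * 'C(n, 2)]. *)
Lemma max_class_dist_cvg (R : realType) (h : nat) (H : graph 'I_h) (p g c : R) :
  0 <= g <= 1 ->
  (forall n (G : graph 'I_n), #|edges G|%:Z = Num.floor (p * 'C(n, 2)%:R) ->
    exists G' : graph 'I_n, ~~ induced_subgraph H G' /\
    #|(edges G :\: edges G') :|: (edges G' :\: edges G)|%:R <= g * 'C(n, 2)%:R + c) ->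
  (forall e : R, 0 < e -> exists N : nat, forall n, (N <= n)%N ->
    exists G : graph 'I_n, #|edges G|%:Z = Num.floor (p * 'C(n, 2)%:R) /\
    forall G' : graph 'I_n, ~~ induced_subgraph H G' ->
    (g - e) * n%:R ^+ 2 <= 2 * #|(edges G :\: edges G') :|: (edges G' :\: edges G)|%:R) ->
  (max_class_dist (Forb H) p n @[n --> \oo] --> g)%classic.
Proof.
move=> /andP[g0 g1] upper lower; apply/cvgrPdist_le => e e0.
have [N1 N1P] := lower e e0.
pose N2 := (Num.truncn (c / e)).+2.
exists (maxn (maxn 2 N1) N2) => // n /=.
rewrite !geq_max => /andP[/andP[n2 /N1P[G [Gm Gfar]]] nN2].
have nR : 2 <= n%:R :> R by rewrite (ler_nat _ 2).
have C2 := bin2R R n.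
have Cn : n%:R - 1 <= 'C(n, 2)%:R :> R.
  have : 2 * (n%:R - 1) <= n%:R * (n%:R - 1) :> R by rewrite ler_wpM2r //; lra.
  lra.
have C0 : 0 < 'C(n, 2)%:R :> R by lra.
have cC : c <= e * 'C(n, 2)%:R.
  rewrite mulrC -ler_pdivrMr //; apply: le_trans Cn; rewrite lerBrDr.
  have := ltW (truncnS_gt (c / e)) => h1.
  have : ((Num.truncn (c / e)).+1%:R + 1 : R) <= n%:R by rewrite natr1 ler_nat.
  lra.
rewrite ler_distlC; apply/andP; split.
  have GP : #|edges G|%:Z == Num.floor (p * 'C(n, 2)%:R) by rewrite Gm.
  apply: le_trans (le_bigmax_cond 0 (fun G : graph 'I_n => class_dist R (Forb H) G) GP).
  apply: le_bigmin => [|G' G'P]; first by lra.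
  rewrite /graph_dist card_ord ler_pdivlMr //.
  have [ge|ge] := leP (g - e) 0.
    by apply: le_trans (_ : 0 <= _) => //; rewrite mulr_le0_ge0 // ltW.
  have := Gfar G' G'P.
  have : (g - e) * (2 * 'C(n, 2)%:R) <= (g - e) * n%:R ^+ 2.
    rewrite ler_pM2l // C2 expr2 ler_pM2l; lra.
  lra.
apply: bigmax_le => [|G1 /eqP G1m]; first by lra.
have [G' [G'P G'd]] := upper n G1 G1m.
apply: le_trans (bigmin_le_cond 1 (fun G' : graph 'I_n => graph_dist R G1 G') G'P) _.
rewrite /graph_dist card_ord ler_pdivrMr // mulrDl.
by apply: le_trans G'd _; rewrite lerD2l.
Qed.

Lemma ceil_natdiv (R : realType) (h k : nat) :
  Num.ceil (h%:R / (k.+1)%:R : R) = ((h + k) %/ k.+1)%N%:Z.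
Proof.
have k0 : 0 < k.+1%:R :> R by rewrite ltr0n.
apply: ceil_def; set l := (_ %/ _)%N.
have h1 : (h <= l * k.+1)%N.
  have := ltn_ceil (h + k) (isT : 0 < k.+1)%N; rewrite -/l mulSn; lia.
have h2 : (l * k.+1 <= h + k)%N by apply: leq_trunc_div.
rewrite intrB -!pmulrn ltr_pdivlMr // ler_pdivrMr // -natrM ler_nat h1 andbT.
rewrite mulrBl mul1r ltrBlDr -natrM -natrD ltr_nat; lia.
Qed.

Theorem theorem1p3 (R : realType) (t h : nat)
  (ht : (1 <= t)%N) (hh : (4 * t * (2 * t + 1) <= h)%N) (hdvd : (t + 1 %| h)%N) :
  let c0 : R := ((h %/ t + 1) %/ 3)%N%:R in
  let l0 : R := (Num.ceil (h%:R / (2 * t + 1)%N%:R : R))%:~R in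
  let p0 : R := t%:R / (c0 * l0 - c0 - l0 + t%:R + 1) in
  forall p : R, p0 <= p <= 1 / l0 ->
    cvgn (max_class_dist (Forb (graph_power (cycle_graph h) t)) p) /\
    edit_distance (Forb (graph_power (cycle_graph h) t)) p =
      p * (1 - p) / (t%:R + (l0 - t%:R - 1) * p).
Proof.
move=> c0 l0 p0 p /andP[p0p pl0].
pose c0n := ((h %/ t + 1) %/ 3)%N.
pose l := ((h + 2 * t) %/ (2 * t).+1)%N.
have l0E : l0 = l%:R by rewrite /l0 addn1 ceil_natdiv.
have hl : (h <= l * (2 * t + 1))%N.
  have := ltn_ceil (h + 2 * t) (isT : 0 < (2 * t).+1)%N; rewrite -/l mulSn addn1; lia.
have l4 : (4 * t <= l)%N by exact: leq_cliques hh hl.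
have l1 : (0 < l)%N by apply: leq_trans l4; rewrite muln_gt0.
have lh : (l.-1 * (2 * t + 1) < h)%N.
  have h2 : (l * (2 * t).+1 <= h + 2 * t)%N by apply: leq_trunc_div.
  by rewrite -(prednK l1) mulSn in h2; rewrite addn1; lia.
have c01 : (0 < c0n)%N by exact: c0_gt0 ht hh erefl.
have tR : 1 <= t%:R :> R by rewrite (ler_nat _ 1).
have l4R : 4 <= l%:R :> R by rewrite (ler_nat _ 4) (leq_trans _ l4) // leq_pmulr.
have c0R : 1 <= c0n%:R :> R by rewrite (ler_nat _ 1).
(* The denominator of [p0] in factored form, as the double count over an induced cycle uses it. *)
have den : c0 * l0 - c0 - l0 + t%:R + 1 = (c0n%:R - 1) * (l%:R - 1) + t%:R.
  by rewrite l0E /c0 -/c0n; ring.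
have cl0 : 0 <= (c0n%:R - 1) * (l%:R - 1) :> R by rewrite mulr_ge0 //; lra.
have den0 : 0 < (c0n%:R - 1) * (l%:R - 1) + t%:R :> R by lra.
have tp : t%:R <= p * ((c0n%:R - 1) * (l%:R - 1) + t%:R).
  by move: p0p; rewrite /p0 den ler_pdivrMr.
have p_gt0 : 0 < p by apply: lt_le_trans p0p; rewrite /p0 den divr_gt0 //; lra.
have lp : l%:R * p <= 1.
  by move: pl0; rewrite l0E ler_pdivlMr; [rewrite mulrC|lra].
have p4 : 4 * p <= 1 by apply: le_trans lp; rewrite ler_pM2r.
have p01 : 0 <= p <= 1 by apply/andP; split; lra.
have lE : l.-1%:R = l%:R - 1 :> R by apply/eqP; rewrite eq_sym subr_eq natr1 prednK.
pose D : R := t%:R * (1 - p) + l.-1%:R * p.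
have DE : t%:R + (l0 - t%:R - 1) * p = D by rewrite /D l0E lE; ring.
have tp1 : 1 * (1 - p) <= t%:R * (1 - p) by rewrite ler_wpM2r //; lra.
have lp0 : 0 <= l.-1%:R * p by rewrite mulr_ge0 // ltW.
have D1 : 1 - p <= D by rewrite /D; lra.
have D0 : 0 < D by lra.
rewrite DE; set g := _ / D.
have g01 : 0 <= g <= 1.
  rewrite /g divr_ge0 ?mulr_ge0 ?(ltW D0) //=; try lra.
  rewrite ler_pdivrMr // mul1r; apply: le_trans D1.
  by rewrite -[leRHS]mul1r ler_wpM2r //; lra.
have h3t : (3 * t < h)%N by exact: ltn_power_length.
have hdvd' : (t.+1 %| h)%N by rewrite -addn1.
have g1 : g <= 1 by case/andP: g01.
have crg k (al : bool -> rel 'I_k) (x : 'I_k -> R) :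
    (forall be u v, al be u v = al be v u) ->
    (forall u v, al true u v || al false u v) ->
    (forall u, ~~ (al true u u && al false u u)) ->
    ~ embeds (graph_power (cycle_graph h) t) al ->
    (forall u, 0 <= x u) -> \sum_u x u = 1 -> g <= quad_form (edit_cost p al) x.
  move=> alC cover diag nemb x0 x1; rewrite /g -DE l0E.
  exact: (crg_lower_bound ht hh hdvd' lh hl (erefl c0n)).
have cv := max_class_dist_cvg g01
  (fun n G => edit_upper_bound h3t lh p01 D0 (n := n) (G := G))
  (edit_lower_bound p01 g1 crg).
by split; [apply/cvg_ex; exists g | apply: cvg_lim].
Qed.
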